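(* Let $d\ge 1$, let $\omega\in\Omega_{\langle d]}$ and let $\alpha\in\mathbb R$. Then the following hold. (1) Each pure stratum $\mathsf R_\omega\subset\mathbb R^d_{\mathrm{coef}}$ is homeomorphic to an open ball of codimension $|\omega|'$ (that is, of dimension $d-|\omega|'$). (2) The space $\sigma_\omega$ is homeomorphic to a closed $(d-|\omega|'-1)$-ball, and the space $\sigma_{\alpha,\omega}$ is homeomorphic to a closed $(d-|\omega|'-2)$-ball. The space $e_\omega$ is a positive cone over $\sigma_\omega$, and $e_{\alpha,\omega}$ is a positive cone over $\sigma_{\alpha,\omega}$. (3) For each $\hat\omega\in\Omega_{\langle d]}$, the strata $\{\mathsf R_\omega\}_{\omega\preceq\hat\omega}$ define the structure of a cell complex on the real affine variety $\mathsf R_{\hat\omega_\succeq}\subset\mathbb R^d_{\mathrm{coef}}$. The attaching maps $\Phi^\partial_\omega:\partial e_\omega\to\mathsf R_{\omega_\succeq}\setminus\mathsf R_\omega$ for the cells $e_\omega$ are the restrictions to $\partial e_\omega$ of the maps $\Phi_\omega(D',D'')=V(D'+D''+\tau(D''))$. (4) The space $\mathbb R^d_{\mathrm{coef}}$ admits a $1$-parameter flow $\Psi_t$ which has a single stationary point $\mathbf 0$ (a source), is transversal to each sphere $S^{d-1}_{\mathrm{coef}}\subset\mathbb R^d_{\mathrm{coef}}$ centered on $\mathbf 0$, and preserves each stratum $\mathsf R_\omega$, $\omega\in\Omega_{\langle d]}$. Thus the cellular structure on $\mathbb R^d_{\mathrm{coef}}$ described in (3) is a cone over a similar cellular structure on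 $S^{d-1}_{\mathrm{coef}}$.
   Context: Combinatorics. $\Omega$ is the set of maps $\omega:\mathbb N=\{1,2,\dots\}\to\mathbb Z_{\ge0}$ with finite support $\mathrm{supp}(\omega)$ such that $\omega(i)\ne0$ implies $\omega(j)\neq 0$ for all $j<i$; such $\omega$ is written as the finite sequence $(\omega(1),\dots,\omega(q))$, $q=|\mathrm{supp}(\omega)|$. Put $|\omega|=\sum_i\omega(i)$ and $|\omega|'=\sum_{i\in\mathrm{supp}(\omega)}(\omega(i)-1)$. An elementary merge $\mathsf M_j$ replaces two adjacent entries $\omega(j),\omega(j+1)$ by the single entry $\omega(j)+\omega(j+1)$; an elementary insert $\mathsf I_j$ inserts a new entry equal to $2$ at some position of the sequence (possibly at the beginning or the end). Write $\omega_1\succeq\omega_2$ if $\omega_2$ can be obtained from $\omega_1$ by a (possibly empty) sequence of elementary merges and inserts. $\Omega_{\langle d]}$ is the set of $\omega\in\Omega$ with $|\omega|\le d$ and $|\omega|\equiv d\pmod 2$. Polynomials. $\mathbb R^d_{\mathrm{coef}}$ is the space of coefficient vectors of real monic polynomials of degree $d$; $\mathbf 0$ corresponds to $z^d$. $\mathsf{Sym}^mY=Y^m/S_m$ is the $m$-th symmetric power (its points are effective divisors of degree $m$ on $Y$). $\tau$ is complex conjugation on $\mathbb C$, and the Viète homeomorphism $V:(\mathsf{Sym}^d\mathbb C)^\tau\to\mathbb R^d_{\mathrm{coef}}$ sends a conjugation-invariant divisor of degree $d$ to the monic polynomial with that root divisor. The real divisor $D_{\mathbb R}(P)$ is the part of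 the root divisor supported in $\mathbb R$; its combinatorial type is the sequence of multiplicities of the real roots listed in increasing order. $\mathsf R_\omega\subset\mathbb R^d_{\mathrm{coef}}$ is the set of polynomials whose real divisor has combinatorial type $\omega$, and $\mathsf R_{\omega_\succeq}$ is the closure of $\mathsf R_\omega$. Cells. Let $\mathbb H=\{z\in\mathbb C:\mathrm{Im}(z)\ge0\}$ and $\mathbb H^\circ=\{\mathrm{Im}(z)>0\}$. For $\omega\in\Omega_{\langle d]}$ with $p=|\mathrm{supp}(\omega)|$ and $m=(d-|\omega|)/2$, let $\Pi_\omega=\{y\in\mathbb R^p:y_1\le\dots\le y_p\}\approx\mathsf{Sym}^p\mathbb R$, where $y$ represents the real divisor $D'=\sum_i\omega(i)\,y_i$, and $\Pi_\omega^\circ=\{y_1<\dots<y_p\}$. Put $e_\omega=\Pi_\omega\times\mathsf{Sym}^m\mathbb H$, $e_\omega^\circ=\Pi^\circ_\omega\times\mathsf{Sym}^m\mathbb H^\circ$, $\partial e_\omega=e_\omega\setminus e^\circ_\omega$. A point of $e_\omega$ is a pair $(D',D'')$. $\sigma_\omega\subset e_\omega$ is the set of pairs such that $\mathrm{supp}(D')\cup\mathrm{supp}(D'')$ is contained in the closed unit disk centered at $0$ but not in its interior. A divisor of degree $d$ is $\alpha$-balanced if the sum of its points with multiplicity equals $\alpha d$. $e_{\alpha,\omega}\subset e_\omega$ consists of the pairs for which $D'+D''+\tau(D'')$ is $\alpha$-balanced, and $\sigma_{\alpha,\omega}\subset e_{\alpha,\omega}$ consists of those pairs for which $\mathrm{supp}(D')\cup\mathrm{supp}(D'')$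 lies in the closed unit disk centered at $\alpha$ but not in its interior. The positive cone over $\sigma$ is $([0,\infty)\times\sigma)/(\{0\}\times\sigma)$. A cell complex here means a Hausdorff space $Z$ that is a disjoint union of subsets $e_a^\circ$, each homeomorphic to an open ball $B_a^\circ$ of some dimension $d_a$, such that the homeomorphism $B_a^\circ\to e_a^\circ$ extends to a continuous map $\phi_a:B_a\to Z$, where $B_a$ is either a closed ball or an open ball together with an open hemisphere of its boundary sphere, $\phi_a(\partial B_a)$ lies in a union of finitely many cells of dimension less than $d_a$, and $Y\subset Z$ is closed if $\phi_a^{-1}(Y\cap\phi_a(B_a))$ is closed in $B_a$ for each $a$. Closed cells are not required to be closed balls.
   Formalization: For ω=(d), σ_ω is two points, not a closed 0-ball, so it is stated to be a 0-sphere; in (3) a cell already closed in the space may be an open ball, as the line R_(d) needs; that the closure is a ''real affine variety'' (false for d=2, ω=(1,1)) is not asserted. *)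

(* Defs.v *)
From Stdlib Require Relation_Operators.
From HB Require Import structures.
From mathcomp Require Import all_boot all_order all_algebra all_fingroup generic_quotient.
From mathcomp Require Import complex polyrcf.
From mathcomp Require Import all_classical all_reals all_analysis.
Set Implicit Arguments.
Unset Strict Implicit.
Unset Printing Implicit Defensive.
Import Order.TTheory GRing.Theory Num.Theory.
Import numFieldNormedType.Exports.
Local Open Scope classical_set_scope.
Local Open Scope ring_scope.
Local Open Scope quotient_scope.

Section Topology.

Definition homeo_on (X Y : topologicalType) (A : set X) (B : set Y)
    (f : X -> Y) : Prop :=
  [/\ set_bij A B f, {within A, continuous f} &
      exists2 g : Y -> X, {within B, continuous g} & {in A, cancel f g}].

Definition homeomorphic (X Y : topologicalType) (A : set X) (B : set Y) : Prop :=
  exists f : X -> Y, homeo_on A B f.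

Definition pair_homeomorphic (X Y : topologicalType)
    (A A0 : set X) (B B0 : set Y) : Prop :=
  exists2 f : X -> Y, homeo_on A B f & f @` A0 = B0.

(* Meant for W contained in Z: points outside Z are isolated in [subspace Z]. *)
Definition closed_in (X : topologicalType) (Z W : set X) : Prop :=
  closed (W : set (subspace Z)).

Variable R : realType.

Definition dot n (x y : 'rV[R]_n) : R := \sum_(i < n) x 0 i * y 0 i.

Definition oball n : set 'rV[R]_n := [set x | dot x x < 1].
Definition cball n : set 'rV[R]_n := [set x | dot x x <= 1].
Definition sphere n (r : R) : set 'rV[R]_n := [set x | dot x x = r ^+ 2].

(* The open ball together with the open hemisphere of its boundary sphere on
   which the first coordinate is positive. *)
Definition hball n : set 'rV[R]_n :=
  @oball n `|`
  [set x | sphere 1 x /\ exists2 i : 'I_n, i = 0%N :> nat & 0 < x 0 i].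

(* A closed ball of integer dimension [n]; the closed (-1)-ball is empty. *)
Definition is_closed_ball (X : topologicalType) (A : set X) (n : int) : Prop :=
  if n is Posz k then homeomorphic A (@cball k) else n = -1 /\ A = set0.

(* [q] exhibits [X] as ([0, oo) x A) / ({0} x A) with apex [o]: up to
   homeomorphism, [X] carries the quotient topology along [q].
   The apex is present also when [A] is empty, as usual for a quotient X / A. *)
Definition cone_map (U T : topologicalType) (X : set U) (A : set T)
    (o : U) (q : R * T -> U) : Prop :=
  let P := [set t : R | 0 < t] `*` A in
  let C := [set t : R | 0 <= t] `*` A in
  [/\ X o,
      forall a, A a -> q (0, a) = o,
      set_bij P (X `\ o) q &
      forall W : set U, W `<=` X ->
        (closed_in X W <-> closed_in C (C `&` q @^-1` W))].

Definition is_positive_cone (U T : topologicalType) (X : set U) (A : set T) :=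
  exists (o : U) (q : R * T -> U), cone_map X A o q.

(* The space [Z] is a cell complex with cells [cell a], a \in K.  The pair
   (B_a, interior of B_a) is presented by any homeomorphic pair [(B a, B0 a)].
   Beside closed balls and half-open balls, a cell that is already closed in [Z]
   (so that there is nothing to attach) may be presented by the open ball
   itself: the line of all polynomials (z - y)^d is such a cell. *)
Definition cell_complex (T : topologicalType) (Z : set T) (I : Type)
    (K : set I) (cell : I -> set T) (dim : I -> nat)
    (X : I -> topologicalType) (B B0 : forall a, set (X a))
    (phi : forall a, X a -> T) : Prop :=
  [/\ hausdorff_space (subspace Z),
      trivIset K cell /\ \bigcup_(a in K) cell a = Z,
      (forall a, K a ->
         [\/ pair_homeomorphic (B a) (B0 a) (@cball (dim a)) (@oball (dim a)),
             pair_homeomorphic (B a) (B0 a) (@hball (dim a)) (@oball (dim a)) |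
             pair_homeomorphic (B a) (B0 a) (@oball (dim a)) (@oball (dim a)) /\
             closed_in Z (cell a)]),
      (forall a, K a ->
         [/\ {within B a, continuous (phi a)},
             phi a @` B a `<=` Z,
             homeo_on (B0 a) (cell a) (phi a) &
             exists J : set I, [/\ finite_set J, J `<=` K,
               (forall j, J j -> (dim j < dim a)%N) &
               phi a @` (B a `\` B0 a) `<=` \bigcup_(j in J) cell j]]) &
      (forall Y : set T, Y `<=` Z ->
         (forall a, K a -> closed_in (B a) (B a `&` phi a @^-1` Y)) ->
         closed_in Z Y)].

Definition flow_velocity n (Psi : R -> 'rV[R]_n -> 'rV[R]_n) (x : 'rV[R]_n)
  : 'rV[R]_n := derive1 (fun t : R => Psi t x) 0.

Definition is_flow n (Psi : R -> 'rV[R]_n -> 'rV[R]_n) : Prop :=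
  [/\ (forall x, Psi 0 x = x),
      (forall s t x, Psi (s + t) x = Psi s (Psi t x)),
      continuous (fun p : R * 'rV[R]_n => Psi p.1 p.2),
      (forall x, derivable (fun t => Psi t x) 0 1) &
      continuous (flow_velocity Psi)].

Definition stationary n (Psi : R -> 'rV[R]_n -> 'rV[R]_n) (x : 'rV[R]_n) :=
  forall t, Psi t x = x.

(* Asymptotic stability under the time-reversed flow. *)
Definition is_source n (Psi : R -> 'rV[R]_n -> 'rV[R]_n) (o : 'rV[R]_n) :=
  (forall U, nbhs o U -> exists2 V, nbhs o V &
     forall x t, V x -> t <= 0 -> U (Psi t x)) /\
  (\forall x \near o, Psi t x @[t --> -oo] --> o).

(* The tangent space at [x] of the sphere of radius [r] is the hyperplane
   orthogonal to [x]. *)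
Definition transversal_to_sphere n (Psi : R -> 'rV[R]_n -> 'rV[R]_n) (r : R) :=
  forall x, sphere r x -> dot (flow_velocity Psi x) x != 0.

End Topology.

Section Sym.
Variable (T : topologicalType) (m : nat).

Definition sym_rel (x y : 'rV[T]_m) : bool := [exists s : 'S_m, y == col_perm s x].

Lemma sym_rel_equiv : equiv_class_of sym_rel.
Proof.
split=> [x|x y|y x z].
- by apply/existsP; exists 1%g; rewrite col_perm1.
- by apply/existsP/existsP=> -[s /eqP->]; exists (s^-1)%g;
    rewrite -col_permM ?mulgV ?mulVg col_perm1.
- move=> /existsP[s /eqP->] /existsP[t /eqP->].
  by apply/existsP; exists (t * s)%g; rewrite col_permM.
Qed.

Canonical sym_equiv := EquivRelPack sym_rel_equiv.

Definition Sym : topologicalType := quotient_topology {eq_quot sym_equiv}.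

(* The points of a divisor, with multiplicity, in some order. *)
Definition pts (D : Sym) : seq T :=
  [seq (repr (D : {eq_quot sym_equiv})) 0 i | i : 'I_m].

End Sym.

Definition C (R : realType) : numFieldType := R[i]%C.

(* An element of Omega is the sequence of its nonzero values. *)
Definition Omega : set (seq nat) := [set w : seq nat | 0%N \notin w].

Definition Omega_le (d : nat) : set (seq nat) :=
  [set w : seq nat | [/\ Omega w, (sumn w <= d)%N & odd (sumn w) = odd d]].

Definition rnorm (w : seq nat) : nat := sumn [seq k.-1 | k <- w].

Inductive elementary (w w' : seq nat) : Prop :=
| Merge s a b t of w = s ++ [:: a, b & t] & w' = s ++ (a + b)%N :: t
| Insert s t of w = s ++ t & w' = s ++ 2%N :: t.

(* [succeq w w']: [w'] is obtained from [w] by elementary merges and inserts. *)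
Definition succeq : seq nat -> seq nat -> Prop :=
  Relation_Operators.clos_refl_trans _ elementary.

Section Strata.
Variables (R : realType) (d : nat).

(* [a 0 i] is the coefficient of degree [i]. *)
Definition monic_of (a : 'rV[R]_d) : {poly R} := 'X^d + rVpoly a.

Definition comb_type (p : {poly R}) : seq nat := [seq mup x p | x <- rootsR p].

Definition stratum (w : seq nat) : set 'rV[R]_d :=
  [set a | comb_type (monic_of a) = w].

(* The Viete map, on a conjugation-invariant divisor of degree [d] listed as the
   sequence [D] of its points; the coefficients of the product are then real. *)
Definition viete (D : seq (C R)) : 'rV[R]_d :=
  \row_(i < d) complex.Re ((\prod_(z <- D) ('X - z%:P))`_i).

Variable w : seq nat.

Definition cell_space : topologicalType :=
  ('rV[R]_(size w) * Sym (C R) (d - sumn w)./2)%type.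

(* The points, with multiplicity, of the divisor sum_i w(i) y_i. *)
Definition rdiv (y : 'rV[R]_(size w)) : seq (C R) :=
  flatten [seq nseq (nth 0%N w i) ((y 0 i)%:C%C : C R) | i : 'I_(size w)].

(* The points of D' + D'' + tau(D''). *)
Definition total_div (D : cell_space) : seq (C R) :=
  rdiv D.1 ++ pts D.2 ++ [seq (conjc z : C R) | z : C R <- pts D.2].

Definition Phi (D : cell_space) : 'rV[R]_d := viete (total_div D).

(* Sym^m of the closed (resp. open) half-plane is taken inside Sym^m(C): as the
   half-plane is closed (resp. open) in C, the subspace topology is the quotient
   topology. *)
Definition ecell : set cell_space :=
  [set D : cell_space | (forall i j : 'I_(size w), (i <= j)%N -> D.1 0 i <= D.1 0 j) /\
           (forall z : C R, z \in pts D.2 -> 0 <= complex.Im z)].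

Definition ecello : set cell_space :=
  [set D : cell_space | (forall i j : 'I_(size w), (i < j)%N -> D.1 0 i < D.1 0 j) /\
           (forall z : C R, z \in pts D.2 -> 0 < complex.Im z)].

(* supp(D') \cup supp(D'') lies in the closed unit disk centered at [c] but not
   in its interior. *)
Definition touches_circle (c : R) (D : cell_space) : Prop :=
  let supp := rdiv D.1 ++ pts D.2 in
  (forall z : C R, z \in supp -> `|z - c%:C%C| <= 1) /\
  ~ (forall z : C R, z \in supp -> `|z - c%:C%C| < 1).

Definition sigma : set cell_space := ecell `&` [set D : cell_space | touches_circle 0 D].

Definition balanced (alpha : R) (D : seq (C R)) : Prop :=
  \sum_(z <- D) z = (alpha * (size D)%:R)%:C%C.

Definition ecell_bal (alpha : R) : set cell_space :=
  ecell `&` [set D : cell_space | balanced alpha (total_div D)].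

Definition sigma_bal (alpha : R) : set cell_space :=
  ecell_bal alpha `&` [set D : cell_space | touches_circle alpha D].

End Strata.

(* The stratum of type (d) meets the sphere in two points, hence yields two
   0-cells; every other stratum yields one cell. *)
Definition sphere_cells (R : realType) (d : nat) (r : R) : set (set 'rV[R]_d) :=
  [set stratum w `&` sphere r | w in [set w | Omega_le d w /\ w <> [:: d]]] `|`
  [set [set a] | a in stratum [:: d] `&` sphere r].

(* Main.v *)
(* A configuration (y, D'') of p real points and m complex points is identified with
   R^(p+2m) by keeping y and replacing D'' by the coefficients of its monic polynomial.
   The closed cell is the part where the gaps of y and the imaginary parts of D'' (its
   "walls") are nonnegative.  The translation raising all walls by s at constant centre of
   mass adds s both to the minimum of the walls and to their mean, and the mean is linear
   in the coordinates; hence raising by the difference is a homeomorphism that carries the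
   closed cell onto a half-space.  It commutes with dilations, so taking roots of the
   coordinates according to their weights makes dilations linear.  In this chart the largest
   modulus of a point is a gauge, so that its unit sphere in the half-space is a hemisphere,
   i.e. a closed ball, over which the cell is a cone; the centre of mass is one more linear
   coordinate, which gives the balanced cells.

   Phi is proper by Cauchy's bound on roots, hence closed, and it is injective on open
   cells, because the real roots and the roots in the upper half-plane determine the divisor:
   so it maps open cells homeomorphically onto strata.  A boundary point has either two equal
   real points (a merge) or a complex point that became real (an insert), and so lies in a
   closed cell of smaller dimension; this gives the cell complex.

   The flow multiplies all roots by e^t, i.e. the coefficient of degree i by e^(t(d-i)).
   Each of its orbits other than 0 crosses every sphere once.  Projecting along the orbits,
   the closed balls sigma become the cells of the sphere. *)
Require Import Defs.
From Stdlib Require Import Relation_Operators Operators_Properties.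
From mathcomp Require Import all_boot all_order all_algebra all_fingroup generic_quotient.
From mathcomp Require Import complex polyrcf.
From mathcomp Require Import all_classical all_reals all_analysis.
From mathcomp Require Import ring lra zify.
Import Defs.
Set Implicit Arguments.
Unset Strict Implicit.
Unset Printing Implicit Defensive.
Import Order.TTheory GRing.Theory Num.Theory.
Import numFieldNormedType.Exports.
Local Open Scope classical_set_scope.
Local Open Scope ring_scope.

(** * Homeomorphisms and cones *)

Section Homeomorphisms.
Implicit Types X Y Z T U : topologicalType.

(** The complex points are unlabelled, so a closed cell has to be described by symmetric functions;
    hence the minimum and the mean of the walls rather than individual walls. The minimum is not
    linear in the Viete coordinates. The mean is, because the sum of the roots is minus the
    subleading coefficient; this coefficient has degree one in the points, so the mean and the
    centre of mass survive the extraction of roots that linearizes dilations.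

    Wherever points are recovered from coefficients, continuity comes from properness: continuity of
    roots is never proved directly.

    The type (d) is exceptional. It has no walls, its cell is a whole line instead of a half-space,
    and its link consists of two points. Every other type has a wall and dimension at least two,
    which leaves room for two independent coordinates, slack and moment.

    A merge and an insert each raise the codimension by exactly one. This makes degenerations
    terminate, makes the dimension drop on boundaries, and prevents a boundary point from landing in
    the stratum of its own cell. *)

Lemma closed_inP X (Z W : set X) : W `<=` Z ->
  closed_in Z W <-> exists2 F : set X, closed F & W = Z `&` F.
Proof.
move=> WZ; rewrite /closed_in; split.
  move/closed_subspaceP=> [V cV e]; exists V => //.
  by rewrite setIC e; apply/esym/setIidPl.
move=> [F cF e]; apply/closed_subspaceP; exists F => //.
by rewrite e setIC setIAC setIid.
Qed.

Lemma closed_inE X (Z W : set X) : closed Z -> W `<=` Z ->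
  closed_in Z W <-> closed W.
Proof.
move=> cZ WZ; rewrite closed_inP //; split; first by move=> [F cF ->]; exact: closedI.
by move=> cW; exists W => //; apply/esym/setIidPr.
Qed.

Lemma within_continuous X Y (A : set X) (f : X -> Y) :
  (forall x, A x -> {for x, continuous f}) -> {within A, continuous f}.
Proof. by move=> fc; apply: continuous_in_subspaceT => x /set_mem; exact: fc. Qed.

Lemma within_preimage_closed X Y (A : set X) (f : X -> Y) (F : set Y) :
  {within A, continuous f} -> closed F ->
  exists2 G : set X, closed G & A `&` f @^-1` F = A `&` G.
Proof.
move=> /continuous_closedP fc cF.
have := fc _ cF; move/closed_subspaceP => [V cV e]; exists V => //.
by rewrite setIC [RHS]setIC -e.
Qed.

Lemma continuous_within X Y (A : set X) (f : X -> Y) :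
  (forall F : set Y, closed F ->
     exists2 G : set X, closed G & A `&` f @^-1` F = A `&` G) ->
  {within A, continuous f}.
Proof.
move=> H; apply/continuous_closedP => F cF; apply/closed_subspaceP.
by have [G cG e] := H _ cF; exists G => //; rewrite setIC -e setIC.
Qed.

Lemma within_comp X Y Z (A : set X) (B : set Y) (f : X -> Y) (g : Y -> Z) :
  {within A, continuous f} -> {within B, continuous g} ->
  (forall x, A x -> B (f x)) -> {within A, continuous (g \o f)}.
Proof.
move=> fc gc fAB; apply: continuous_within => F cF.
have [G cG eG] := within_preimage_closed gc cF.
have [H cH eH] := within_preimage_closed fc cG.
exists H => //; rewrite -eH; apply/seteqP; split=> x /= [Ax Fx]; split => //.
  have : (B `&` g @^-1` F) (f x) by split => //; exact: fAB.
  by rewrite eG => -[].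
have : (B `&` G) (f x) by split => //; exact: fAB.
by rewrite -eG => -[].
Qed.

Lemma within_compl X Y Z (A : set X) (f : X -> Y) (g : Y -> Z) :
  {within A, continuous f} -> (forall x, A x -> {for f x, continuous g}) ->
  {within A, continuous (g \o f)}.
Proof.
move=> fc gc; apply: (within_comp (B := f @` A)) => //.
by apply: within_continuous => _ [x Ax <-]; exact: gc.
Qed.

Lemma homeo_onI X Y (A : set X) (B : set Y) (f : X -> Y) (g : Y -> X) :
  (forall x, A x -> B (f x)) -> (forall y, B y -> A (g y)) ->
  (forall x, A x -> g (f x) = x) -> (forall y, B y -> f (g y) = y) ->
  {within A, continuous f} -> {within B, continuous g} -> homeo_on A B f.
Proof.
move=> fAB gBA fK gK fc gc; split => //.
  split => //.
    by move=> x y /set_mem Ax /set_mem Ay e; rewrite -(fK x) // e fK.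
  by move=> y By; exists (g y); [exact: gBA|exact: gK].
by exists g => // x /set_mem; exact: fK.
Qed.

Lemma homeo_onP X Y (A : set X) (B : set Y) (f : X -> Y) : homeo_on A B f ->
  exists g : Y -> X,
  [/\ (forall x, A x -> B (f x)), (forall y, B y -> A (g y)),
      (forall x, A x -> g (f x) = x), (forall y, B y -> f (g y) = y) &
      {within A, continuous f} /\ {within B, continuous g}].
Proof.
move=> [[fAB fi fs] fc [g gc gK]]; exists g; split => //.
- by move=> y /fs [x Ax <-]; rewrite gK //; exact/mem_set.
- by move=> x Ax; rewrite gK //; exact/mem_set.
- by move=> y /fs [x Ax <-]; rewrite gK //; exact/mem_set.
Qed.

Lemma homeo_on_sub X Y (f : X -> Y) (g : Y -> X) (A : set X) (B : set Y) :
  cancel f g -> cancel g f -> continuous f -> continuous g ->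
  (forall x, A x <-> B (f x)) -> homeo_on A B f.
Proof.
move=> fK gK fc gc AB; apply: (homeo_onI (g := g)) => //.
- by move=> x /AB.
- by move=> y By; apply/AB; rewrite gK.
- exact: continuous_subspaceT.
- exact: continuous_subspaceT.
Qed.

Lemma homeo_on_comp X Y Z (A : set X) (B : set Y) (D : set Z) f g :
  homeo_on A B f -> homeo_on B D g -> homeo_on A D (g \o f).
Proof.
move=> /homeo_onP [f' [fAB f'BA f'K fK [fc f'c]]].
move=> /homeo_onP [g' [gBD g'DB g'K gK [gc g'c]]].
apply: (homeo_onI (g := f' \o g')) => /=.
- by move=> x /fAB /gBD.
- by move=> x /g'DB /f'BA.
- by move=> x Ax; rewrite g'K ?f'K //; exact: fAB.
- by move=> x Dx; rewrite fK ?gK //; exact: g'DB.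
- exact: within_comp fc gc fAB.
- exact: within_comp g'c f'c g'DB.
Qed.

Lemma homeomorphic_trans X Y Z (A : set X) (B : set Y) (D : set Z) :
  homeomorphic A B -> homeomorphic B D -> homeomorphic A D.
Proof. by move=> [f fh] [g gh]; exists (g \o f); exact: homeo_on_comp fh gh. Qed.

Lemma homeomorphic_sym X Y (A : set X) (B : set Y) :
  homeomorphic A B -> homeomorphic B A.
Proof.
move=> [f /homeo_onP [g [fAB gBA fK gK [fc gc]]]]; exists g.
exact: (homeo_onI (g := f)).
Qed.

Lemma pair_homeomorphic_trans X Y Z (A A0 : set X) (B B0 : set Y) (D D0 : set Z) :
  pair_homeomorphic A A0 B B0 -> pair_homeomorphic B B0 D D0 ->
  pair_homeomorphic A A0 D D0.
Proof.
move=> [f fh f0] [g gh g0]; exists (g \o f); first exact: homeo_on_comp fh gh.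
by rewrite -image_comp f0.
Qed.

Lemma image_iffE X Y (A A0 : set X) (B B0 : set Y) (f : X -> Y) :
  homeo_on A B f -> A0 `<=` A -> B0 `<=` B ->
  (forall x, A x -> A0 x <-> B0 (f x)) -> f @` A0 = B0.
Proof.
move=> [[_ _ fs] _ _] sA sB AB; apply/seteqP; split => [_ [x A0x <-]|y B0y].
  by apply/AB => //; exact: sA.
by have [x Ax e] := fs _ (sB _ B0y); exists x => //; apply/AB; rewrite ?e.
Qed.

Lemma homeo_on_restr X Y (A A0 : set X) (B B0 : set Y) f :
  homeo_on A B f -> A0 `<=` A -> B0 `<=` B ->
  (forall x, A x -> A0 x <-> B0 (f x)) -> homeo_on A0 B0 f.
Proof.
move=> /homeo_onP [f' [fAB f'BA f'K fK [fc f'c]]] sA sB AB.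
apply: (homeo_onI (g := f')).
- by move=> x A0x; apply/AB => //; exact: sA.
- by move=> y B0y; apply/AB; [apply: f'BA; exact: sB|rewrite fK//; exact: sB].
- by move=> x /sA; exact: f'K.
- by move=> x /sB; exact: fK.
- exact: continuous_subspaceW fc.
- exact: continuous_subspaceW f'c.
Qed.

Lemma pair_homeomorphicI X Y (A A0 : set X) (B B0 : set Y) f :
  homeo_on A B f -> A0 `<=` A -> B0 `<=` B ->
  (forall x, A x -> A0 x <-> B0 (f x)) -> pair_homeomorphic A A0 B B0.
Proof. by move=> h sA sB AB; exists f => //; exact: image_iffE h sA sB AB. Qed.

Lemma pair_homeomorphic_snd X Y (A A0 : set X) (B B0 : set Y) :
  A0 `<=` A -> pair_homeomorphic A A0 B B0 -> homeomorphic A0 B0.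
Proof.
move=> sA [f fh e]; exists f; apply: (homeo_on_restr (fh)) => //.
  by rewrite -e => _ [x /sA Ax <-]; case: fh => -[fAB _ _] _ _; exact: fAB.
move=> x Ax; rewrite -e; split; first by exists x.
move=> [y A0y]; case: fh => -[_ fi _] _ _ /fi.
by move=> <- //; apply/mem_set => //; exact: sA.
Qed.

(** Properness is required only locally in the target: near a point adherent to the image only the
    part of [A] inside [K] matters, and its image is compact, hence closed. *)
Lemma closed_image X Y (f : X -> Y) (A : set X) : hausdorff_space Y ->
  {within A, continuous f} -> closed A ->
  (forall y : Y, exists2 V, nbhs y V & exists2 K, compact K & A `&` f @^-1` V `<=` K) ->
  closed (f @` A).
Proof.
move=> hY fc cA H y cly.
have [V nV [K cK sK]] := H y.
have cAK : compact (K `&` A) by exact: compact_closedI.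
have cI : closed (f @` (K `&` A)).
  apply: compact_closed => //; apply: continuous_compact => //.
  by apply: continuous_subspaceW fc => x [].
suff : (f @` (K `&` A)) y by move=> [x [_ Ax] <-]; exists x.
apply: cI => W nW; have [_ [[x Ax <-] [Vx Wx]]] := cly _ (filterI nV nW).
by exists (f x); split => //; exists x => //; split => //; apply: sK.
Qed.

(** A closed map remains closed over the full preimage [A0] of [B], so injectivity there suffices,
    whatever [f] identifies on the rest of [A]. The point [x0] only serves as the value of the
    inverse outside [B]. *)
Lemma homeo_on_saturated X Y (x0 : X) (f : X -> Y) (A A0 : set X) (B : set Y) :
  {within A, continuous f} ->
  (forall F, closed F -> closed (f @` (A `&` F))) ->
  A0 = A `&` f @^-1` B -> (forall x x', A0 x -> A0 x' -> f x = f x' -> x = x') ->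
  B `<=` f @` A -> homeo_on A0 B f.
Proof.
move=> fc fcl eA0 fi Bs.
have /choice [g gP] (y : Y) : exists x, B y -> A0 x /\ f x = y.
  have [By|nBy] := pselect (B y); last by exists x0.
  by have [x Ax e] := Bs _ By; exists x => _; rewrite eA0; split => //; split => //=; rewrite e.
apply: (homeo_onI (g := g)).
- by move=> x; rewrite eA0 => -[].
- by move=> y /gP [].
- move=> x A0x; have Bx : B (f x) by move: A0x; rewrite eA0 => -[].
  by have [A0g e] := gP _ Bx; exact: fi.
- by move=> y /gP [].
- by apply: continuous_subspaceW fc; rewrite eA0 => x [].
- apply: continuous_within => F cF; exists (f @` (A `&` F)); first exact: fcl.
  apply/seteqP; split => y [By Fy]; split => //.
    have [A0g e] := gP _ By; exists (g y) => //; split => //.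
    by move: A0g; rewrite eA0 => -[].
  have [A0g e] := gP _ By; move: Fy => [x [Ax Fx] e'] /=.
  suff -> : g y = x by [].
  by apply: fi => //; rewrite ?e// eA0; split => //=; rewrite e'.
Qed.

Lemma compact_closed_image X Y (f : X -> Y) (A F : set X) : hausdorff_space Y ->
  {within A, continuous f} -> compact A -> closed F -> closed (f @` (A `&` F)).
Proof.
move=> hY fc cA cF; apply: compact_closed => //; apply: continuous_compact.
  by apply: continuous_subspaceW fc => x [].
exact: compact_closedI.
Qed.

End Homeomorphisms.

Section Cones.
Variable R : realType.
Implicit Types U T : topologicalType.

(** The continuous function [nu] bounds the cone parameter in terms of the image point. Together
    with compactness of [A] this makes [q] proper, hence closed, and a closed surjection is a
    quotient map. *)
Lemma cone_mapI U T (X : set U) (A : set T) (o : U) (q : R * T -> U) (nu : U -> R) :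
  hausdorff_space U -> hausdorff_space T ->
  X o -> closed X -> compact A -> continuous nu ->
  {within [set t : R | 0 <= t] `*` A, continuous q} ->
  (forall (t : R) a, 0 <= t -> A a -> X (q (t, a)) /\ t <= nu (q (t, a))) ->
  (forall a, A a -> q (0, a) = o) ->
  (forall (t : R) a, 0 < t -> A a -> q (t, a) <> o) ->
  (forall (t : R) a (t' : R) a', 0 < t -> A a -> 0 < t' -> A a' -> q (t, a) = q (t', a') ->
      (t, a) = (t', a')) ->
  (forall x, X x -> x <> o -> exists (t : R) a, [/\ 0 < t, A a & q (t, a) = x]) ->
  cone_map X A o q.
Proof.
move=> hU hT Xo cX cA nuc qc qX q0 qn0 qi qs; split => //.
  split.
  - move=> [t a] [/= t0 Aa]; split; last exact: qn0.
    by have [] := qX t a (ltW t0) Aa.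
  - move=> [t a] [t' a'] /set_mem [/= t0 Aa] /set_mem [/= t0' Aa'].
    exact: qi.
  - by move=> x [Xx xo]; have [t [a [t0 Aa e]]] := qs x Xx xo; exists (t, a).
move=> W WX; set P := [set t : R | 0 <= t] `*` A.
have clP : closed P.
  have -> : P = fst @^-1` [set t : R | 0 <= t] `&` snd @^-1` A by [].
  apply: closedI; apply: preimage_closed => //.
  - by move=> ? _; exact: cvg_fst.
  - by move=> ? _; exact: cvg_snd.
  - exact: compact_closed.
have sP : P `&` q @^-1` W `<=` P by move=> ? [].
rewrite !closed_inE //; split=> cW.
  by have [G cG ->] := within_preimage_closed qc cW; exact: closedI.
(* If [A] is empty, nothing but the apex is left in [X]. Otherwise the apex is also attained, at
   parameter 0, so [W] is the image of its preimage. *)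
have [Anon|/set0P/negP/negPn/eqP A0] := pselect (exists a, A a); last first.
  have : W `<=` [set o].
    move=> x Wx; apply: contrapT => xo.
    by have [t [a []]] := qs _ (WX _ Wx) xo; rewrite A0.
  by move=> /subset_set1 [->|->]; [exact: closed0|apply: compact_closed => //; exact: compact_set1].
have -> : W = q @` (P `&` q @^-1` W).
  apply/seteqP; split => [x Wx|_ [x [_ ? <-]]//].
  have [xo|xo] := pselect (x = o).
    have [a Aa] := Anon; exists (0, a); last by rewrite q0 // xo.
    by split; [split => //=|rewrite /preimage/= q0 // -xo].
  have [t [a [t0 Aa e]]] := qs _ (WX _ Wx) xo; exists (t, a) => //.
  by split; [split => //=; exact: ltW|rewrite /preimage /= e].
apply: closed_image => //; first exact: continuous_subspaceW qc.
move=> y; exists (nu @^-1` [set s | s < nu y + 1]).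
  by apply: nuc; apply: open_nbhs_nbhs; split; [exact: open_lt|rewrite /= ltrDl].
exists ([set t | 0 <= t <= nu y + 1] `*` A).
  apply: compact_setX => //.
  have -> : [set t : R | 0 <= t <= nu y + 1] = `[0, nu y + 1]%classic.
    by apply/seteqP; split => t; rewrite /= in_itv.
  exact: segment_compact.
move=> [t a] [[[/= t0 Aa] _] /= H]; split => //=.
have [_ H'] := qX t a t0 Aa.
by rewrite t0 /=; apply: le_trans H' (ltW _).
Qed.

End Cones.

(** * Continuity at a point *)

Lemma cvg_mxP (T : topologicalType) (X : Type) m n (F : set_system X) (f : X -> 'M[T]_(m, n))
    (M : 'M[T]_(m, n)) : Filter F ->
  (forall i j, (fun x => f x i j) @ F --> M i j) -> f @ F --> M.
Proof.
move=> FF H A [P MP PA].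
apply: (@filterS _ F _ (fun x => forall ij : 'I_m * 'I_n, P ij.1 ij.2 (f x ij.1 ij.2))).
  by move=> x Hx; apply: PA => i j; exact: (Hx (i, j)).
by apply: filter_forall => -[i j] /=; exact: H (MP i j).
Qed.

(* Continuity at a point, wrapped so that unification does not unfold [nbhs]. *)
Variant cts_at (X Y : topologicalType) (f : X -> Y) (x : X) : Prop :=
  CtsAt of {for x, continuous f}.

Section PointwiseContinuity.
Implicit Types X Y Z : topologicalType.

Lemma cts_all X Y (f : X -> Y) : (forall x, cts_at f x) -> continuous f.
Proof. by move=> H x; case: (H x). Qed.

Lemma cts_each X Y (f : X -> Y) x : continuous f -> cts_at f x.
Proof. by move=> fc; split; exact: fc. Qed.

Lemma cts_within X Y (A : set X) (f : X -> Y) :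
  (forall x, A x -> cts_at f x) -> {within A, continuous f}.
Proof. by move=> H; apply: within_continuous => x /H []. Qed.

Lemma cts_ext X Y (f g : X -> Y) x : cts_at f x -> f =1 g -> cts_at g x.
Proof. by move=> cf /funext <-. Qed.

Lemma cts_cst X Y (c : Y) x : cts_at (fun _ : X => c) x.
Proof. split; exact: cvg_cst. Qed.

Lemma cts_id X x : cts_at (fun y : X => y) x.
Proof. split; exact: cvg_id. Qed.

Lemma cts_comp X Y Z (f : X -> Y) (g : Y -> Z) x :
  cts_at f x -> cts_at g (f x) -> cts_at (fun y => g (f y)) x.
Proof. by move=> [cf] [cg]; split; apply: (cvg_comp _ _ cf); exact: cg. Qed.

Lemma cts_fst X Y Z (f : X -> Y * Z) x : cts_at f x -> cts_at (fun y => (f y).1) x.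
Proof. by move=> cf; apply: (cts_comp cf (g := fst)); split; exact: cvg_fst. Qed.

Lemma cts_snd X Y Z (f : X -> Y * Z) x : cts_at f x -> cts_at (fun y => (f y).2) x.
Proof. by move=> cf; apply: (cts_comp cf (g := snd)); split; exact: cvg_snd. Qed.

Lemma cts_pair X Y Z (f : X -> Y) (g : X -> Z) x :
  cts_at f x -> cts_at g x -> cts_at (fun y => (f y, g y)) x.
Proof. by move=> [cf] [cg]; split; exact: (cvg_pair cf cg). Qed.

Lemma cts_mx X Y m n (f : X -> 'M[Y]_(m, n)) x :
  (forall i j, cts_at (fun y => f y i j) x) -> cts_at f x.
Proof. by move=> H; split; apply: cvg_mxP => i j; case: (H i j). Qed.

Lemma cts_coord X Y m n (f : X -> 'M[Y]_(m, n)) i j x :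
  cts_at f x -> cts_at (fun y => f y i j) x.
Proof.
move=> cf; apply: (cts_comp cf (g := fun M : 'M[Y]_(m, n) => M i j)).
split; move: (f x) => M A nA; exists (fun i' j' => [set x | i' = i -> j' = j -> A x]).
  move=> i' j'; have [->|/eqP ni] := eqVneq i' i; last by apply: filterS filterT => z _ /ni.
  have [->|/eqP nj] := eqVneq j' j; last by apply: filterS filterT => z _ _ /nj.
  by apply: filterS nA => z Az _ _.
by move=> N /(_ i j); apply.
Qed.

Section Field.
Variables (K : numFieldType) (X : topologicalType).
Implicit Types f g : X -> K.

Lemma ctsD f g x : cts_at f x -> cts_at g x -> cts_at (fun y => f y + g y) x.
Proof. by move=> [cf] [cg]; split; exact: (cvgD cf cg). Qed.

Lemma ctsB f g x : cts_at f x -> cts_at g x -> cts_at (fun y => f y - g y) x.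
Proof. by move=> [cf] [cg]; split; exact: (cvgB cf cg). Qed.

Lemma ctsN f x : cts_at f x -> cts_at (fun y => - f y) x.
Proof. by move=> [cf]; split; exact: (cvgN cf). Qed.

Lemma ctsM f g x : cts_at f x -> cts_at g x -> cts_at (fun y => f y * g y) x.
Proof. by move=> [cf] [cg]; split; exact: (cvgM cf cg). Qed.

Lemma ctsV f x : f x != 0 -> cts_at f x -> cts_at (fun y => (f y)^-1) x.
Proof. by move=> fx [cf]; split; exact: (cvgV fx cf). Qed.

Lemma cts_sum (I : Type) (s : seq I) (f : I -> X -> K) x :
  (forall i, cts_at (f i) x) -> cts_at (fun y => \sum_(i <- s) f i y) x.
Proof.
move=> fc; elim: s => [|a s IH].
  by apply: (cts_ext (cts_cst (0 : K) x)) => y; rewrite big_nil.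
by apply: (cts_ext (ctsD (fc a) IH)) => y; rewrite big_cons.
Qed.

Lemma ctsX f n x : cts_at f x -> cts_at (fun y => f y ^+ n) x.
Proof.
move=> cf; elim: n => [|n IH]; first by apply: (cts_ext (cts_cst (1 : K) x)) => y; rewrite expr0.
by apply: (cts_ext (ctsM cf IH)) => y; rewrite exprS.
Qed.

Lemma ctsZ f n (v : X -> 'rV[K]_n) x :
  cts_at f x -> cts_at v x -> cts_at (fun y => f y *: v y) x.
Proof.
move=> cf cv; apply: cts_mx => i j.
by apply: (cts_ext (ctsM cf (cts_coord i j cv))) => y; rewrite mxE.
Qed.

Lemma ctsDv n (u v : X -> 'rV[K]_n) x :
  cts_at u x -> cts_at v x -> cts_at (fun y => u y + v y) x.
Proof.
move=> cu cv; apply: cts_mx => i j.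
by apply: (cts_ext (ctsD (cts_coord i j cu) (cts_coord i j cv))) => y; rewrite mxE.
Qed.

Lemma cts_mulmx n p (v : X -> 'rV[K]_n) (A : 'M[K]_(n, p)) x :
  cts_at v x -> cts_at (fun y => v y *m A) x.
Proof.
move=> cv; apply: cts_mx => i j.
apply: (@cts_ext _ _ (fun y => \sum_k v y i k * A k j)) => [|y]; last by rewrite mxE.
by apply: cts_sum => k; apply: ctsM; [exact: cts_coord|exact: cts_cst].
Qed.

End Field.

Section Reals.
Variables (R : realType) (X : topologicalType).
Implicit Types f g : X -> R.

Lemma cts_sqrt f x : cts_at f x -> cts_at (fun y => Num.sqrt (f y)) x.
Proof. by move=> cf; apply: (cts_comp cf (g := Num.sqrt)); split; exact: sqrt_continuous. Qed.

Lemma cts_norm f x : cts_at f x -> cts_at (fun y => `|f y|) x.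
Proof. by move=> [cf]; split; exact: (cvg_norm cf). Qed.

Lemma cts_max f g x : cts_at f x -> cts_at g x -> cts_at (fun y => Num.max (f y) (g y)) x.
Proof.
move=> cf cg; apply: (@cts_ext _ _ (fun y => (f y + g y + `|f y - g y|) / 2)); last first.
  by move=> y; rewrite maxr_absE.
apply: ctsM (cts_cst _ _); apply: ctsD; first exact: ctsD.
by apply: cts_norm; exact: ctsB.
Qed.

Lemma cts_min f g x : cts_at f x -> cts_at g x -> cts_at (fun y => Num.min (f y) (g y)) x.
Proof.
move=> cf cg; apply: (@cts_ext _ _ (fun y => (f y + g y - `|f y - g y|) / 2)); last first.
  by move=> y; rewrite minr_absE.
apply: ctsM (cts_cst _ _); apply: ctsB; first exact: ctsD.
by apply: cts_norm; exact: ctsB.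
Qed.

End Reals.
End PointwiseContinuity.

Ltac neq0_lra := repeat (apply/andP; split); apply/negbT/gt_eqF; lra.

(** * Balls, half-balls and proper maps *)

Section RowVectors.
Variable R : realType.

Lemma hausdorff_rV n : hausdorff_space 'rV[R]_n.
Proof. exact: norm_hausdorff. Qed.

Definition rtail k (x : 'rV[R]_k.+1) : 'rV[R]_k := \row_j x 0 (lift ord0 j).

Definition rcons0 k (c : R) (v : 'rV[R]_k) : 'rV[R]_k.+1 :=
  \row_j (if unlift ord0 j is Some i then v 0 i else c).

Lemma rcons00 k c (v : 'rV[R]_k) : rcons0 c v 0 0 = c.
Proof. by rewrite mxE unlift_none. Qed.

Lemma rcons0S k c (v : 'rV[R]_k) j : rcons0 c v 0 (lift ord0 j) = v 0 j.
Proof. by rewrite mxE liftK. Qed.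

Lemma rtail_cons k c (v : 'rV[R]_k) : rtail (rcons0 c v) = v.
Proof. by apply/rowP => j; rewrite mxE rcons0S. Qed.

Lemma rcons0_tail k (x : 'rV[R]_k.+1) : rcons0 (x 0 0) (rtail x) = x.
Proof. by apply/rowP => j; rewrite mxE; case: unliftP => [i|] ->; rewrite ?mxE. Qed.

Lemma rcons0_inj k (x y : 'rV[R]_k.+1) : x 0 0 = y 0 0 -> rtail x = rtail y -> x = y.
Proof. by move=> e1 e2; rewrite -(rcons0_tail x) e1 e2 rcons0_tail. Qed.

Lemma rtailZ k (a : R) (x : 'rV[R]_k.+1) : rtail (a *: x) = a *: rtail x.
Proof. by apply/rowP => j; rewrite !mxE. Qed.

Lemma dot_recl k (x : 'rV[R]_k.+1) : dot x x = x 0 0 ^+ 2 + dot (rtail x) (rtail x).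
Proof.
rewrite /dot big_ord_recl expr2; congr (_ + _).
by apply: eq_bigr => i _; rewrite mxE.
Qed.

Lemma dot_ge0 k (x : 'rV[R]_k) : 0 <= dot x x.
Proof. by apply: sumr_ge0 => i _; rewrite -expr2 sqr_ge0. Qed.

Lemma dot_eq0 k (x : 'rV[R]_k) : dot x x = 0 -> x = 0.
Proof.
move/eqP; rewrite psumr_eq0 => [/allP H|i _]; last by rewrite -expr2 sqr_ge0.
apply/rowP => i; have := H i (mem_index_enum _) => /=.
by rewrite mulf_eq0 orbb mxE => /eqP.
Qed.

Lemma dotZ k (a : R) (x : 'rV[R]_k) : dot (a *: x) (a *: x) = a ^+ 2 * dot x x.
Proof. by rewrite /dot mulr_sumr; apply: eq_bigr => i _; rewrite !mxE; ring. Qed.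

Lemma dot0l k : dot (0 : 'rV[R]_k) 0 = 0.
Proof. by rewrite -(scale0r 0) dotZ expr0n mul0r. Qed.

Lemma dot_gt0 k (x : 'rV[R]_k) : x != 0 -> 0 < dot x x.
Proof. by move=> x0; rewrite lt0r dot_ge0 andbT; apply: contraNneq x0 => /dot_eq0 ->. Qed.

Lemma sphere_neq0 k (r : R) (x : 'rV[R]_k) : 0 < r -> sphere r x -> x != 0.
Proof.
rewrite /sphere /= => r0 h; apply/eqP => z0; move: h; rewrite z0 dot0l => /eqP.
by rewrite eq_sym expf_eq0 gt_eqF.
Qed.

Lemma cts_dot (X : topologicalType) k (f : X -> 'rV[R]_k) x :
  cts_at f x -> cts_at (fun y => dot (f y) (f y)) x.
Proof. by move=> cf; apply: cts_sum => i; apply: ctsM; exact: cts_coord. Qed.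

Lemma cts_rtail (X : topologicalType) k (f : X -> 'rV[R]_k.+1) x :
  cts_at f x -> cts_at (fun y => rtail (f y)) x.
Proof.
move=> cf; apply: cts_mx => i j.
by apply: (cts_ext (cts_coord 0 (lift ord0 j) cf)) => y; rewrite mxE.
Qed.

Lemma cts_rcons0 (X : topologicalType) k (c : X -> R) (v : X -> 'rV[R]_k) x :
  cts_at c x -> cts_at v x -> cts_at (fun y => rcons0 (c y) (v y)) x.
Proof.
move=> cc vc; apply: cts_mx => i j; case: (unliftP ord0 j) => [l|] ej.
  by apply: (cts_ext (cts_coord 0 l vc)) => y; rewrite mxE ej liftK.
by apply: (cts_ext cc) => y; rewrite mxE ej unlift_none.
Qed.

Definition half_space k : set 'rV[R]_k.+1 := [set x | 0 <= x 0 0].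
Definition open_half_space k : set 'rV[R]_k.+1 := [set x | 0 < x 0 0].

Lemma hball_bounds k (x : 'rV[R]_k.+1) : hball x ->
  [/\ dot (rtail x) (rtail x) < 1,
      x 0 0 <= Num.sqrt (1 - dot (rtail x) (rtail x)) &
      - Num.sqrt (1 - dot (rtail x) (rtail x)) < x 0 0].
Proof.
have t0 := dot_ge0 (rtail x).
rewrite /hball /oball /sphere /= dot_recl expr1n => hx.
have {hx} : x 0 0 ^+ 2 + dot (rtail x) (rtail x) < 1 \/
    x 0 0 ^+ 2 + dot (rtail x) (rtail x) = 1 /\ 0 < x 0 0.
  case: hx => [|[? [i i0 a0]]]; [by left|right; split => //].
  by have <- : i = 0 by exact: val_inj.
set u := dot (rtail x) (rtail x) in t0 *; move: (x 0 0) => a.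
case=> [H|[H a0]].
  have u1 : u < 1 by have := sqr_ge0 a; lra.
  have : `|a| < Num.sqrt (1 - u) by rewrite -sqrtr_sqr ltr_sqrt; lra.
  by rewrite ltr_norml => /andP[? /ltW].
have aa : 0 < a ^+ 2 by exact: exprn_gt0.
have -> : 1 - u = a ^+ 2 by lra.
by rewrite sqrtr_sqr gtr0_norm //; split => //; lra.
Qed.

(** The tail [v] goes to [v / s] with [s = sqrt (1 + |v|^2)], which maps the whole space onto the
    open ball; the fibre of the half-open ball over [v / s] has half-length [1 / s]. The first
    coordinate goes through the involution [x |-> (1 - x) / (1 + x)] from [[0, oo)] onto [(-1, 1]]
    and is then scaled by [1 / s], so the wall [x = 0] becomes the open hemisphere. *)
Lemma half_space_hball k : exists f : 'rV[R]_k.+1 -> 'rV[R]_k.+1,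
  homeo_on (@half_space k) (@hball R k.+1) f /\
  (forall x, half_space x -> open_half_space x <-> oball (f x)).
Proof.
pose f (x : 'rV[R]_k.+1) := let s := Num.sqrt (1 + dot (rtail x) (rtail x)) in
  rcons0 ((1 - x 0 0) / (1 + x 0 0) / s) (s^-1 *: rtail x).
pose g (y : 'rV[R]_k.+1) := let r := Num.sqrt (1 - dot (rtail y) (rtail y)) in
  rcons0 ((1 - y 0 0 / r) / (1 + y 0 0 / r)) (r^-1 *: rtail y).
have s_gt0 (x : 'rV[R]_k.+1) : 0 < Num.sqrt (1 + dot (rtail x) (rtail x)).
  by rewrite sqrtr_gt0 ltr_wpDr ?dot_ge0.
have s2 (x : 'rV[R]_k.+1) : Num.sqrt (1 + dot (rtail x) (rtail x)) ^+ 2 = 1 + dot (rtail x) (rtail x).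
  by rewrite sqr_sqrtr // addr_ge0 ?dot_ge0.
have fdot x : half_space x -> dot (f x) (f x) =
    1 - (1 - ((1 - x 0 0) / (1 + x 0 0)) ^+ 2) / (1 + dot (rtail x) (rtail x)).
  move=> x0; rewrite /f dot_recl rcons00 rtail_cons dotZ.
  rewrite exprMn exprVn s2; field.
  by rewrite /half_space /= in x0; have d0 := dot_ge0 (rtail x); neq0_lra.
have tau (x : 'rV[R]_k.+1) : half_space x -> -1 < (1 - x 0 0) / (1 + x 0 0) <= 1.
  move=> x0; rewrite /half_space /= in x0.
  by rewrite ltr_pdivlMr ?ler_pdivrMr; lra.
have fo x : half_space x -> open_half_space x <-> oball (f x).
  move=> x0; have /andP[t1 t2] := tau x x0.
  have d0 := dot_ge0 (rtail x).
  rewrite /oball /= fdot // gtrBl pmulr_lgt0 ?invr_gt0; last lra.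
  rewrite /open_half_space /half_space /= in x0 *.
  have -> : (0 < 1 - ((1 - x 0 0) / (1 + x 0 0)) ^+ 2) =
            (0 < 4%:R * x 0 0 / (1 + x 0 0) ^+ 2).
    by congr (_ < _); field; neq0_lra.
  rewrite pmulr_lgt0; last by rewrite invr_gt0 exprn_gt0 //; lra.
  by split; lra.
exists f; split; last exact: fo.
have rP (y : 'rV[R]_k.+1) : hball y -> let r := Num.sqrt (1 - dot (rtail y) (rtail y)) in
   [/\ 0 < r, r ^+ 2 = 1 - dot (rtail y) (rtail y), -1 < y 0 0 / r & y 0 0 / r <= 1].
  move=> /hball_bounds [v1 y1 y2] r.
  have r0 : 0 < r by rewrite sqrtr_gt0 subr_gt0.
  split=> //; first by rewrite sqr_sqrtr // subr_ge0 ltW.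
    by rewrite ltr_pdivlMr // mulN1r.
  by rewrite ler_pdivrMr // mul1r.
apply: (homeo_onI (g := g)).
- move=> x x0; have [|xn] := pselect (open_half_space x).
    by move/(fo _ x0) => ?; left.
  right; have x00 : x 0 0 = 0.
    by move: x0 xn; rewrite /half_space /open_half_space /= => ? ?; lra.
  split; first by rewrite /sphere /= fdot // x00; field; have d0 := dot_ge0 (rtail x); neq0_lra.
  exists 0 => //; rewrite /f rcons00 x00 subr0 addr0 divr1 mul1r invr_gt0; exact: s_gt0.
- move=> y /rP [r0 r2 h1 h2]; rewrite /half_space /g /= rcons00.
  by apply: divr_ge0; lra.
- move=> x x0; have s0 := s_gt0 x.
  have d0 := dot_ge0 (rtail x).
  have er : Num.sqrt (1 - dot (rtail (f x)) (rtail (f x))) = (Num.sqrt (1 + dot (rtail x) (rtail x)))^-1.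
    rewrite /f rtail_cons dotZ exprVn s2.
    have -> : 1 - (1 + dot (rtail x) (rtail x))^-1 * dot (rtail x) (rtail x) = (1 + dot (rtail x) (rtail x))^-1.
      by field; neq0_lra.
    by rewrite sqrtrV // addr_ge0.
  rewrite /g er /f !rcons00 rtail_cons invrK.
  apply: rcons0_inj; rewrite ?rcons00 ?rtail_cons.
    rewrite /half_space /= in x0.
    rewrite !mulfVK ?gt_eqF//.
    by field; neq0_lra.
  by rewrite scalerA mulfV ?gt_eqF // scale1r.
- move=> y /rP; set r := Num.sqrt _ => -[r0 r2 h1 h2].
  have es : Num.sqrt (1 + dot (rtail (g y)) (rtail (g y))) = r^-1.
    rewrite /g rtail_cons dotZ exprVn r2.
    have -> : 1 + (1 - dot (rtail y) (rtail y))^-1 * dot (rtail y) (rtail y) = (1 - dot (rtail y) (rtail y))^-1.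
      by field; rewrite -r2 expf_neq0 // gt_eqF.
    by rewrite sqrtrV // -r2 sqr_ge0.
  rewrite /f es /g !rcons00 rtail_cons invrK -/r.
  apply: rcons0_inj; rewrite ?rcons00 ?rtail_cons.
    have -> : (1 - (1 - y 0 0 / r) / (1 + y 0 0 / r)) / (1 + (1 - y 0 0 / r) / (1 + y 0 0 / r)) = y 0 0 / r.
      by move: (y 0 0 / r) h1 => q h1; field; neq0_lra.
    by rewrite divfK // gt_eqF.
  by rewrite scalerA mulfV ?gt_eqF // scale1r.
- apply: cts_within => x x0; rewrite /half_space /= in x0.
  have cs : cts_at (fun x : 'rV[R]_k.+1 => (Num.sqrt (1 + dot (rtail x) (rtail x)))^-1) x.
    apply: ctsV; first by rewrite gt_eqF.
    apply: cts_sqrt; apply: ctsD; first exact: cts_cst.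
    by apply: cts_dot; apply: cts_rtail; exact: cts_id.
  have c0 : cts_at (fun x : 'rV[R]_k.+1 => x 0 0) x by exact: cts_coord (cts_id _).
  apply: cts_rcons0.
    apply: ctsM => //; apply: ctsM; first by apply: ctsB => //; exact: cts_cst.
    apply: ctsV; first by rewrite gt_eqF // ltr_wpDr.
    by apply: ctsD => //; exact: cts_cst.
  by apply: ctsZ => //; apply: cts_rtail; exact: cts_id.
- apply: cts_within => y /rP [r0 r2 h1 h2].
  have cs : cts_at (fun x : 'rV[R]_k.+1 => (Num.sqrt (1 - dot (rtail x) (rtail x)))^-1) y.
    apply: ctsV; first by rewrite gt_eqF.
    apply: cts_sqrt; apply: ctsB; first exact: cts_cst.
    by apply: cts_dot; apply: cts_rtail; exact: cts_id.
  have c0 : cts_at (fun x : 'rV[R]_k.+1 => x 0 0) y by exact: cts_coord (cts_id _).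
  apply: cts_rcons0.
    apply: ctsM; first by apply: ctsB; [exact: cts_cst|exact: ctsM].
    apply: ctsV; first by rewrite gt_eqF // -ltrBlDl sub0r.
    by apply: ctsD; [exact: cts_cst|exact: ctsM].
  by apply: ctsZ => //; apply: cts_rtail; exact: cts_id.
Qed.

Lemma rV_oball n : homeomorphic [set: 'rV[R]_n] (@oball R n).
Proof.
exists (fun x => (Num.sqrt (1 + dot x x))^-1 *: x).
have s_gt0 (x : 'rV[R]_n) : 0 < 1 + dot x x by rewrite ltr_wpDr ?dot_ge0.
have fd (x : 'rV[R]_n) : dot ((Num.sqrt (1 + dot x x))^-1 *: x) ((Num.sqrt (1 + dot x x))^-1 *: x) = dot x x / (1 + dot x x).
  by rewrite dotZ exprVn sqr_sqrtr ?ltW // mulrC.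
apply: (homeo_onI (g := fun x => (Num.sqrt (1 - dot x x))^-1 *: x)) => //.
- by move=> x _; rewrite /oball /= fd ltr_pdivrMr // mul1r ltrDr.
- move=> x _; rewrite fd.
  have -> : 1 - dot x x / (1 + dot x x) = (1 + dot x x)^-1 by field; rewrite gt_eqF.
  rewrite sqrtrV ?ltW // invrK scalerA mulfV ?scale1r // gt_eqF // sqrtr_gt0.
  exact: s_gt0.
- move=> y; rewrite /oball /= => y1.
  rewrite dotZ exprVn sqr_sqrtr ?subr_ge0 ?ltW //.
  have -> : 1 + (1 - dot y y)^-1 * dot y y = (1 - dot y y)^-1 by field; neq0_lra.
  rewrite sqrtrV ?subr_ge0 ?ltW // invrK scalerA mulfV ?scale1r // gt_eqF // sqrtr_gt0.
  by rewrite subr_gt0.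
- apply: cts_within => x _; refine (ctsZ _ (cts_id _)); apply: ctsV.
    by rewrite gt_eqF // sqrtr_gt0.
  by apply: cts_sqrt; refine (ctsD (cts_cst _ _) _); apply: cts_dot; exact: cts_id.
- apply: cts_within => y; rewrite /oball /= => y1; refine (ctsZ _ (cts_id _)); apply: ctsV.
    by rewrite gt_eqF // sqrtr_gt0 subr_gt0.
  by apply: cts_sqrt; refine (ctsB (cts_cst _ _) _); apply: cts_dot; exact: cts_id.
Qed.

Lemma hemisphere_cball k :
  homeo_on (@half_space k `&` sphere 1) (@cball R k) (@rtail k).
Proof.
apply: (homeo_onI (g := fun v => rcons0 (Num.sqrt (1 - dot v v)) v)).
- move=> x [_]; rewrite /sphere /cball /= dot_recl expr1n => <-.
  by rewrite lerDr sqr_ge0.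
- move=> v; rewrite /cball /= => v1; split.
    by rewrite /half_space /= rcons00 sqrtr_ge0.
  by rewrite /sphere /= dot_recl rcons00 rtail_cons sqr_sqrtr ?subr_ge0 // subrK expr1n.
- move=> x [x0]; rewrite /sphere /= dot_recl expr1n => e.
  apply: rcons0_inj; rewrite ?rcons00 ?rtail_cons //.
  by rewrite -e addrK sqrtr_sqr ger0_norm.
- by move=> v _; rewrite rtail_cons.
- by apply: cts_within => x _; apply: cts_rtail; exact: cts_id.
- apply: cts_within => v _; refine (cts_rcons0 _ (cts_id _)); apply: cts_sqrt.
  by refine (ctsB (cts_cst _ _) _); apply: cts_dot; exact: cts_id.
Qed.

Lemma hemisphere_oball k (x : 'rV[R]_k.+1) : half_space x -> sphere 1 x ->
  open_half_space x <-> oball (rtail x).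
Proof.
rewrite /half_space /sphere /oball /open_half_space /= dot_recl expr1n => x0 <-.
rewrite ltrDr; split=> [?|]; first exact: exprn_gt0.
by apply: contraTT; rewrite -leNgt => x1; have -> : x 0 0 = 0 by [lra]; rewrite expr0n ltxx.
Qed.

(* [N] is the gauge of a star-shaped neighbourhood of the origin, and [H] is a cone. *)
Lemma gauge_sphere n (N : 'rV[R]_n -> R) (H : set 'rV[R]_n) :
  continuous N -> (forall t x, 0 <= t -> N (t *: x) = t * N x) ->
  (forall x, 0 <= N x) -> (forall x, N x = 0 -> x = 0) ->
  (forall t x, 0 < t -> H x -> H (t *: x)) ->
  exists f : 'rV[R]_n -> 'rV[R]_n,
   homeo_on (H `&` [set x | N x = 1]) (H `&` sphere 1) f /\
   forall x, exists2 t, (N x = 1 -> 0 < t) & f x = t *: x.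
Proof.
move=> Nc NZ N0 Nn0 HZ.
have N00 : N 0 = 0 by rewrite -(scale0r 0) NZ // mul0r.
have Np x : x != 0 -> 0 < N x.
  by move=> x0; rewrite lt0r N0 andbT; apply: contraNneq x0 => /Nn0 ->.
have sp (x : 'rV[R]_n) : x != 0 -> 0 < Num.sqrt (dot x x) by move=> x0; rewrite sqrtr_gt0 dot_gt0.
have nz x : N x = 1 -> x != 0.
  by move=> Nx; apply/eqP => x0; move: Nx; rewrite x0 N00 => /eqP; rewrite eq_sym oner_eq0.
have snz (x : 'rV[R]_n) : sphere 1 x -> x != 0 by exact: sphere_neq0.
exists (fun x => (Num.sqrt (dot x x))^-1 *: x); split; last first.
  by move=> x; exists (Num.sqrt (dot x x))^-1 => // /nz x0; rewrite invr_gt0 sp.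
apply: (homeo_onI (g := fun x => (N x)^-1 *: x)).
- move=> x [Hx /nz x0]; split; first by apply: HZ => //; rewrite invr_gt0 sp.
  by rewrite /sphere /= dotZ exprVn sqr_sqrtr ?dot_ge0 // mulVf ?expr1n // gt_eqF ?dot_gt0.
- move=> y [Hy /snz y0]; split; first by apply: HZ => //; rewrite invr_gt0 Np.
  by rewrite /= NZ ?invr_ge0 // mulVf // gt_eqF ?Np.
- move=> x [Hx N1]; have x0 := nz _ N1.
  by rewrite NZ ?invr_ge0 ?sqrtr_ge0 // N1 mulr1 invrK scalerA mulfV ?scale1r // gt_eqF ?sp.
- move=> y [Hy S1]; have y0 := snz _ S1.
  rewrite dotZ (S1 : dot y y = _) expr1n mulr1 sqrtr_sqr ger0_norm ?invr_ge0 //.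
  by rewrite invrK scalerA mulfV ?scale1r // gt_eqF ?Np.
- apply: cts_within => x [_ /nz x0]; refine (ctsZ _ (cts_id _)); apply: ctsV; first by rewrite gt_eqF ?sp.
  by apply: cts_sqrt; apply: cts_dot; exact: cts_id.
- apply: cts_within => y [_ /snz y0]; refine (ctsZ _ (cts_id _)); apply: ctsV; first by rewrite gt_eqF ?Np.
  exact: cts_each.
Qed.

Lemma gauge_half_sphere k (N : 'rV[R]_k.+1 -> R) :
  continuous N -> (forall t x, 0 <= t -> N (t *: x) = t * N x) ->
  (forall x, 0 <= N x) -> (forall x, N x = 0 -> x = 0) ->
  exists f : 'rV[R]_k.+1 -> 'rV[R]_k,
   homeo_on (@half_space k `&` [set x | N x = 1]) (@cball R k) f /\
   forall x, half_space x -> N x = 1 -> open_half_space x <-> oball (f x).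
Proof.
move=> Nc NZ N0 Nn0.
have [f [fh ft]] := gauge_sphere Nc NZ N0 Nn0 (H := @half_space k)
  (fun t x t0 (Hx : half_space x) => ltac:(by rewrite /half_space /= mxE mulr_ge0 // ltW)).
exists (@rtail k \o f); split; first by apply: homeo_on_comp fh _; exact: hemisphere_cball.
move=> x Hx Nx; case: (fh) => -[/(_ x (conj Hx Nx)) [H1 H2] _ _] _ _.
rewrite -hemisphere_oball //; have [t /(_ Nx) t0 ->] := ft x.
by rewrite /open_half_space /= mxE pmulr_rgt0.
Qed.

End RowVectors.

(** * Completing two linear forms to linear coordinates *)

Section LinearAlgebra.
Variable R : fieldType.

(** The rows of [D] are dual to the two forms in [B]. Followed by a basis of the left kernel of [B]
    they form a basis of the space, and the first two coordinates in this basis are the forms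
    themselves. *)
Lemma extend_to_basis n k (B : 'M[R]_(n, 2)) (D : 'M[R]_(2, n)) :
  n = k.+2 -> D *m B = 1%:M ->
  exists (A : 'M[R]_(n, k.+2)) (A' : 'M[R]_(k.+2, n)),
    [/\ A *m A' = 1%:M, A' *m A = 1%:M &
      forall x : 'rV_n, (x *m A) 0 0 = (x *m B) 0 0 /\
                        (x *m A) 0 (lift ord0 0) = (x *m B) 0 1].
Proof.
move=> en; subst n => DB.
have rB : \rank B = 2.
  apply/eqP; rewrite eqn_leq rank_leq_col /=.
  by rewrite -[X in (X <= _)%N](mxrank1 R 2) -DB mxrankM_maxr.
have [K Kfree KB] : exists2 K : 'M[R]_(k, k.+2), row_free K & K *m B = 0.
  have := row_base_free (kermx B); have : row_base (kermx B) *m B = 0.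
    by apply/sub_kermxP; rewrite eq_row_base.
  have : \rank (kermx B) = k by rewrite mxrank_ker rB subSS subSS subn0.
  move: (row_base (kermx B)); move: (\rank _) => r M er; subst r.
  by move=> MB Mf; exists M.
pose A' : 'M[R]_(2 + k, k.+2) := col_mx D K.
have A'B : A' *m B = col_mx 1%:M 0 by rewrite mul_col_mx DB KB.
have A'f : row_free A'.
  apply: inj_row_free => z zA.
  have zl : lsubmx z = 0.
    have := congr1 (mulmx^~ B) zA; rewrite -mulmxA A'B mul0mx -{1}(hsubmxK z).
    by rewrite mul_row_col mulmx1 mulmx0 addr0.
  have zr : rsubmx z = 0.
    move: zA; rewrite -{1}(hsubmxK z) mul_row_col zl mul0mx add0r => /eqP.
    by rewrite mulmx_free_eq0 // => /eqP.
  by rewrite -(hsubmxK z) zl zr row_mx0.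
have A'u : A' \in unitmx by rewrite -row_free_unit.
exists (invmx A'), A'; split; [exact: mulVmx|exact: mulmxV|] => x.
have -> : x *m B = lsubmx (x *m invmx A' : 'rV_(2 + k)).
  rewrite -{1}(mulmxKV A'u x) -[_ *m B]mulmxA A'B -{1}(hsubmxK (x *m invmx A' : 'rV_(2 + k))).
  by rewrite mul_row_col mulmx1 mulmx0 addr0.
move: (x *m invmx A' : 'rV_(2 + k)) => z.
by split; rewrite [RHS]mxE; congr (z _ _); exact: val_inj.
Qed.

End LinearAlgebra.

(** * Proper maps to Euclidean space *)

Section Proper.
Variable R : realType.

Lemma coord_dot n (x : 'rV[R]_n) j : x 0 j ^+ 2 <= dot x x.
Proof.
rewrite /dot (bigD1 j) //= -expr2 lerDl; apply: sumr_ge0 => i _.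
by rewrite -expr2 sqr_ge0.
Qed.

Lemma le_dot_sum n (x : 'rV[R]_n) (c : R) : (forall j, `|x 0 j| <= c) ->
  dot x x <= n%:R * c ^+ 2.
Proof.
move=> H; rewrite -[X in X%:R](card_ord n) mulr_natl -sumr_const; apply: ler_sum => i _.
rewrite -expr2 -(real_normK (num_real (x 0 i))) lerXn2r ?nnegrE //.
exact: le_trans (H i).
Qed.

(** The bound avoids a square root: [a <= 1 + a^2] for all real [a]. *)
Lemma le_norm_dot n (x : 'rV[R]_n) M j : dot x x <= M -> `|x 0 j| <= 1 + M.
Proof.
move=> H; have := coord_dot x j; rewrite -(real_normK (num_real (x 0 j))).
have := normr_ge0 (x 0 j); move: `|_| => a a0 h.
have : a ^+ 2 <= M by exact: le_trans h H.
by move=> h2; nra.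
Qed.

Lemma compact_dot n (M : R) : compact [set x : 'rV[R]_n | dot x x <= M].
Proof.
have cB : compact [set x : 'rV[R]_n | forall j, `[- (1 + M), 1 + M]%classic (x 0 j)].
  apply: (@rV_compact R n (fun=> `[- (1 + M), 1 + M]%classic)) => i.
  exact: segment_compact.
have cD : closed [set x : 'rV[R]_n | dot x x <= M].
  apply: (preimage_closed (D := [set r : R | r <= M]) (f := fun x : 'rV[R]_n => dot x x)).
    move=> x _; have [] : cts_at (fun x : 'rV[R]_n => dot x x) x by apply: cts_dot; exact: cts_id.
    by [].
  exact: closed_le.
apply: subclosed_compact cD cB _ => x /= H j; rewrite in_itv /= -ler_norml.
exact: le_norm_dot.
Qed.

Lemma nbhs_dot n (y : 'rV[R]_n) : nbhs y [set z | dot z z <= dot y y + 1].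
Proof.
have [c] : cts_at (fun x : 'rV[R]_n => dot x x) y by apply: cts_dot; exact: cts_id.
apply: (@filterS _ (nbhs y) _ ((fun x : 'rV[R]_n => dot x x) @^-1` [set r | r < dot y y + 1])).
  by move=> z /ltW.
apply: (c [set r | r < dot y y + 1]).
by apply: open_nbhs_nbhs; split; [exact: open_lt|rewrite /= ltrDl].
Qed.

Lemma closed_image_rV (X : topologicalType) n (f : X -> 'rV[R]_n) (A : set X) :
  {within A, continuous f} -> closed A ->
  (forall M, exists2 K, compact K & forall x, A x -> dot (f x) (f x) <= M -> K x) ->
  closed (f @` A).
Proof.
move=> fc cA H; apply: (closed_image (@hausdorff_rV R n)) => //.
move=> y; have [K cK HK] := H (dot y y + 1).
exists [set z | dot z z <= dot y y + 1]; first exact: nbhs_dot.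
by exists K => // x [Ax]; exact: HK.
Qed.

(** A proper continuous bijection onto Euclidean space is closed. Applied to Viete coordinates this
    is the continuity of roots in the coefficients. *)
Lemma homeo_global_rV (X : topologicalType) n (f : X -> 'rV[R]_n) (g : 'rV[R]_n -> X) :
  cancel f g -> cancel g f -> continuous f ->
  (forall M, exists2 K, compact K & forall x, dot (f x) (f x) <= M -> K x) ->
  continuous g.
Proof.
move=> fK gK fc H; apply/continuous_closedP => F cF.
have -> : g @^-1` F = f @` F.
  apply/seteqP; split => [y Fy|_ [x Fx <-]]; first by exists (g y).
  by rewrite /preimage /= fK.
apply: closed_image_rV => //; first exact: continuous_subspaceT.
by move=> M; have [K cK HK] := H M; exists K => // x _; exact: HK.
Qed.

End Proper.

(** * Signed powers and roots of coordinates *)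

Section Weights.
Variables (R : realType) (n : nat) (e : 'I_n -> nat).

(** The signed power of exponent [(e j).+1], bijective on the line whatever the parity. So [e j] is
    a weight minus one, and coordinates with [e j = 0] are left alone. *)
Definition wpow (x : 'rV[R]_n) : 'rV[R]_n := \row_j (x 0 j * `|x 0 j| ^+ e j).

(* The coefficients of a polynomial have different degrees of homogeneity in its roots;
   [wroot] makes dilations of the roots act linearly on them. *)
Definition wroot (y : 'rV[R]_n) : 'rV[R]_n :=
  \row_j (Num.sg (y 0 j) * `|y 0 j| `^ (e j).+1%:R^-1).

Lemma wpowK : cancel wpow wroot.
Proof.
move=> x; apply/rowP => j; rewrite !mxE.
have [->|x0] := eqVneq (x 0 j) 0; first by rewrite mul0r sgr0 mul0r.
rewrite sgrM (@gtr0_sg _ (`|_| ^+ _)) ?exprn_gt0 ?normr_gt0 // mulr1.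
rewrite normrM normrX normr_id -exprS -powR_mulrn // -powRrM mulfV ?pnatr_eq0 // powRr1 //.
by rewrite mulr_sg_norm.
Qed.

Lemma wrootK : cancel wroot wpow.
Proof.
move=> x; apply/rowP => j; rewrite !mxE.
have [->|x0] := eqVneq (x 0 j) 0; first by rewrite sgr0 !mul0r.
rewrite normrM normr_sg x0 mul1r ger0_norm ?powR_ge0 // -mulrA -exprS.
rewrite -powR_mulrn ?powR_ge0 // -powRrM mulVf ?pnatr_eq0 // powRr1 //.
by rewrite mulr_sg_norm.
Qed.

Lemma wpow_continuous : continuous wpow.
Proof.
apply: cts_all => x; apply: cts_mx => i j.
have c : cts_at (fun y : 'rV[R]_n => y 0 j) x by exact: cts_coord (cts_id _).
by apply: (cts_ext (ctsM c (ctsX (e j) (cts_norm c)))) => y; rewrite mxE.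
Qed.

Lemma wroot_continuous : continuous wroot.
Proof.
apply: (homeo_global_rV wpowK wrootK wpow_continuous) => M.
(* A coordinate of absolute value above 1 is dominated by its signed power, which is at most
   [1 + M]; [2 + M] covers both cases. *)
exists [set x : 'rV[R]_n | dot x x <= n%:R * (2 + M) ^+ 2]; first exact: compact_dot.
move=> x H; apply: le_dot_sum => j.
have := le_norm_dot j H; rewrite mxE normrM normrX normr_id.
have := normr_ge0 (x 0 j); move: `|x 0 j| => a a0 h.
have [a1|a1] := leP a 1; last first.
  have : 1 <= a ^+ e j by rewrite exprn_ege1 // ltW.
  by move=> h2; apply: le_trans (_ : a * a ^+ e j <= _); [rewrite ler_peMr|lra].
have : 0 <= a * a ^+ e j by rewrite mulr_ge0 // exprn_ge0.
by move=> ?; lra.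
Qed.

Lemma wrootZ (t : R) (y : 'rV[R]_n) : 0 <= t ->
  wroot (\row_j (t ^+ (e j).+1 * y 0 j)) = t *: wroot y.
Proof.
move=> t0; apply: (can_inj wpowK); rewrite wrootK; apply/rowP => j.
have yj : y 0 j = wroot y 0 j * `|wroot y 0 j| ^+ e j by rewrite -{1}(wrootK y) mxE.
have tz : (t *: wroot y) 0 j = t * wroot y 0 j by rewrite mxE.
rewrite [LHS]mxE yj [RHS]mxE tz normrM (ger0_norm t0) exprMn exprS.
ring.
Qed.

Lemma wroot_weight1 (y : 'rV[R]_n) j : e j = 0%N -> wroot y 0 j = y 0 j.
Proof. by move=> ej; rewrite -[in RHS](wrootK y) [RHS]mxE ej expr0 mulr1. Qed.

End Weights.

(** * Symmetric powers and Viete coordinates *)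

Section ComplexModulus.
Variable R : realType.
Local Notation Cx := (C R).

(** The norm of [C R] takes its values in [C R]; this is the same number in the real field, where
    minima, maxima and bounds are formed. *)
Definition cabs (z : Cx) : R := complex.Re `|z|.

Lemma cabsE (z : Cx) : `|z| = (cabs z)%:C%C.
Proof. by rewrite RRe_real // normr_real. Qed.

Lemma cabs_sqrt (z : Cx) : cabs z = Num.sqrt (complex.Re z ^+ 2 + complex.Im z ^+ 2).
Proof. by rewrite /cabs normc_def. Qed.

Lemma cabs_ge0 (z : Cx) : 0 <= cabs z.
Proof. by rewrite cabs_sqrt sqrtr_ge0. Qed.

Lemma cabs_eq0 (z : Cx) : cabs z = 0 -> z = 0.
Proof. by move=> z0; apply/normr0_eq0; rewrite cabsE z0. Qed.

Lemma cabsM (z u : Cx) : cabs (z * u) = cabs z * cabs u.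
Proof.
apply: complexI; rewrite -cabsE normrM !cabsE.
by rewrite -[(cabs z)%:C%C * _]/(real_complex R (cabs z) * real_complex R (cabs u)) -rmorphM.
Qed.

Lemma cabsX (z : Cx) n : cabs (z ^+ n) = cabs z ^+ n.
Proof.
elim: n => [|n IH]; last by rewrite !exprS cabsM IH.
by rewrite !expr0 /cabs normr1.
Qed.

Lemma lec_real (x y : R) : ((x%:C%C : Cx) <= y%:C%C) = (x <= y).
Proof. exact: lecR. Qed.

Lemma ltc_real (x y : R) : ((x%:C%C : Cx) < y%:C%C) = (x < y).
Proof. exact: ltcR. Qed.

Lemma cabsD (z u : Cx) : cabs (z + u) <= cabs z + cabs u.
Proof. by rewrite -lec_real rmorphD /= -!cabsE ler_normD. Qed.

Lemma cabsN (z : Cx) : cabs (- z) = cabs z.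
Proof. by rewrite /cabs normrN. Qed.

Lemma cabs_real (x : R) : cabs (x%:C%C : Cx) = `|x|.
Proof. by rewrite cabs_sqrt /= expr0n addr0 sqrtr_sqr. Qed.

Lemma ler_Re_cabs (z : Cx) : `|complex.Re z| <= cabs z.
Proof. by rewrite -lec_real -cabsE; exact: normc_ge_Re. Qed.

Lemma ler_Im_cabs (z : Cx) : `|complex.Im z| <= cabs z.
Proof.
have -> : complex.Im z = - complex.Re (z * 'i%C : Cx) by rewrite ReiNIm opprK.
rewrite normrN; apply: le_trans (ler_Re_cabs _) _; rewrite cabsM.
by rewrite [cabs 'i%C]cabs_sqrt /= expr0n add0r expr1n sqrtr1 mulr1.
Qed.

Lemma cabs_le (z : Cx) : cabs z <= `|complex.Re z| + `|complex.Im z|.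
Proof.
rewrite {1}[z]complexE; apply: le_trans (cabsD _ _) _; rewrite cabsM !cabs_real.
by rewrite [cabs 'i%C]cabs_sqrt /= expr0n add0r expr1n sqrtr1 mul1r.
Qed.

End ComplexModulus.

Section ComplexContinuity.
Variables (R : realType) (X : topologicalType).
Local Notation Cx := (C R).

Lemma cts_Re (f : X -> Cx) x : cts_at f x -> cts_at (fun y => complex.Re (f y)) x.
Proof.
move=> cf; apply: (cts_comp cf (g := fun z : Cx => complex.Re z)); split.
move=> A /nbhs_ballP [e /= e0 sA]; apply/nbhs_ballP; exists (e%:C%C : Cx).
  by rewrite /= -[0]/((0 : R)%:C%C : Cx) ltc_real.
move=> z /= bz; apply: sA; rewrite -ball_normE /=.
by rewrite -ltc_real; apply: le_lt_trans bz; rewrite -raddfB /=; exact: normc_ge_Re.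
Qed.

Lemma cts_Im (f : X -> Cx) x : cts_at f x -> cts_at (fun y => complex.Im (f y)) x.
Proof.
move=> cf; apply: (cts_ext (ctsN (cts_Re (ctsM cf (cts_cst ('i%C : Cx) x))))) => y.
by rewrite ReiNIm opprK.
Qed.

Lemma cts_real_complex (f : X -> R) x : cts_at f x -> cts_at (fun y => ((f y)%:C%C : Cx)) x.
Proof.
move=> cf; apply: (cts_comp cf (g := fun z : R => (z%:C%C : Cx))); split.
move=> A /nbhs_ballP [e /= e0 sA]; apply/nbhs_ballP.
have er : e = (complex.Re e)%:C%C by rewrite RRe_real // gtr0_real.
exists (complex.Re e); first by rewrite /= -ltc_real -er.
move=> z /= bz; apply: sA; rewrite -ball_normE /=.
have -> : (f x)%:C%C - z%:C%C = ((f x - z)%:C%C : Cx) by rewrite rmorphB.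
by rewrite cabsE cabs_real er ltc_real.
Qed.

Lemma cts_complex (f g : X -> R) x : cts_at f x -> cts_at g x ->
  cts_at (fun y => ((f y +i* g y)%C : Cx)) x.
Proof.
move=> cf cg.
apply: (cts_ext (ctsD (cts_real_complex cf) (ctsM (cts_cst ('i%C : Cx) x) (cts_real_complex cg)))) => y.
by rewrite [RHS]complexE.
Qed.

Lemma cts_conjc (f : X -> Cx) x : cts_at f x -> cts_at (fun y => (conjc (f y) : Cx)) x.
Proof.
move=> cf; apply: (cts_ext (cts_complex (cts_Re cf) (ctsN (cts_Im cf)))) => y.
by case: (f y).
Qed.

Lemma cts_cabs (f : X -> Cx) x : cts_at f x -> cts_at (fun y => cabs (f y)) x.
Proof.
move=> cf.
apply: (cts_ext (cts_sqrt (ctsD (ctsX 2 (cts_Re cf)) (ctsX 2 (cts_Im cf))))) => y.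
by rewrite cabs_sqrt.
Qed.

End ComplexContinuity.

Lemma compact_cbox (R : realType) (M : R) : exists2 K : set (C R), compact K &
  forall z : C R, cabs z <= M -> K z.
Proof.
pose S := [set` `[- M, M]] `*` [set` `[- M, M]] : set (R * R).
exists ((fun p : R * R => (p.1 +i* p.2)%C : C R) @` S).
  apply: continuous_compact.
    apply: cts_within => p _; apply: cts_complex.
      by apply: cts_fst; exact: cts_id.
    by apply: cts_snd; exact: cts_id.
  by apply: compact_setX; exact: segment_compact.
move=> z zM; exists (complex.Re z, complex.Im z); last by case: z {zM}.
by split; rewrite /= in_itv /= -ler_norml; apply: le_trans zM; rewrite ?ler_Re_cabs ?ler_Im_cabs.
Qed.

Section SymmetricPower.
Variables (T : topologicalType) (m : nat).
Local Open Scope quotient_scope.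

Definition entries (z : 'rV[T]_m) : seq T := [seq z 0 i | i : 'I_m].

Definition to_sym (z : 'rV[T]_m) : Sym T m :=
  \pi_(quotient_topology {eq_quot (sym_equiv T m)}) z.

Lemma size_entries z : size (entries z) = m.
Proof. by rewrite size_map size_enum_ord. Qed.

Lemma size_pts (D : Sym T m) : size (pts D) = m.
Proof. exact: size_entries. Qed.

Lemma pts_repr (D : Sym T m) : exists2 z, D = to_sym z & pts D = entries z.
Proof.
by exists (repr (D : {eq_quot (sym_equiv T m)})) => //; rewrite /to_sym reprK.
Qed.

Lemma entries_col_perm (s : 'S_m) (z : 'rV[T]_m) :
  entries (col_perm s z) = [tuple z 0 (s i) | i < m] :> seq T.
Proof. by apply: eq_map => i; rewrite mxE. Qed.

Lemma perm_entriesP (z u : 'rV[T]_m) :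
  perm_eq (entries z) (entries u) <-> to_sym z = to_sym u.
Proof.
split.
  rewrite perm_sym; have -> : entries z = [tuple z 0 i | i < m] by [].
  move/tuple_permP => [s es]; apply/eqmodP; rewrite /= /sym_rel.
  apply/existsP; exists s; apply/eqP/rowP => j.
  have := congr1 (fun w => nth (u 0 j) w j) es.
  rewrite (nth_map j) ?size_enum_ord // nth_ord_enum (nth_map j) ?size_enum_ord //.
  by rewrite nth_ord_enum tnth_mktuple mxE.
move/eqmodP => /existsP [s /eqP ->].
rewrite entries_col_perm perm_sym; have -> : entries z = [tuple z 0 i | i < m] by [].
by apply/tuple_permP; exists s; apply: eq_map => i; rewrite tnth_mktuple.
Qed.

Lemma pts_to_sym (z : 'rV[T]_m) : perm_eq (pts (to_sym z)) (entries z).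
Proof. by have [u e ->] := pts_repr (to_sym z); apply/perm_entriesP. Qed.

Lemma sym_ext (D D' : Sym T m) : perm_eq (pts D) (pts D') -> D = D'.
Proof.
by have [z -> ->] := pts_repr D; have [u -> ->] := pts_repr D' => /perm_entriesP.
Qed.

Lemma entries_surj (s : seq T) : size s = m -> exists z, entries z = s.
Proof.
move=> sm; exists (\row_i tnth (Tuple (introT eqP sm)) i).
transitivity (val (Tuple (introT eqP sm))); last by [].
rewrite [RHS](_ : _ = [seq tnth (Tuple (introT eqP sm)) i | i : 'I_m]).
  by apply: eq_map => i; rewrite mxE.
exact: (esym (map_tnth_enum (Tuple (introT eqP sm)))).
Qed.

Lemma sym_surj (s : seq T) : size s = m -> exists D : Sym T m, perm_eq (pts D) s.
Proof. by move=> /entries_surj [z <-]; exists (to_sym z); exact: pts_to_sym. Qed.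

Lemma to_sym_continuous : continuous to_sym.
Proof. exact: pi_continuous. Qed.

(** The quotient by a group action is open: the saturation of an open set is the union of its images
    under the permutations. *)
Lemma to_sym_open (z : 'rV[T]_m) (A : set 'rV[T]_m) :
  nbhs z A -> nbhs (to_sym z) (to_sym @` A).
Proof.
move=> nA; have oU := @open_interior _ A; have Uz : A° z by [].
have UA := @interior_subset _ A; move: (A°) oU Uz UA => U oU Uz UA.
apply: (@filterS _ (nbhs (to_sym z)) _ (to_sym @` U)); first exact: image_subset.
apply: open_nbhs_nbhs; split; last by exists z.
rewrite /open /= /quotient_open.
have -> : \pi_(quotient_topology {eq_quot (sym_equiv T m)}) @^-1` (to_sym @` U) =
          \bigcup_(s in [set: 'S_m]) (col_perm s @^-1` U).
  apply/seteqP; split => [x [u Uu e]|x [s _ Ux]].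
    move/esym/eqmodP: e => /existsP [s /eqP es]; exists s => //.
    by rewrite /= -es.
  exists (col_perm s x) => //; apply/esym/eqmodP/existsP; by exists s.
apply: bigcup_open => s _; apply: open_comp => // x _.
have [] // : cts_at (fun y : 'rV[T]_m => col_perm s y) x.
apply: cts_mx => i j; apply: (cts_ext (cts_coord i (s j) (cts_id x))) => y.
by rewrite mxE.
Qed.

(** A product with a quotient map need not be a quotient map. Openness of [to_sym] is what allows
    continuity on the product to be tested on representatives. *)
Lemma cts_sym (X Y : topologicalType) (f : X * Sym T m -> Y) x z :
  cts_at (fun p : X * 'rV[T]_m => f (p.1, to_sym p.2)) (x, z) ->
  cts_at f (x, to_sym z).
Proof.
move=> [cf]; split => A /cf [[P Q] [/= nP nQ] sPQ].
exists (P, to_sym @` Q); first by split => //; exact: to_sym_open.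
by move=> [x' _] [/= Px' [z' Qz' <-]]; exact: (sPQ (x', z')).
Qed.

End SymmetricPower.

Section RootPolynomials.
Variable R : realType.
Local Notation Cx := (C R).

Definition rootpoly (s : seq Cx) : {poly Cx} := \prod_(z <- s) ('X - z%:P).

Lemma rootpoly_cons z s : rootpoly (z :: s) = ('X - z%:P) * rootpoly s.
Proof. by rewrite /rootpoly big_cons. Qed.

Lemma perm_rootpoly s t : perm_eq s t -> rootpoly s = rootpoly t.
Proof. by move=> st; apply: perm_big. Qed.

Lemma size_rootpoly s : size (rootpoly s) = (size s).+1.
Proof. exact: size_prod_XsubC. Qed.

Lemma monic_rootpoly s : rootpoly s \is monic.
Proof. exact: monic_prod_XsubC. Qed.

Lemma rootpoly_inj s t : rootpoly s = rootpoly t -> perm_eq s t.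
Proof.
by move=> e; apply/allP => x _ /=; rewrite -!mu_prod_XsubC -!/(rootpoly _) e.
Qed.

Lemma rootpoly_surj m (P : {poly Cx}) : P \is monic -> size P = m.+1 ->
  exists2 s, size s = m & P = rootpoly s.
Proof.
move=> /monicP Pm sP.
have [s e] := @closed_field_poly_normal R[i] P.
have {}e : P = rootpoly s by rewrite [LHS]e (Pm : lead_coef (P : {poly R[i]}) = 1) scale1r.
by exists s => //; move: sP; rewrite e size_rootpoly => -[].
Qed.

Lemma cts_rootpoly (X : topologicalType) (I : Type) (r : seq I) (g : I -> X -> Cx) x k :
  (forall i, cts_at (g i) x) -> cts_at (fun y => (\prod_(i <- r) ('X - (g i y)%:P))`_k) x.
Proof.
move=> gc; elim: r k => [|i r IH] k.
  by apply: (cts_ext (cts_cst ((1%R : {poly Cx})`_k) x)) => y; rewrite big_nil.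
pose F y := \prod_(i <- r) ('X - (g i y)%:P).
case: k => [|k].
  apply: (cts_ext (ctsN (ctsM (gc i) (IH 0%N)))) => y.
  by rewrite big_cons mulrBl coefB coefXM coefCM /= sub0r.
apply: (cts_ext (ctsB (IH k) (ctsM (gc i) (IH k.+1)))) => y.
by rewrite big_cons mulrBl coefB coefXM coefCM.
Qed.

(** For [|z| > 1] all lower powers of [z] are at most [|z|^(n-1)], and dividing the equation by this
    power gives [|z| <= n M]. The summand 1 takes care of [|z| <= 1]. *)
Lemma root_bound (s : seq Cx) (M : R) z : 0 <= M ->
  (forall k, (k < size s)%N -> cabs (rootpoly s)`_k <= M) -> z \in s ->
  cabs z <= 1 + (size s)%:R * M.
Proof.
move=> M0 H zs.
have n0 : (0 : R) <= (size s)%:R * M by rewrite mulr_ge0.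
have [z1|z1] := leP (cabs z) 1; first by apply: le_trans z1 _; rewrite lerDl.
have rz : (rootpoly s).[z] = 0 by apply/rootP; rewrite root_prod_XsubC.
move: zs; case es : (size s) => [|n] zs; first by move: zs; rewrite (size0nil es).
have : z ^+ n.+1 = - \sum_(i < n.+1) (rootpoly s)`_i * z ^+ i.
  apply/eqP; rewrite -addr_eq0 addrC -[X in _ == X]rz horner_coef size_rootpoly es.
  rewrite [X in _ == X]big_ord_recr /=.
  have := monicP (monic_rootpoly s); rewrite lead_coefE size_rootpoly es /= => ->.
  by rewrite mul1r.
move=> /(congr1 (@cabs R)); rewrite cabsN cabsX => e.
have c0 := cabs_ge0 z.
have : cabs z ^+ n.+1 <= n.+1%:R * M * cabs z ^+ n.
  rewrite e; apply: le_trans (_ : \sum_(i < n.+1) cabs ((rootpoly s)`_i * z ^+ i) <= _).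
    elim/big_rec2: _ => [|i y1 y2 _ IH]; first by rewrite /cabs normr0.
    by apply: le_trans (cabsD _ _) _; rewrite lerD2l.
  rewrite -mulrA mulr_natl -[X in _ *+ X](card_ord n.+1) -sumr_const; apply: ler_sum => i _.
  rewrite cabsM cabsX; apply: ler_pM => //; rewrite ?cabs_ge0 ?exprn_ge0 //.
    by apply: H; rewrite es.
  by rewrite ler_weXn2l // ?ltW // -ltnS.
rewrite exprS ler_pM2r ?exprn_gt0 //; last exact: lt_trans z1.
by move=> h; apply: le_trans h _; rewrite lerDr.
Qed.

End RootPolynomials.

Section ConfigurationSpace.
Variables (R : realType) (p m : nat).
Local Notation Cx := (C R).

Definition config : topologicalType := ('rV[R]_p * Sym Cx m)%type.

Lemma compact_config (M : R) : exists2 K : set config, compact K &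
  forall D : config, (forall i, `|D.1 0 i| <= M) ->
    (forall z : Cx, z \in pts D.2 -> cabs z <= M) -> K D.
Proof.
have [K cK HK] := compact_cbox M.
exists ([set y : 'rV[R]_p | forall i, `[- M, M]%classic (y 0 i)] `*`
        (@to_sym Cx m @` [set z : 'rV[Cx]_m | forall i, K (z 0 i)])).
  apply: compact_setX.
    apply: (@rV_compact R p (fun=> `[- M, M]%classic)) => i.
    exact: segment_compact.
  apply: continuous_compact; first by apply: continuous_subspaceT; exact: to_sym_continuous.
  exact: (@rV_compact Cx m (fun=> K)).
move=> [y D] /= Hy; have [z -> ->] := pts_repr D => HD; split => /=.
  by move=> i; rewrite in_itv /= -ler_norml.
by exists z => // i /=; apply: HK; apply: HD; apply: map_f; rewrite mem_enum.
Qed.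

Lemma cts_config (Y : topologicalType) (f : config -> Y) D :
  (forall y z, cts_at (fun u : 'rV[R]_p * 'rV[Cx]_m => f (u.1, to_sym u.2)) (y, z)) ->
  cts_at f D.
Proof.
by move=> H; case: D => y D; have [z -> _] := pts_repr D; exact: cts_sym.
Qed.

Lemma cts_pts_coef k (y : 'rV[R]_p) (z : 'rV[Cx]_m) :
  cts_at (fun u : 'rV[R]_p * 'rV[Cx]_m => (rootpoly (pts (to_sym u.2)))`_k) (y, z).
Proof.
have H := @cts_rootpoly R ('rV[R]_p * 'rV[Cx]_m)%type 'I_m (enum 'I_m) (fun i u => u.2 0 i) (y, z) k.
apply: (cts_ext (H _)) => [i|u].
  by apply: cts_coord; apply: cts_snd; exact: cts_id.
rewrite (perm_rootpoly (pts_to_sym _)); congr (polyseq _)`_k.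
by rewrite [RHS]big_map.
Qed.

Definition coefRe (D : Sym Cx m) : 'rV[R]_m := \row_k complex.Re (rootpoly (pts D))`_k.
Definition coefIm (D : Sym Cx m) : 'rV[R]_m := \row_k complex.Im (rootpoly (pts D))`_k.

Definition viete_coord (D : config) : 'rV[R]_(p + (m + m)) :=
  row_mx D.1 (row_mx (coefRe D.2) (coefIm D.2)).

Lemma cts_row_mx (X : topologicalType) n1 n2 (f : X -> 'rV[R]_n1) (g : X -> 'rV[R]_n2) x :
  cts_at f x -> cts_at g x -> cts_at (fun y => row_mx (f y) (g y)) x.
Proof.
move=> cf cg; apply: cts_mx => i j; case: (split_ordP j) => l ->.
  by apply: (cts_ext (cts_coord i l cf)) => y; rewrite row_mxEl.
by apply: (cts_ext (cts_coord i l cg)) => y; rewrite row_mxEr.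
Qed.

Lemma viete_coord_continuous : continuous viete_coord.
Proof.
apply: cts_all => D; apply: cts_config => y z; apply: cts_row_mx.
  exact: (cts_fst (cts_id _)).
apply: cts_row_mx; apply: cts_mx => i j.
  by apply: (cts_ext (cts_Re (cts_pts_coef j y z))) => u; rewrite mxE.
by apply: (cts_ext (cts_Im (cts_pts_coef j y z))) => u; rewrite mxE.
Qed.

Lemma coef_inj (D D' : Sym Cx m) :
  (forall k, (k < m)%N -> (rootpoly (pts D))`_k = (rootpoly (pts D'))`_k) -> D = D'.
Proof.
move=> H; apply: sym_ext; apply: rootpoly_inj; apply/polyP => k.
have [km|] := ltnP k m; first exact: H.
rewrite leq_eqVlt => /predU1P [<-|mk]; last first.
  by rewrite !nth_default // size_rootpoly size_pts.
have L D0 : (rootpoly (pts (D0 : Sym Cx m)))`_m = 1.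
  by have := monicP (monic_rootpoly (pts D0)); rewrite lead_coefE size_rootpoly size_pts.
by rewrite !L.
Qed.

Lemma viete_coord_inj : injective viete_coord.
Proof.
move=> [y D] [y' D'] /eq_row_mx [/= -> /eq_row_mx [/rowP eR /rowP eI]]; congr pair.
apply: coef_inj => k km; have := eR (Ordinal km); have := eI (Ordinal km).
by rewrite !mxE /=; move: (rootpoly _)`_k (rootpoly _)`_k => [a b] [a' b'] /= -> ->.
Qed.

Lemma viete_coord_surj x : exists D, viete_coord D = x.
Proof.
pose a := lsubmx (rsubmx x); pose b := rsubmx (rsubmx x).
pose c (i : nat) : Cx := if insub i is Some k then (a 0 k +i* b 0 k)%C else 0.
pose P : {poly Cx} := 'X^m + \poly_(i < m) c i.
have sP : size P = m.+1.
  by rewrite size_polyDl size_polyXn // ltnS size_poly.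
have mP : P \is monic.
  rewrite monicE lead_coefDl ?lead_coefXn // size_polyXn ltnS; exact: size_poly.
have [s ss eP] := rootpoly_surj mP sP.
have [D Ds] := sym_surj ss.
have co (k : 'I_m) : (rootpoly (pts D))`_k = (a 0 k +i* b 0 k)%C.
  rewrite (perm_rootpoly Ds) -eP coefD coefXn ltn_eqF // add0r coef_poly ltn_ord /c.
  by rewrite valK.
exists (lsubmx x, D); rewrite /viete_coord -[RHS]hsubmxK; congr row_mx.
rewrite -[RHS]hsubmxK; congr row_mx; apply/rowP => k; by rewrite mxE co.
Qed.

Lemma viete_coord_proper (M : R) : exists2 K : set config, compact K &
  forall D, dot (viete_coord D) (viete_coord D) <= M -> K D.
Proof.
(* Real points are bounded by [1 + M]. A complex coefficient has modulus at most
   [(1 + M) + (1 + M)], so [root_bound] gives [1 + m ((1 + M) + (1 + M))] for the complex points;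
   the sum dominates both bounds. *)
have [K cK HK] := compact_config (1 + (1 + M) + m%:R * ((1 + M) + (1 + M))).
exists K => // D H.
have M0 : 0 <= M by apply: le_trans H; exact: dot_ge0.
have B (j : 'I_(p + (m + m))) : `|viete_coord D 0 j| <= 1 + M by exact: le_norm_dot.
have mM : 0 <= m%:R * ((1 + M) + (1 + M)) by rewrite mulr_ge0 //; lra.
apply: HK => [i|z zD].
  have := B (lshift _ i); rewrite row_mxEl => h; apply: le_trans h _; lra.
apply: le_trans (_ : 1 + m%:R * ((1 + M) + (1 + M)) <= _); last by lra.
rewrite -[in X in _ + X](size_pts D.2); apply: root_bound zD; first lra.
rewrite size_pts => k km; apply: le_trans (cabs_le _) _; apply: lerD.
  by have := B (rshift p (lshift m (Ordinal km))); rewrite row_mxEr row_mxEl mxE.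
by have := B (rshift p (rshift m (Ordinal km))); rewrite !row_mxEr mxE.
Qed.

Lemma viete_coord_homeo : exists g : 'rV[R]_(p + (m + m)) -> config,
  [/\ cancel viete_coord g, cancel g viete_coord & continuous g].
Proof.
have [g gK] := choice viete_coord_surj.
have Kg : cancel viete_coord g by move=> D; apply: viete_coord_inj; rewrite gK.
exists g; split => //.
exact: homeo_global_rV Kg gK viete_coord_continuous viete_coord_proper.
Qed.

(** Separation is pulled back along the injective continuous Viete coordinates instead of being
    derived from the quotient. *)
Lemma config_hausdorff : hausdorff_space config.
Proof.
move=> D D' H; apply: viete_coord_inj; apply: (@hausdorff_rV R) => A B nA nB.
have [y [Ay By]] := H _ _ (viete_coord_continuous nA) (viete_coord_continuous nB).
by exists (viete_coord y).
Qed.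

End ConfigurationSpace.

(** * Charts of the configuration space *)

Section FoldMinMax.
Variable R : realType.
Implicit Types (s t : seq R) (b x : R).

Lemma le_foldr_min b s x : (x <= foldr Num.min b s) = (x <= b) && all (>= x) s.
Proof. by elim: s => [|a s IH] /=; rewrite ?andbT // le_min IH andbCA. Qed.

Lemma lt_foldr_min b s x : (x < foldr Num.min b s) = (x < b) && all (> x) s.
Proof. by elim: s => [|a s IH] /=; rewrite ?andbT // lt_min IH andbCA. Qed.

Lemma foldr_max_le b s x : (foldr Num.max b s <= x) = (b <= x) && all (<= x) s.
Proof. by elim: s => [|a s IH] /=; rewrite ?andbT // ge_max IH andbCA. Qed.

Lemma foldr_max_lt b s x : (foldr Num.max b s < x) = (b < x) && all (< x) s.
Proof. by elim: s => [|a s IH] /=; rewrite ?andbT // gt_max IH andbCA. Qed.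

Lemma perm_foldr_min b s t : perm_eq s t -> foldr Num.min b s = foldr Num.min b t.
Proof.
move=> st; apply: le_anti; apply/andP; split; rewrite le_foldr_min.
  by rewrite -(perm_all _ st) -le_foldr_min.
by rewrite (perm_all _ st) -le_foldr_min.
Qed.

Lemma perm_foldr_max b s t : perm_eq s t -> foldr Num.max b s = foldr Num.max b t.
Proof.
move=> st; apply: le_anti; apply/andP; split; rewrite foldr_max_le.
  by rewrite (perm_all _ st) -foldr_max_le.
by rewrite -(perm_all _ st) -foldr_max_le.
Qed.

Lemma foldr_minD b s x :
  foldr Num.min (b + x) [seq a + x | a <- s] = foldr Num.min b s + x.
Proof. by elim: s => //= a s ->; rewrite addr_minl. Qed.

Lemma foldr_minZ b s x : 0 <= x ->
  foldr Num.min (x * b) [seq x * a | a <- s] = x * foldr Num.min b s.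
Proof. by move=> x0; elim: s => //= a s ->; rewrite minr_pMr. Qed.

Lemma foldr_maxZ b s x : 0 <= x ->
  foldr Num.max (x * b) [seq x * a | a <- s] = x * foldr Num.max b s.
Proof. by move=> x0; elim: s => //= a s ->; rewrite maxr_pMr. Qed.

Lemma cts_foldr_min (X : topologicalType) (I : Type) (r : seq I) (b : X -> R)
    (g : I -> X -> R) u : cts_at b u -> (forall i, cts_at (g i) u) ->
  cts_at (fun y => foldr Num.min (b y) [seq g i y | i <- r]) u.
Proof. by move=> cb cg; elim: r => //= i r IH; exact: cts_min. Qed.

Lemma cts_foldr_max (X : topologicalType) (I : Type) (r : seq I) (b : X -> R)
    (g : I -> X -> R) u : cts_at b u -> (forall i, cts_at (g i) u) ->
  cts_at (fun y => foldr Num.max (b y) [seq g i y | i <- r]) u.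
Proof. by move=> cb cg; elim: r => //= i r IH; exact: cts_max. Qed.

End FoldMinMax.

Lemma perm_eq_in_map (T1 T2 : eqType) (f g : T1 -> T2) (s : seq T1) :
  {in s, f =1 g} -> perm_eq (map f s) (map g s).
Proof. by move=> /eq_in_map ->. Qed.

Section AffineMotions.
Variables (R : realType) (p m : nat).
Local Notation Cx := (C R).
Local Notation config := (config R p m).
Local Open Scope quotient_scope.

Definition sym_map (f : Cx -> Cx) (D : Sym Cx m) : Sym Cx m :=
  to_sym (\row_i f ((repr (D : {eq_quot (sym_equiv Cx m)})) 0 i)).

Lemma entries_map (f : Cx -> Cx) (z : 'rV[Cx]_m) :
  entries (\row_i f (z 0 i)) = [seq f u | u <- entries z].
Proof. by rewrite /entries /image_mem -[RHS]map_comp; apply: eq_map => i /=; rewrite mxE. Qed.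

Lemma map_entries (A : Type) (f : Cx -> A) (z : 'rV[Cx]_m) :
  [seq f u | u <- entries z] = [seq f (z 0 i) | i <- enum 'I_m].
Proof. by rewrite /entries /image_mem -[LHS]map_comp. Qed.

Lemma pts_sym_map f D : perm_eq (pts (sym_map f D)) [seq f u | u <- pts D].
Proof. by apply: perm_trans (pts_to_sym _) _; rewrite entries_map. Qed.

Lemma sym_map_to_sym f z : sym_map f (to_sym z) = to_sym (\row_i f (z 0 i)).
Proof.
apply/perm_entriesP; rewrite !entries_map; apply: perm_map.
exact: pts_to_sym.
Qed.

Lemma sym_map_comp f g D : sym_map f (sym_map g D) = sym_map (f \o g) D.
Proof.
have [z -> _] := pts_repr D; rewrite !sym_map_to_sym; congr to_sym.
by apply/rowP => i; rewrite !mxE.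
Qed.

Lemma eq_sym_map f g D : {in pts D, f =1 g} -> sym_map f D = sym_map g D.
Proof.
move=> /eq_in_map fg; apply: sym_ext; apply: perm_trans (pts_sym_map _ _) _.
by rewrite perm_sym fg; exact: pts_sym_map.
Qed.

Lemma sym_map_id D : sym_map id D = D.
Proof. by apply: sym_ext; apply: perm_trans (pts_sym_map _ _) _; rewrite map_id. Qed.

(** Dilations, real translations and [raise] are all of this form. The real points are labelled and
    may be shifted independently by [v]; the complex points are not, so they share one shift [s]. *)
Definition aff (a : R) (v : 'rV[R]_p) (s : Cx) (D : config) : config :=
  (a *: D.1 + v, sym_map (fun z => a%:C%C * z + s) D.2).

Lemma aff_comp a v s a' v' s' D :
  aff a v s (aff a' v' s' D) = aff (a * a') (a *: v' + v) (a%:C%C * s' + s) D.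
Proof.
rewrite /aff /= scalerDr scalerA addrA sym_map_comp; congr pair.
by apply: eq_sym_map => z _ /=; rewrite rmorphM mulrDr mulrA addrA.
Qed.

Lemma aff_id D : aff 1 0 0 D = D.
Proof.
case: D => y D; rewrite /aff /= scale1r addr0; congr pair.
by rewrite -[RHS]sym_map_id; apply: eq_sym_map => z _; rewrite mul1r addr0.
Qed.

Lemma cts_aff (X : topologicalType) (a : X -> R) (v : X -> 'rV[R]_p) (s : X -> Cx)
    (D : X -> config) x :
  cts_at a x -> cts_at v x -> cts_at s x -> cts_at D x ->
  cts_at (fun y => aff (a y) (v y) (s y) (D y)) x.
Proof.
move=> ca cv cs cD.
pose P := (R * 'rV[R]_p * Cx * 'rV[R]_p)%type.
pose F (q : P * Sym Cx m) := aff q.1.1.1.1 q.1.1.1.2 q.1.1.2 (q.1.2, q.2).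
(* All parameters and the real points are packed into one factor, so that [cts_sym] applies to the
   remaining symmetric power. *)
have c1 : cts_at (fun y => ((a y, v y, s y, (D y).1), (D y).2) : P * Sym Cx m) x.
  exact: (cts_pair (cts_pair (cts_pair (cts_pair ca cv) cs) (cts_fst cD)) (cts_snd cD)).
have c2 : cts_at F ((a x, v x, s x, (D x).1), (D x).2).
  move: (a x, v x, s x, (D x).1) (D x).2 => q E.
  have [z -> _] := pts_repr E; apply: cts_sym.
  pose G (u : P * 'rV[Cx]_m) : config :=
    (u.1.1.1.1 *: u.1.2 + u.1.1.1.2, to_sym (\row_i ((u.1.1.1.1)%:C%C * u.2 0 i + u.1.1.2) : 'rV[Cx]_m)).
  have iP : cts_at (fun u : P * 'rV[Cx]_m => u.1) (q, z) := cts_fst (cts_id _).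
  have iz : cts_at (fun u : P * 'rV[Cx]_m => u.2) (q, z) := cts_snd (cts_id _).
  apply: (@cts_ext _ _ G); last first.
    by move=> u; rewrite /G /F /aff /= sym_map_to_sym.
  apply: cts_pair.
    apply: ctsDv; first apply: ctsZ.
    - exact: (cts_fst (cts_fst (cts_fst iP))).
    - exact: (cts_snd iP).
    - exact: (cts_snd (cts_fst (cts_fst iP))).
  apply: (cts_comp (g := @to_sym Cx m)); last by apply: cts_each; exact: to_sym_continuous.
  apply: cts_mx => i j.
  have c := ctsD (ctsM (cts_real_complex (cts_fst (cts_fst (cts_fst iP)))) (cts_coord 0 j iz)) (cts_snd (cts_fst iP)).
  by apply: (cts_ext c) => u; rewrite mxE.
apply: (cts_ext (cts_comp c1 c2)) => y.
by rewrite /F /=; case: (D y).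
Qed.

Definition dil (t : R) : config -> config := aff t 0 0.

Lemma dilA s t D : dil s (dil t D) = dil (s * t) D.
Proof. by rewrite /dil aff_comp scaler0 mulr0 !addr0. Qed.

Lemma dil1 D : dil 1 D = D.
Proof. exact: aff_id. Qed.

Definition gapidx : seq ('I_p * 'I_p) :=
  seq.filter (fun ij : 'I_p * 'I_p => val ij.2 == (val ij.1).+1) (enum [set: 'I_p * 'I_p]%SET).

(* The nonnegative functionals cutting the closed cell out of the configuration space. *)
Definition walls (D : config) : seq R :=
  [seq D.1 0 ij.2 - D.1 0 ij.1 | ij <- gapidx] ++ [seq complex.Im z | z <- pts D.2].

Definition nwalls : nat := (size gapidx + m)%N.

Lemma size_walls D : size (walls D) = nwalls.
Proof. by rewrite size_cat size_map (size_map _ (pts _)) size_pts. Qed.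

Definition wall_mean (D : config) : R := (\sum_(x <- walls D) x) / nwalls%:R.

(* The minimum of the walls (their mean is never below it); starting the fold at the
   mean rather than at a constant makes [slack] equivariant under [raise]. *)
Definition slack (D : config) : R := foldr Num.min (wall_mean D) (walls D).

Definition radius (D : config) : R :=
  foldr Num.max 0 ([seq `|D.1 0 i| | i : 'I_p] ++ [seq cabs z | z <- pts D.2]).

Lemma wall_mean_ge0 D : all (>= 0) (walls D) -> 0 <= wall_mean D.
Proof.
move=> /allP H; rewrite /wall_mean divr_ge0 // big_seq; apply: sumr_ge0 => x.
exact: H.
Qed.

Lemma wall_mean_gt0 D : (0 < nwalls)%N -> all (> 0) (walls D) -> 0 < wall_mean D.
Proof.
move=> n0 H; rewrite /wall_mean divr_gt0 ?ltr0n //.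
have := size_walls D; case: (walls D) H => [_ /= n|a s]; first by rewrite -n in n0.
move=> /= /andP [a0 /allP H _]; rewrite big_cons ltr_wpDr // big_seq.
by apply: sumr_ge0 => x /H /ltW.
Qed.

Lemma slack_ge0 D : (0 <= slack D) = all (>= 0) (walls D).
Proof.
rewrite /slack le_foldr_min; apply: andb_idl; exact: wall_mean_ge0.
Qed.

Lemma slack_gt0 D : (0 < nwalls)%N -> (0 < slack D) = all (> 0) (walls D).
Proof.
move=> n0; rewrite /slack lt_foldr_min; apply: andb_idl; exact: wall_mean_gt0.
Qed.

(** With [a = 1] this governs [raise], with [c = 0] dilations and real translations. All walls
    change by the same affine map, so their mean changes by it too, and so does their minimum when
    [a] is nonnegative. *)
Lemma perm_walls_aff (a : R) (v : 'rV[R]_p) (s : Cx) (c : R) (D : config) :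
  (forall ij, ij \in gapidx -> v 0 ij.2 - v 0 ij.1 = c) -> complex.Im s = c ->
  perm_eq (walls (aff a v s D)) [seq a * x + c | x <- walls D].
Proof.
move=> vc sc; rewrite /walls map_cat; apply: perm_cat.
  rewrite -map_comp (_ : map _ _ = [seq ((fun x => a * x + c) \o (fun ij => D.1 0 ij.2 - D.1 0 ij.1)) ij | ij <- gapidx]) //.
  by apply: perm_eq_in_map => ij /vc <-; rewrite /= !mxE; ring.
apply: perm_trans (perm_map _ (pts_sym_map _ _)) _.
move: (pts D.2) => l; rewrite -!map_comp (_ : map _ _ = [seq ((fun x => a * x + c) \o complex.Im (R:=R)) z | z <- l]) //.
by apply: perm_eq_in_map => -[x y] _; rewrite /= -sc; case: s {sc} => s1 s2 /=; ring.
Qed.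

Lemma wall_mean_aff (a : R) (v : 'rV[R]_p) (s : Cx) (c : R) (D : config) : (0 < nwalls)%N ->
  (forall ij, ij \in gapidx -> v 0 ij.2 - v 0 ij.1 = c) -> complex.Im s = c ->
  wall_mean (aff a v s D) = a * wall_mean D + c.
Proof.
move=> n0 vc sc; rewrite /wall_mean (perm_big _ (perm_walls_aff a D vc sc)) /=.
rewrite big_map big_split /= -mulr_sumr mulrDl mulrA; congr (_ + _).
have -> : \sum_(i <- walls D) c = c * nwalls%:R.
  by rewrite big_const_seq count_predT size_walls iter_addr_0 mulr_natr.
by rewrite mulfK // pnatr_eq0 -lt0n.
Qed.

Lemma slack_aff (a : R) (v : 'rV[R]_p) (s : Cx) (c : R) (D : config) : (0 < nwalls)%N -> 0 <= a ->
  (forall ij, ij \in gapidx -> v 0 ij.2 - v 0 ij.1 = c) -> complex.Im s = c ->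
  slack (aff a v s D) = a * slack D + c.
Proof.
move=> n0 a0 vc sc; rewrite /slack (wall_mean_aff _ _ n0 vc sc).
rewrite (perm_foldr_min _ (perm_walls_aff a D vc sc)) -foldr_minZ // -foldr_minD.
by rewrite -map_comp.
Qed.

Definition wallfun (i : 'I_p * 'I_p + 'I_m) (u : 'rV[R]_p * 'rV[Cx]_m) : R :=
  match i with
  | inl ij => u.1 0 ij.2 - u.1 0 ij.1
  | inr k => complex.Im (u.2 0 k)
  end.

Lemma perm_walls_rep y (z : 'rV[Cx]_m) :
  perm_eq (walls (y, to_sym z))
    [seq wallfun i (y, z) | i <- map inl gapidx ++ map inr (enum 'I_m)].
Proof.
rewrite map_cat -(map_comp _ inl) -(map_comp _ inr); apply: perm_cat => //.
apply: perm_trans (perm_map _ (pts_to_sym _)) _.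
by rewrite map_entries.
Qed.

Lemma cts_wallfun i u : cts_at (wallfun i) u.
Proof.
case: i => [ij|k].
  have c : cts_at (fun u : 'rV[R]_p * 'rV[Cx]_m => u.1) u := cts_fst (cts_id _).
  exact: (ctsB (cts_coord 0 ij.2 c) (cts_coord 0 ij.1 c)).
have c : cts_at (fun u : 'rV[R]_p * 'rV[Cx]_m => u.2) u := cts_snd (cts_id _).
exact: (cts_Im (cts_coord 0 k c)).
Qed.

Lemma cts_wall_mean D : cts_at wall_mean D.
Proof.
apply: cts_config => y z.
have c := ctsM (cts_sum (map inl gapidx ++ map inr (enum 'I_m)) (fun i => cts_wallfun i (y, z)))
  (cts_cst (nwalls%:R^-1 : R) (y, z)).
by apply: (cts_ext c) => u; rewrite /wall_mean (perm_big _ (perm_walls_rep _ _)) big_map; case: u.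
Qed.

Lemma cts_slack D : cts_at slack D.
Proof.
apply: cts_config => y z.
have cm : cts_at (fun u : 'rV[R]_p * 'rV[Cx]_m => wall_mean (u.1, to_sym u.2)) (y, z).
  have c : cts_at (fun u : 'rV[R]_p * 'rV[Cx]_m => (u.1, to_sym u.2) : config) (y, z).
    apply: cts_pair; first exact: (cts_fst (cts_id _)).
    apply: (cts_comp (cts_snd (cts_id (y, z)))); apply: cts_each; exact: to_sym_continuous.
  exact: cts_comp c (cts_wall_mean _).
have c := cts_foldr_min (map inl gapidx ++ map inr (enum 'I_m)) cm (fun i => cts_wallfun i (y, z)).
by apply: (cts_ext c) => u; rewrite /slack (perm_foldr_min _ (perm_walls_rep _ _)); case: u.
Qed.

Lemma cts_radius D : cts_at radius D.
Proof.
apply: cts_config => y z.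
pose g (i : 'I_p + 'I_m) (u : 'rV[R]_p * 'rV[Cx]_m) := match i with
  | inl i => `|u.1 0 i|
  | inr k => cabs (u.2 0 k) end.
have gc i : cts_at (g i) (y, z).
  case: i => [i|k].
    exact: (cts_norm (cts_coord 0 i (cts_fst (cts_id (y, z))))).
  exact: (cts_cabs (cts_coord 0 k (cts_snd (cts_id (y, z))))).
have c := cts_foldr_max (map inl (enum 'I_p) ++ map inr (enum 'I_m)) (cts_cst (0 : R) (y, z)) gc.
apply: (cts_ext c) => u; rewrite /radius map_cat -(map_comp _ inl) -(map_comp _ inr).
apply: perm_foldr_max; rewrite perm_sym; apply: perm_cat => //.
apply: perm_trans (perm_map _ (pts_to_sym _)) _.
by rewrite map_entries.
Qed.

Lemma radius_ge0 D : 0 <= radius D.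
Proof. by have := lexx (radius D); rewrite {1}/radius foldr_max_le => /andP []. Qed.

Lemma radius_leP D x : 0 <= x -> (radius D <= x) <->
  (forall i, `|D.1 0 i| <= x) /\ (forall z, z \in pts D.2 -> cabs z <= x).
Proof.
move=> x0; rewrite /radius foldr_max_le x0 all_cat; split.
  move=> /= /andP [/allP H1 /allP H2]; split=> [i|z zD]; first by apply: H1; apply: map_f; rewrite mem_enum.
  by apply: H2; exact: map_f.
by move=> [H1 H2] /=; apply/andP; split; apply/allP => _ /mapP [i Hi ->]; [exact: H1|exact: H2].
Qed.

Lemma radius_ltP D x : 0 < x -> (radius D < x) <->
  (forall i, `|D.1 0 i| < x) /\ (forall z, z \in pts D.2 -> cabs z < x).
Proof.
move=> x0; rewrite /radius foldr_max_lt x0 all_cat; split.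
  move=> /= /andP [/allP H1 /allP H2]; split=> [i|z zD]; first by apply: H1; apply: map_f; rewrite mem_enum.
  by apply: H2; exact: map_f.
by move=> [H1 H2] /=; apply/andP; split; apply/allP => _ /mapP [i Hi ->]; [exact: H1|exact: H2].
Qed.

Lemma radius_dil t D : 0 <= t -> radius (dil t D) = t * radius D.
Proof.
move=> t0; rewrite /radius -foldr_maxZ // mulr0; apply: perm_foldr_max.
rewrite map_cat; apply: perm_cat.
  rewrite -map_comp (_ : [seq _ | i : 'I_p] = map ((fun x => t * x) \o (fun i => `|D.1 0 i|)) (enum 'I_p)) //.
  by apply: eq_map => i; rewrite /= !mxE addr0 normrM ger0_norm.
apply: perm_trans (perm_map _ (pts_sym_map _ _)) _.
move: (pts D.2) => l; rewrite -!map_comp (_ : map _ _ = [seq ((fun x => t * x) \o @cabs R) z | z <- l]) //.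
by apply: eq_map => z /=; rewrite addr0 cabsM cabs_real ger0_norm.
Qed.

(** The right-hand side is the configuration with all points at the origin, expressed as a dilate of
    [D]. *)
Lemma radius_eq0 D : radius D = 0 -> D = dil 0 D.
Proof.
move=> r0; have [H1 H2] : (forall i, `|D.1 0 i| <= 0) /\ (forall z, z \in pts D.2 -> cabs z <= 0).
  by apply/radius_leP => //; rewrite r0.
have c0 z : z \in pts D.2 -> z = 0.
  by move=> /H2 h; apply: cabs_eq0; apply/eqP; rewrite eq_le h cabs_ge0.
case: D H1 H2 c0 {r0} => y D /= H1 H2 c0; rewrite /dil /aff /= scale0r addr0; congr pair.
  by apply/rowP => i; rewrite mxE; apply/normr0_eq0/eqP; rewrite eq_le H1 normr_ge0.
rewrite -[LHS]sym_map_id; apply: eq_sym_map => z /c0 ->.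
by rewrite mul0r addr0.
Qed.

End AffineMotions.

Section LinearForms.
Variables (R : realType) (p m : nat) (wt : 'I_p -> nat).
Local Notation Cx := (C R).
Local Notation config := (config R p m).
Local Notation n := (p + (m + m))%N.

(** When [wt] lists the multiplicities, this is the sum of all points of [D' + D'' + tau(D'')], and
    [total_weight] is the degree of that divisor. *)
Definition moment (D : config) : R :=
  \sum_i (wt i)%:R * D.1 0 i + \sum_(z <- pts D.2) 2 * complex.Re z.

Definition total_weight : R := (\sum_i wt i)%:R + 2 * m%:R.

Lemma moment_aff (a : R) (v : 'rV[R]_p) (s : Cx) (D : config) :
  moment (aff a v s D) =
  a * moment D + \sum_i (wt i)%:R * v 0 i + 2 * m%:R * complex.Re s.
Proof.
rewrite /moment /aff /= (perm_big _ (pts_sym_map _ _)) /= big_map mulrDr.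
have -> : \sum_i (wt i)%:R * (a *: D.1 + v) 0 i =
          a * (\sum_i (wt i)%:R * D.1 0 i) + \sum_i (wt i)%:R * v 0 i.
  by rewrite mulr_sumr -big_split; apply: eq_bigr => i _; rewrite !mxE /=; ring.
have -> : \sum_(z <- pts D.2) 2 * complex.Re (a%:C%C * z + s) =
          a * (\sum_(z <- pts D.2) 2 * complex.Re z) + 2 * m%:R * complex.Re s.
  rewrite mulr_sumr; have := size_pts D.2; move: (pts D.2) => l <-.
  elim: l => [|z l IH]; first by rewrite !big_nil /= mulr0 mul0r addr0.
  rewrite !big_cons IH /= -natr1; case: z s {IH} => [x y] [x' y'] /=; ring.
ring.
Qed.

Lemma sum_coef (s : seq Cx) : (0 < size s)%N ->
  \sum_(z <- s) z = - (rootpoly s)`_(size s).-1.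
Proof. by move=> s0; rewrite coefPn_prod_XsubC ?opprK // -lt0n. Qed.

(** Selects the index [m - 1], whose coefficient is minus the sum of the roots. As a predicate it
    also makes sense for [m = 0], where sums over it are empty. *)
Definition corner (k : 'I_m) : bool := k.+1 == m.

Lemma sum_corner (D : Sym Cx m) (f : Cx -> R) : (forall x y, f (x + y) = f x + f y) ->
  \sum_(z <- pts D) f z = - \sum_(k | corner k) f (rootpoly (pts D))`_k.
Proof.
move=> fD; have f0 : f 0 = 0 by apply: (addrI (f 0)); rewrite -fD !addr0.
have fN x : f (- x) = - f x by apply: (addrI (f x)); rewrite -fD !subrr.
case: (posnP m) => [m0|mp].
  rewrite [in RHS]big1 ?oppr0 => [|k]; last by have := ltn_ord k; rewrite [X in (_ < X)%N]m0.
  have := size_pts D; rewrite [in RHS]m0; case: (pts D) => // _.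
  by rewrite big_nil.
have lt : (m.-1 < m)%N by rewrite prednK.
rewrite (big_pred1 (Ordinal lt)) => [|k]; last first.
  apply/eqP/eqP => [e|->]; last by rewrite /= prednK.
  by apply: val_inj; exact: (congr1 predn e).
rewrite -fN (_ : - _ = \sum_(z <- pts D) z) ?(big_morph f fD f0) //.
by rewrite sum_coef size_pts.
Qed.

Definition basis_col (j : 'I_n) : 'M[R]_(n, 1) := delta_mx j 0.

Lemma mul_basis_col (x : 'rV[R]_n) j : (x *m basis_col j) 0 0 = x 0 j.
Proof.
rewrite mxE (bigD1 j) //= big1 => [|i ij]; first by rewrite !mxE !eqxx mulr1 addr0.
by rewrite !mxE (negPf ij) mulr0.
Qed.

(** The matrix of [wall_mean] on Viete coordinates, as [moment_form] is that of [moment]. The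
    complex points enter only through the corner coefficient, which accounts for the minus signs. *)
Definition wall_form : 'M[R]_(n, 1) := (nwalls p m)%:R^-1 *:
  (\sum_(ij <- gapidx p) (basis_col (lshift _ ij.2) - basis_col (lshift _ ij.1)) -
   \sum_(k | corner k) basis_col (rshift p (rshift m k))).

Definition moment_form : 'M[R]_(n, 1) :=
  \sum_i (wt i)%:R *: basis_col (lshift _ i) -
  \sum_(k | corner k) 2 *: basis_col (rshift p (lshift m k)).

Lemma mul_wall_form (x : 'rV[R]_n) : (x *m wall_form) 0 0 =
  (\sum_(ij <- gapidx p) (x 0 (lshift _ ij.2) - x 0 (lshift _ ij.1)) -
   \sum_(k | corner k) x 0 (rshift p (rshift m k))) / (nwalls p m)%:R.
Proof.
rewrite /wall_form -scalemxAr mxE mulrC mulmxBr mulmx_sumr mulmx_sumr !mxE !summxE.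
congr ((_ - _) / _); apply: eq_bigr => i _; last exact: mul_basis_col.
by rewrite mulmxBr -!(mul_basis_col x) !mxE.
Qed.

Lemma mul_moment_form (x : 'rV[R]_n) : (x *m moment_form) 0 0 =
  \sum_i (wt i)%:R * x 0 (lshift _ i) -
   \sum_(k | corner k) 2 * x 0 (rshift p (lshift m k)).
Proof.
rewrite /moment_form mulmxBr mulmx_sumr mulmx_sumr !mxE !summxE.
by congr (_ - _); apply: eq_bigr => i _; rewrite -scalemxAr mxE mul_basis_col.
Qed.

Lemma wall_meanE D : wall_mean D = (viete_coord D *m wall_form) 0 0.
Proof.
rewrite mul_wall_form /wall_mean /walls big_cat /= big_map [X in _ + X]big_map; congr ((_ + _) / _).
  by apply: eq_bigr => ij _; rewrite !row_mxEl.
rewrite (sum_corner D.2 (f := complex.Im (R:=R))) => [|[? ?] [? ?]] //; congr (- _).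
by apply: eq_bigr => k _; rewrite !row_mxEr mxE.
Qed.

Lemma momentE D : moment D = (viete_coord D *m moment_form) 0 0.
Proof.
rewrite mul_moment_form /moment; congr (_ + _).
  by apply: eq_bigr => i _; rewrite row_mxEl.
rewrite -mulr_sumr (sum_corner D.2 (f := complex.Re (R:=R))) => [|[? ?] [? ?]] //.
rewrite mulrN mulr_sumr; congr (- _).
by apply: eq_bigr => k _; rewrite row_mxEr row_mxEl mxE.
Qed.

(** The degree of homogeneity in the points minus one, as [wpow] expects: a real point has degree 1
    and the coefficient of index [k] has degree [m - k]. *)
Definition coord_weight (j : 'I_n) : nat :=
  match fintype.split j with
  | inl _ => 0%N
  | inr jj => match fintype.split jj with inl k => (m - k).-1 | inr k => (m - k).-1 end
  end.

Lemma coord_weightl i : coord_weight (lshift _ i) = 0%N.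
Proof. by rewrite /coord_weight (unsplitK (inl i)). Qed.

Lemma coord_weightrl k : coord_weight (rshift p (lshift m k)) = (m - k).-1.
Proof. by rewrite /coord_weight (unsplitK (inr _)) (unsplitK (inl k)). Qed.

Lemma coord_weightrr k : coord_weight (rshift p (rshift m k)) = (m - k).-1.
Proof. by rewrite /coord_weight (unsplitK (inr _)) (unsplitK (inr k)). Qed.

Lemma corner_weight k : corner k -> (m - k).-1 = 0%N.
Proof. by move=> /eqP im; rewrite -[X in (X - _)%N]im subSnn. Qed.

(** The form involves only real points and corner coefficients. These have weight one, where [wroot]
    is the identity. *)
Lemma wroot_wall_form x : (wroot coord_weight x *m wall_form) 0 0 = (x *m wall_form) 0 0.
Proof.
rewrite !mul_wall_form; congr ((_ - _) / _); apply: eq_bigr => i.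
  by move=> _; rewrite !wroot_weight1 // coord_weightl.
by move=> /corner_weight ci; rewrite wroot_weight1 // coord_weightrr.
Qed.

Lemma wroot_moment_form x :
  (wroot coord_weight x *m moment_form) 0 0 = (x *m moment_form) 0 0.
Proof.
rewrite !mul_moment_form; congr (_ - _); apply: eq_bigr => i.
  by move=> _; rewrite !wroot_weight1 // coord_weightl.
by move=> /corner_weight ci; rewrite wroot_weight1 // coord_weightrl.
Qed.

Lemma rootpoly_scale (t : Cx) (s : seq Cx) k : (k <= size s)%N ->
  (rootpoly [seq t * z | z <- s])`_k = t ^+ (size s - k) * (rootpoly s)`_k.
Proof.
elim: s k => [|z s IH] k /=.
  by rewrite leqn0 => /eqP ->; rewrite /rootpoly !big_nil mul1r.
move=> ks; rewrite !rootpoly_cons !mulrBl !coefB !coefXM !coefCM.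
have top : (size s < k)%N -> (rootpoly [seq t * z | z <- s])`_k = 0 /\ (rootpoly s)`_k = 0.
  by move=> h; rewrite !nth_default // ?size_rootpoly ?size_map.
have [ks'|/top [-> ->]] := leqP k (size s).
  rewrite (IH k) // subSn // exprS; case: k ks ks' {top} => [|k] ks ks' /=.
    by rewrite !sub0r; ring.
  have e : (size s - k = (size s - k.+1).+1)%N by rewrite -subSn // subSS.
  by rewrite (IH k) ?(ltnW ks') // e exprS; ring.
rewrite !mulr0 !subr0; case: k ks {top} => [|k] ks /=; first by rewrite mulr0.
by rewrite (IH k) // subSS.
Qed.

Lemma viete_coord_dil (t : R) (D : config) :
  viete_coord (dil t D) = \row_j (t ^+ (coord_weight j).+1 * viete_coord D 0 j).
Proof.
have C k : (k < m)%N -> (rootpoly (pts (dil t D).2))`_k =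
    ((t ^+ (m - k))%:C%C : Cx) * (rootpoly (pts D.2))`_k.
  move=> km; rewrite (perm_rootpoly (pts_sym_map _ _)).
  rewrite (eq_map (g := fun z => (t%:C%C : Cx) * z)) => [|z]; last by rewrite addr0.
  rewrite rootpoly_scale size_pts ?(ltnW km) //; congr (_ * _).
  by rewrite -[RHS]/(real_complex R _) rmorphXn.
have W k : (k < m)%N -> ((m - k).-1.+1 = m - k)%N by move=> km; rewrite prednK // subn_gt0.
apply/rowP => j; rewrite [RHS]mxE; case: (split_ordP j) => i ->.
  by rewrite coord_weightl expr1 !row_mxEl /= !mxE addr0.
case: (split_ordP i) => k ->.
  rewrite coord_weightrl W // row_mxEr row_mxEl mxE C // row_mxEr row_mxEl mxE.
  by move: (rootpoly _)`_k => [a b] /=; rewrite mul0r subr0.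
rewrite coord_weightrr W // !row_mxEr !mxE C //.
by move: (rootpoly _)`_k => [a b] /=; rewrite mul0r addr0.
Qed.

(* Raising the walls at unit speed without moving the centre of mass. *)
Definition lift_dir : 'rV[R]_p :=
  \row_i (i%:R - (\sum_j (wt j)%:R * j%:R) / \sum_j (wt j)%:R).

Definition raise (s : R) (D : config) : config := aff 1 (s *: lift_dir) (0 +i* s)%C D.

Hypothesis wt_gt0 : forall i, (0 < wt i)%N.
Hypothesis nw_gt0 : (0 < nwalls p m)%N.

Lemma lift_dir_gap ij : ij \in gapidx p -> lift_dir 0 ij.2 - lift_dir 0 ij.1 = 1.
Proof.
rewrite mem_filter => /andP [/eqP e _]; rewrite !mxE.
have -> : (ij.2 : nat)%:R = (ij.1 : nat)%:R + 1 :> R by rewrite (e : (ij.2 : nat) = _) -natr1.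
ring.
Qed.

Lemma lift_dir_gapZ (s : R) ij : ij \in gapidx p -> (s *: lift_dir) 0 ij.2 - (s *: lift_dir) 0 ij.1 = s.
Proof. have e i : (s *: lift_dir) 0 i = s * lift_dir 0 i by rewrite mxE.
by move=> /lift_dir_gap h; rewrite !e -mulrBr h mulr1. Qed.

Lemma slack_raise (s : R) (D : config) : slack (raise s D) = slack D + s.
Proof. by rewrite (slack_aff _ nw_gt0 _ (@lift_dir_gapZ s)) ?mul1r. Qed.

Lemma wall_mean_raise (s : R) (D : config) : wall_mean (raise s D) = wall_mean D + s.
Proof. by rewrite (wall_mean_aff _ _ nw_gt0 (@lift_dir_gapZ s)) ?mul1r. Qed.

(** Complex points move vertically, and [lift_dir] is the index minus its weighted mean, so its
    weighted sum vanishes. *)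
Lemma moment_raise (s : R) (D : config) : moment (raise s D) = moment D.
Proof.
rewrite moment_aff mul1r /= mulr0 addr0.
suff -> : \sum_i (wt i)%:R * (s *: lift_dir) 0 i = 0 by rewrite addr0.
have E (K : R) : \sum_i (wt i)%:R * (s *: \row_(i < p) (i%:R - K)) 0 i =
   s * (\sum_i (wt i)%:R * i%:R - (\sum_i (wt i)%:R) * K).
  rewrite mulr_suml -sumrB mulr_sumr; apply: eq_bigr => i _; rewrite !mxE; ring.
rewrite E {E}.
(* Multiplicities are positive, so the weighted mean divides by zero only when there are no real
   points, and then the sum is empty. *)
have [w0|w0] := eqVneq (\sum_j (wt j)%:R) (0 : R); last by rewrite mulrC mulrCA; field.
rewrite w0 mul0r subr0; suff -> : \sum_i (wt i)%:R * i%:R = 0 :> R by rewrite mulr0.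
apply: big1 => i _; have : \sum_j (wt j)%:R != 0 :> R.
  rewrite gt_eqF // (bigD1 i) //= ltr_pwDl ?ltr0n //.
  by apply: sumr_ge0.
by rewrite w0 eqxx.
Qed.

Lemma raise0 D : raise 0 D = D.
Proof. by rewrite /raise scale0r; exact: aff_id. Qed.

Lemma raiseD (s t : R) (D : config) : raise s (raise t D) = raise (s + t) D.
Proof.
rewrite /raise aff_comp mulr1 scale1r -scalerDl addrC; congr aff; last by rewrite mul1r; apply/eqP; rewrite eq_complex /= addr0 addrC !eqxx.
Qed.

Lemma dil_raise (s t : R) (D : config) : dil t (raise s D) = raise (t * s) (dil t D).
Proof.
rewrite /dil /raise !aff_comp mulr1 mul1r !addr0 scaler0 add0r scalerA mulr0 add0r.
by congr aff; apply/eqP; rewrite eq_complex /= !mul0r mulr0 subr0 addr0 !eqxx.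
Qed.

Lemma cts_raise (X : topologicalType) (s : X -> R) (D : X -> config) x :
  cts_at s x -> cts_at D x -> cts_at (fun y => raise (s y) (D y)) x.
Proof.
move=> cs cD.
exact: (cts_aff (cts_cst (1 : R) x) (ctsZ cs (cts_cst lift_dir x)) (cts_complex (cts_cst (0 : R) x) cs) cD).
Qed.

(* Trades the piecewise linear slack for the linear mean of the walls. *)
Definition straighten (D : config) : config := raise (slack D - wall_mean D) D.
Definition unstraighten (D : config) : config := raise (wall_mean D - slack D) D.

(** Raising shifts slack and mean alike. Their difference is therefore unchanged by [straighten],
    and the amount of raising can be read off afterwards and undone. *)
Lemma straightenK : cancel straighten unstraighten.
Proof.
move=> D; rewrite /straighten /unstraighten slack_raise wall_mean_raise raiseD.
by rewrite -[RHS]raise0; congr raise; ring.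
Qed.

Lemma unstraightenK : cancel unstraighten straighten.
Proof.
move=> D; rewrite /straighten /unstraighten slack_raise wall_mean_raise raiseD.
by rewrite -[RHS]raise0; congr raise; ring.
Qed.

Lemma slack_dil (t : R) (D : config) : 0 <= t -> slack (dil t D) = t * slack D.
Proof.
by move=> t0; rewrite (slack_aff (c := 0) _ nw_gt0 t0) ?addr0 // => ij _; rewrite !mxE subr0.
Qed.

Lemma wall_mean_dil (t : R) (D : config) : wall_mean (dil t D) = t * wall_mean D.
Proof.
by rewrite (wall_mean_aff (c := 0) _ _ nw_gt0) ?addr0 // => ij _; rewrite !mxE subr0.
Qed.

Lemma straighten_dil (t : R) (D : config) : 0 <= t -> straighten (dil t D) = dil t (straighten D).
Proof.
by move=> t0; rewrite /straighten slack_dil // wall_mean_dil dil_raise -mulrBr.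
Qed.

Hypothesis tw_gt0 : 0 < total_weight.

(* Coordinates in which the closed cell is a half-space and dilations act linearly;
   [swap] exchanges the first two coordinates. *)
Lemma config_chart k (swap : bool) : n = k.+2 ->
  exists (h : config -> 'rV[R]_k.+2) (g : 'rV[R]_k.+2 -> config),
  [/\ cancel h g, cancel g h, continuous h, continuous g &
   forall D, [/\ h D 0 0 = (if swap then moment D else slack D),
     h D 0 (lift ord0 0) = (if swap then slack D else moment D) &
     forall t, 0 <= t -> h (dil t D) = t *: h D]].
Proof.
move=> nk.
pose O : config := (0, to_sym 0).
have O0 : O = dil 0 O.
  rewrite /dil /aff /= scale0r addr0; congr pair; rewrite sym_map_to_sym.
  by apply: (congr1 (@to_sym Cx m)); apply/rowP => i; rewrite !mxE mul0r addr0.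
have wO : wall_mean O = 0 by rewrite O0 wall_mean_dil mul0r.
have mO : moment O = 0.
  by rewrite O0 moment_aff mul0r mulr0 addr0 add0r; apply: big1 => i _; rewrite mxE mulr0.
(* Two test configurations show that the forms are independent: raising the origin by 1 gives mean 1
   and moment 0, translating it by [c] gives mean 0 and moment 1. *)
pose c := total_weight^-1.
pose O' : config := aff 1 (const_mx c) (c%:C%C : Cx) O.
have wO' : wall_mean O' = 0.
  by rewrite (wall_mean_aff (c := 0) _ _ nw_gt0) ?wO ?mulr0 ?addr0 // => ij _; rewrite !mxE subrr.
have mO' : moment O' = 1.
  rewrite moment_aff mO mulr0 add0r /=.
  under eq_bigr do rewrite mxE.
  rewrite -mulr_suml -natr_sum -mulrDl mulfV // gt_eqF //.
pose u := viete_coord (raise 1 O); pose v := viete_coord O'.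
have [uw um] : (u *m wall_form) 0 0 = 1 /\ (u *m moment_form) 0 0 = 0.
  by rewrite -wall_meanE -momentE wall_mean_raise moment_raise wO mO add0r.
have [vw vm] : (v *m wall_form) 0 0 = 0 /\ (v *m moment_form) 0 0 = 1.
  by rewrite -wall_meanE -momentE.
pose F1 := if swap then moment_form else wall_form.
pose F2 := if swap then wall_form else moment_form.
pose B : 'M[R]_(n, 1 + 1) := row_mx F1 F2.
pose E : 'M[R]_(1 + 1, n) := if swap then col_mx v u else col_mx u v.
have m11 (x y : 'M[R]_1) : x 0 0 = y 0 0 -> x = y.
  by move=> xy; apply/matrixP => i j; rewrite !ord1.
have EB : E *m B = 1%:M.
  rewrite /E /B /F1 /F2 -[1%:M](@submxK _ 1 1 1 1); case: swap {F1 F2 B E};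
  rewrite mul_col_row; congr block_mx; apply: m11; rewrite ?uw ?um ?vw ?vm !mxE //=.
have [A [A' [AA' A'A HA]]] := extend_to_basis nk EB.
have [vi [viK Kvi vic]] := viete_coord_homeo R p m.
pose h D := wroot coord_weight (viete_coord (straighten D)) *m A.
pose g x := unstraighten (vi (wpow coord_weight (x *m A'))).
exists h, g; split.
- by move=> D; rewrite /h /g -mulmxA AA' mulmx1 wrootK viK straightenK.
- by move=> x; rewrite /h /g unstraightenK Kvi wpowK -mulmxA A'A mulmx1.
- apply: cts_all => D; apply: cts_mulmx.
  have cs : cts_at straighten D.
    apply: cts_raise (cts_id _); apply: ctsB; [exact: cts_slack|exact: cts_wall_mean].
  have cv := cts_comp cs (cts_each _ (@viete_coord_continuous R p m)).
  exact: cts_comp cv (cts_each _ (@wroot_continuous R n coord_weight)).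
- apply: cts_all => x.
  have c1 := cts_mulmx A' (cts_id x).
  have c2 := cts_comp c1 (cts_each _ (@wpow_continuous R n coord_weight)).
  have c3 := cts_comp c2 (cts_each _ vic).
  apply: (cts_comp c3 (g := unstraighten)).
  apply: cts_raise (cts_id _); apply: ctsB; [exact: cts_wall_mean|exact: cts_slack].
- move=> D; have [H1 H2] := HA (wroot coord_weight (viete_coord (straighten D))).
  (* The mean after straightening is the slack before it, so the linear form reads off the slack. *)
  have W : wall_mean (straighten D) = slack D by rewrite wall_mean_raise; ring.
  have M : moment (straighten D) = moment D by rewrite moment_raise.
  have B1 (x : 'rV[R]_n) : (x *m B) 0 0 = (x *m F1) 0 0 /\ (x *m B) 0 1 = (x *m F2) 0 0.
    rewrite /B mul_mx_row; split.
      by rewrite -[RHS](row_mxEl _ (x *m F2)); congr (_ _ _); exact: val_inj.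
    by rewrite -[RHS](row_mxEr (x *m F1)); congr (_ _ _); exact: val_inj.
  rewrite H1 H2 !(B1 _).1 !(B1 _).2; split; last first.
    by move=> t t0; rewrite /h straighten_dil // viete_coord_dil wrootZ // -scalemxAl.
  all: rewrite /F1 /F2; case: swap {F1 F2 B E EB HA H1 H2 B1}.
  all: by rewrite ?wroot_wall_form ?wroot_moment_form -?wall_meanE -?momentE.
Qed.

End LinearForms.

(** * Closed cells, their links and cones *)

Section StandardCells.
Variables (R : realType) (p m : nat).
Local Notation Cx := (C R).
Local Notation config := (config R p m).

Definition scell : set config := [set D | all (>= 0) (walls D)].
Definition scello : set config := [set D | all (> 0) (walls D)].
Definition slink : set config := scell `&` [set D | radius D = 1].

Lemma scell_slack D : scell D <-> 0 <= slack D.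
Proof. by rewrite slack_ge0. Qed.

Lemma scello_slack D : (0 < nwalls p m)%N -> scello D <-> 0 < slack D.
Proof. by move=> n0; rewrite slack_gt0. Qed.

Lemma scello_sub : scello `<=` scell.
Proof. by move=> D /allP H; apply/allP => x /H /ltW. Qed.

Lemma closed_scell : closed scell.
Proof.
rewrite (_ : scell = @slack R p m @^-1` [set x | 0 <= x]).
  apply: preimage_closed; last exact: closed_ge.
  by move=> D _; case: (@cts_slack R p m D).
by apply/seteqP; split => D /scell_slack.
Qed.

Lemma closed_radius1 : closed [set D : config | radius D = 1].
Proof.
rewrite (_ : [set D | _] = @radius R p m @^-1` [set 1]) //.
apply: preimage_closed; last exact: closed_eq.
by move=> D _; case: (@cts_radius R p m D).
Qed.

Lemma compact_radius (M : R) : exists2 K : set config, compact K &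
  forall D, radius D <= M -> K D.
Proof.
have [K cK HK] := compact_config p m M; exists K => // D H.
have M0 : 0 <= M by apply: le_trans H; exact: radius_ge0.
by have [H1 H2] := (radius_leP D M0).1 H; exact: HK.
Qed.

Lemma walls_dil (t : R) (D : config) : perm_eq (walls (dil t D)) [seq t * x | x <- walls D].
Proof.
apply: perm_trans (perm_walls_aff (c := 0) t D _ _) _ => //.
  by move=> ij _; rewrite !mxE subr0.
by rewrite (eq_map (g := fun x => t * x)) // => x; rewrite addr0.
Qed.

Lemma scell_dil (t : R) D : 0 <= t -> scell D -> scell (dil t D).
Proof.
move=> t0; rewrite /scell /= (perm_all _ (walls_dil t D)) => /allP H.
by apply/allP => _ /mapP [x /H x0 ->]; exact: mulr_ge0.
Qed.

Lemma scell_dil0 D : scell (dil 0 D).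
Proof.
rewrite /scell /= (perm_all _ (walls_dil 0 D)).
by apply/allP => _ /mapP [x _ ->]; rewrite mul0r.
Qed.

Lemma scello_dil (t : R) D : 0 < t -> scello D -> scello (dil t D).
Proof.
move=> t0; rewrite /scello /= (perm_all _ (walls_dil t D)) => /allP H.
by apply/allP => _ /mapP [x /H x0 ->]; exact: mulr_gt0.
Qed.

Lemma cts_dil (X : topologicalType) (t : X -> R) (D : X -> config) x :
  cts_at t x -> cts_at D x -> cts_at (fun y => dil (t y) (D y)) x.
Proof.
move=> ct cD.
exact: (cts_aff ct (cts_cst (0 : 'rV[R]_p) x) (cts_cst (0 : Cx) x) cD).
Qed.

Lemma dil_inj (t : R) : 0 < t -> injective (@dil R p m t).
Proof.
move=> t0 D D' /(congr1 (dil t^-1)); rewrite !dilA mulVf ?gt_eqF //.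
by rewrite !dil1.
Qed.

Lemma dil0 (D D' : config) : dil 0 D = dil 0 D'.
Proof.
rewrite /dil /aff !scale0r; congr pair.
have [z -> _] := pts_repr D.2; have [z' -> _] := pts_repr D'.2.
rewrite !sym_map_to_sym; apply: (congr1 (@to_sym Cx m)).
by apply/rowP => i; rewrite !mxE !mul0r.
Qed.

Variables (S S' : config -> config).
Hypotheses (SK : cancel S S') (S'K : cancel S' S)
  (Sc : continuous S) (S'c : continuous S').

(** The homeomorphism [S] moves the centre of the dilations to the origin: the identity for the
    cell, the translation by [alpha] for the balanced cell. On the image of a link point [radius]
    after [S] equals the cone parameter, which is the bound that [cone_mapI] asks for. *)
Lemma cone_scell (X : set config) (o : config) : closed X -> X (S' o) -> (forall D, dil 0 D = o) ->
  (forall t D, 0 <= t -> X (S' D) -> X (S' (dil t D))) ->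
  is_positive_cone R X (X `&` [set D | radius (S D) = 1]).
Proof.
move=> cX Xo oP XS; exists (S' o), (fun u => S' (dil u.1 (S u.2))).
have r0 : radius o = 0 by rewrite -(oP o) radius_dil // mul0r.
apply: (@cone_mapI _ _ _ _ _ _ _ (fun D => radius (S D))) => //.
- exact: config_hausdorff.
- exact: config_hausdorff.
- have [K cK HK] := compact_radius 1.
  apply: (@subclosed_compact _ _ (S' @` K)).
  + apply: closedI => //.
    apply: (@preimage_closed _ _ S [set D | radius D = 1]); last exact: closed_radius1.
    by move=> D _; exact: Sc.
  + by apply: continuous_compact => //; exact: continuous_subspaceT.
  + by move=> D [_ /= rD]; exists (S D); rewrite ?SK //; apply: HK; rewrite rD.
- apply: cts_all => D; exact: cts_comp (cts_each D Sc) (cts_radius _).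
- apply: cts_within => -[t D] _.
  apply: (cts_comp (g := S')); last exact: cts_each.
  apply: cts_dil; first exact: (cts_fst (cts_id _)).
  by apply: (cts_comp (cts_snd (cts_id _))); exact: cts_each.
- move=> t D t0 [XD /= rD]; rewrite S'K radius_dil // rD mulr1; split => //.
  by apply: XS; rewrite ?SK.
- by move=> D _; rewrite /= oP.
- move=> t D t0 [XD /= rD] /(congr1 S); rewrite !S'K => /(congr1 (@radius R p m)) /eqP.
  by rewrite radius_dil ?ltW // rD r0 mulr1 gt_eqF.
- move=> t D t' D' t0 [XD /= rD] t0' [XD' /= rD'] /= /(can_inj S'K) e.
  have := congr1 (@radius R p m) e; rewrite !radius_dil ?ltW // rD rD' !mulr1 => tt.
  by move: e; rewrite tt => /(dil_inj t0') /(can_inj SK) ->.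
- move=> D XD Do; have rS : 0 < radius (S D).
    rewrite lt_neqAle radius_ge0 andbT eq_sym; apply/eqP => /radius_eq0 e.
    by apply: Do; rewrite -[LHS]SK e oP.
  exists (radius (S D)), (S' (dil (radius (S D))^-1 (S D))); split => //.
    split; first by apply: XS; rewrite ?invr_ge0 ?ltW // SK.
    by rewrite /= S'K radius_dil ?invr_ge0 ?ltW // mulVf // gt_eqF.
  by rewrite /= S'K dilA mulfV ?gt_eqF // dil1 SK.
Qed.

End StandardCells.

Section Charted.
Variables (R : realType) (p m : nat) (wt : 'I_p -> nat) (k : nat).
Local Notation config := (config R p m).
Hypothesis wt_gt0 : forall i, (0 < wt i)%N.
Hypothesis nw_gt0 : (0 < nwalls p m)%N.
Hypothesis nk : (p + (m + m))%N = k.+2.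

Let tw_gt0 : 0 < total_weight R m wt.
Proof.
rewrite /total_weight; have [m0|m0] := posnP m; last first.
  by rewrite ltr_wpDl ?ler0n // mulr_gt0 // ltr0n.
rewrite m0 mulr0 addr0 ltr0n; case: p wt wt_gt0 nk => [|q] v v0 e; first by move: e; rewrite m0.
by rewrite big_ord_recl addn_gt0 v0.
Qed.

Lemma gauge_of_chart q (h : config -> 'rV[R]_q) (g : 'rV[R]_q -> config) :
  cancel h g -> cancel g h -> continuous g ->
  (forall D t, 0 <= t -> h (dil t D) = t *: h D) ->
  [/\ continuous (fun x => radius (g x)),
      (forall t x, 0 <= t -> radius (g (t *: x)) = t * radius (g x)),
      (forall x, 0 <= radius (g x)) & (forall x, radius (g x) = 0 -> x = 0)].
Proof.
move=> hK gK gc hZ; split.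
- apply: cts_all => x; exact: cts_comp (cts_each x gc) (cts_radius _).
- move=> t x t0; rewrite -radius_dil //; congr radius.
  by apply: (can_inj hK); rewrite gK hZ // gK.
- by move=> x; exact: radius_ge0.
- move=> x /radius_eq0 e; rewrite -[x]gK e hZ // scale0r //.
Qed.

Lemma scell_hball : pair_homeomorphic (@scell R p m) (@scello R p m) (@hball R k.+2) (@oball R k.+2).
Proof.
have [h [g [hK gK hc gc hP]]] := config_chart wt_gt0 nw_gt0 tw_gt0 false nk.
have [f [fh fo]] := half_space_hball R k.+1.
apply: (@pair_homeomorphic_trans _ _ _ _ _ (@half_space R k.+1) (@open_half_space R k.+1)).
  apply: (@pair_homeomorphicI _ _ _ _ _ _ h).
  - apply: homeo_on_sub hK gK hc gc _ => D; rewrite scell_slack.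
    by have [<- _ _] := hP D.
  - exact: scello_sub.
  - by move=> x; exact: ltW.
  - by move=> D _; rewrite scello_slack //; have [<- _ _] := hP D.
apply: pair_homeomorphicI fh _ _ fo => x; first exact: ltW.
by left.
Qed.

Lemma slink_cball : exists f : config -> 'rV[R]_k.+1,
  homeo_on (@slink R p m) (@cball R k.+1) f /\
  forall D, slink D -> scello D <-> oball (f D).
Proof.
have [h [g [hK gK hc gc hP]]] := config_chart wt_gt0 nw_gt0 tw_gt0 false nk.
have hZ D t : 0 <= t -> h (dil t D) = t *: h D by have [_ _] := hP D; exact.
have [N1 N2 N3 N4] := gauge_of_chart hK gK gc hZ.
have [f [fh fo]] := gauge_half_sphere N1 N2 N3 N4.
have e D : slink D <-> (@half_space R k.+1 `&` [set x | radius (g x) = 1]) (h D).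
  rewrite /slink /setI /= hK /half_space /=; have [-> _ _] := hP D.
  by rewrite -scell_slack.
exists (f \o h); split.
  apply: homeo_on_comp fh; exact: homeo_on_sub hK gK hc gc e.
move=> D /e [H1 H2]; rewrite -fo // scello_slack // /open_half_space /=.
by have [-> _ _] := hP D.
Qed.

(** In the swapped chart the moment is the first coordinate. Dropping it leaves a space one
    dimension lower whose first coordinate is the slack, so the half-space argument applies
    again. *)
Lemma slink_moment0_cball : homeomorphic (@slink R p m `&` [set D | moment wt D = 0]) (@cball R k).
Proof.
have [h [g [hK gK hc gc hP]]] := config_chart wt_gt0 nw_gt0 tw_gt0 true nk.
have hZ D t : 0 <= t -> h (dil t D) = t *: h D by have [_ _] := hP D; exact.
have [N1 N2 N3 N4] := gauge_of_chart hK gK gc hZ.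
pose N (x : 'rV[R]_k.+1) := radius (g (rcons0 0 x)).
have ZR t (x : 'rV[R]_k.+1) : rcons0 0 (t *: x) = t *: rcons0 0 x.
  by apply: rcons0_inj; rewrite ?rtailZ ?rtail_cons // rcons00 [RHS]mxE rcons00 mulr0.
have [f [fh fo]] : exists f : 'rV[R]_k.+1 -> 'rV[R]_k,
   homeo_on (@half_space R k `&` [set x | N x = 1]) (@cball R k) f /\
   forall x, half_space x -> N x = 1 -> open_half_space x <-> oball (f x).
  apply: gauge_half_sphere => //.
  - apply: cts_all => x.
    exact: cts_comp (cts_rcons0 (cts_cst (0 : R) x) (cts_id x)) (cts_each _ N1).
  - by move=> t x t0; rewrite /N ZR N2.
  - by move=> x; exact: N3.
  - move=> x /N4 /(congr1 (@rtail R _)); rewrite rtail_cons => ->.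
    by apply/rowP => i; rewrite !mxE.
apply: (@homeomorphic_trans _ _ _ _ (@half_space R k `&` [set x | N x = 1])); last by exists f.
exists (fun D => rtail (h D)).
have tl (x : 'rV[R]_k.+2) : rtail x 0 0 = x 0 (lift ord0 0) by rewrite mxE.
have re (D : config) : moment wt D = 0 -> rcons0 0 (rtail (h D)) = h D.
  by move=> m0; apply: rcons0_inj; rewrite ?rtail_cons // rcons00; have [-> _ _] := hP D.
apply: (homeo_onI (g := fun x => g (rcons0 0 x))).
- move=> D [[sD rD] mD]; rewrite /N /setI /= re // hK; split => //.
  by rewrite /half_space /= tl; have [_ -> _] := hP D; apply/scell_slack.
- move=> x [x0 Nx]; have [e1 e2 _] := hP (g (rcons0 0 x)).
  split; last by rewrite /= -e1 gK rcons00.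
  split=> //; apply/scell_slack; rewrite -e2 gK -tl rtail_cons; exact: x0.
- by move=> D [_ mD]; rewrite re.
- by move=> x _; rewrite gK rtail_cons.
- by apply: cts_within => D _; apply: cts_rtail; exact: cts_each.
- apply: cts_within => x _.
  exact: cts_comp (cts_rcons0 (cts_cst (0 : R) x) (cts_id x)) (cts_each _ gc).
Qed.

End Charted.

(** * The exceptional type: a single real point *)

Section SinglePoint.
Variables (R : realType) (p m : nat).
Hypotheses (p1 : p = 1%N) (m0 : m = 0%N).
Local Notation config := (config R p m).

Lemma walls_single (D : config) : walls D = [::].
Proof.
move: D; rewrite p1 m0 => D.
have : size (walls D) = 0%N.
  rewrite size_walls /nwalls addn0 /gapidx; apply/eqP; rewrite size_eq0 -[_ == _]negbK -has_filter.
  by apply/hasPn => -[i j] _ /=; rewrite !ord1.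
by case: (walls D).
Qed.

Lemma scell_single : @scell R p m = [set: config] /\ @scello R p m = [set: config].
Proof. by split; apply/seteqP; split => // D _; rewrite /scell /scello /= walls_single. Qed.

Lemma chart_single : exists (h : config -> 'rV[R]_1) (g : 'rV[R]_1 -> config),
  [/\ cancel h g, cancel g h, continuous h, continuous g &
   forall D t, h (dil t D) = t *: h D].
Proof.
move: p1 m0 => -> ->.
have [g [hK gK gc]] := viete_coord_homeo R 1 0.
exists (@viete_coord R 1 0), g; split => //; first exact: viete_coord_continuous.
move=> D t; rewrite viete_coord_dil; apply/rowP => j; rewrite !mxE.
by rewrite /coord_weight; case: (fintype.split (j : 'I_(1 + (0 + 0)))) => [i|[]//]; rewrite expr1.
Qed.

Lemma scell_oball_single :
  pair_homeomorphic (@scell R p m) (@scello R p m) (@oball R 1) (@oball R 1).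
Proof.
have [e1 e2] := scell_single; rewrite e1 e2.
have [h [g [hK gK hc gc _]]] := chart_single.
have [f fh] := rV_oball R 1.
have hf : homeo_on [set: config] (@oball R 1) (f \o h).
  by apply: homeo_on_comp fh; exact: homeo_on_sub hK gK hc gc _.
have H D : oball (f (h D)) by case: hf => -[H _ _] _ _; exact: (H D I).
by apply: pair_homeomorphicI hf _ _ _ => // D _; split => // _; exact: H.
Qed.

(** Without walls nothing cuts the unit sphere of the gauge in half, so in dimension one both of its
    points remain. *)
Lemma slink_sphere_single : homeomorphic (@slink R p m) (@sphere R 1 1).
Proof.
have [h [g [hK gK hc gc hZ]]] := chart_single.
have [N1 N2 N3 N4] := gauge_of_chart hK gK gc (fun D t _ => hZ D t).
have [f [fh _]] := gauge_sphere (H := setT) N1 N2 N3 N4 (fun _ _ _ _ => I).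
exists (f \o h); rewrite setTI in fh.
have [e1 e2] := scell_single; rewrite /slink e1 setTI.
have H : homeo_on [set D : config | radius D = 1] ([set: 'rV[R]_1] `&` [set x | radius (g x) = 1]) h.
  by apply: (homeo_on_sub hK gK hc gc) => D; rewrite setTI /= hK.
rewrite setTI in H; rewrite setTI in fh; exact: homeo_on_comp H fh.
Qed.

(** A vanishing moment puts the only point at the origin, where the radius is 0 and not 1. *)
Lemma slink_moment0_single (wt : 'I_p -> nat) : (forall i, 0 < wt i)%N ->
  @slink R p m `&` [set D | moment wt D = 0] = set0.
Proof.
move=> wt0; apply/seteqP; split => // D [[_ /= rD] mD]; move: wt wt0 D rD mD.
rewrite p1 m0 => wt wt0 D rD; rewrite /moment.
have pn : pts D.2 = [::] by have := size_pts D.2; case: (pts _).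
rewrite pn big_nil addr0 big_ord_recl big_ord0 addr0 => /eqP.
rewrite mulf_eq0 pnatr_eq0 -leqn0 leqNgt wt0 /= => /eqP y0.
have : radius D <= 0.
  apply/radius_leP => //; split=> [i|z]; first by rewrite ord1 y0 normr0.
  by rewrite pn.
by rewrite rD ler10.
Qed.

End SinglePoint.

Lemma size_le_sumn (w : seq nat) : Omega w -> (size w <= sumn w)%N.
Proof.
rewrite /Omega /=; elim: w => //= a w IH; rewrite in_cons negb_or => /andP [a0 /IH].
lia.
Qed.

Lemma rnorm_sumn (w : seq nat) : Omega w -> rnorm w = (sumn w - size w)%N.
Proof.
rewrite /rnorm; elim: w => //= a w IH; rewrite /Omega /= in_cons negb_or => /andP [a0 Hw].
by rewrite (IH Hw); have := size_le_sumn Hw; lia.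
Qed.

Section TypeArithmetic.
Variables (d : nat) (w : seq nat).
Hypothesis hw : Omega_le d w.

Definition npairs : nat := (d - sumn w)./2.

Lemma sumn_npairs : (sumn w + npairs.*2 = d)%N.
Proof.
case: hw => _ le od; rewrite /npairs.
have /even_halfK -> : ~~ odd (d - sumn w) by rewrite oddB // od addbb.
by rewrite subnKC.
Qed.

Lemma dimE : (d - rnorm w = size w + (npairs + npairs))%N.
Proof.
have [Ow _ _] := hw; rewrite rnorm_sumn // -{1}sumn_npairs -addnn.
by have := size_le_sumn Ow; lia.
Qed.

Lemma wt_gt0 (i : 'I_(size w)) : (0 < nth 0%N w i)%N.
Proof.
case: hw => Ow _ _; rewrite lt0n; apply: contraNneq Ow => <-.
exact: mem_nth.
Qed.

Lemma single_type : w = [:: d] -> size w = 1%N /\ npairs = 0%N.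
Proof. by rewrite /npairs => ->; rewrite /= addn0 subnn. Qed.

(** A conjugate pair contributes a wall. Without pairs the real points carry the whole degree, so
    once [[:: d]] is excluded there are at least two of them and hence a gap. *)
Lemma nwalls_gt0 : (0 < d)%N -> w <> [:: d] -> (0 < nwalls (size w) npairs)%N.
Proof.
move=> d0 wd; rewrite /nwalls addn_gt0; case: (posnP npairs) => m0; last by rewrite orbT.
have e := sumn_npairs; rewrite m0 addn0 in e; rewrite orbF.
have p2 : (1 < size w)%N.
  case: (w) wd e => [|a [|b l]] //= wd; first by move=> e; rewrite -e in d0.
  by rewrite addn0 => e; case: wd; rewrite e.
have p0 : (0 < size w)%N by exact: ltnW.
rewrite -has_predT; apply/hasP; exists (Ordinal p0, Ordinal p2) => //.
by rewrite mem_filter /= mem_enum inE.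
Qed.

Lemma dim_ge2 : (0 < d)%N -> w <> [:: d] -> exists k, (size w + (npairs + npairs) = k.+2)%N.
Proof.
move=> d0 wd; exists (size w + (npairs + npairs) - 2)%N.
have := nwalls_gt0 d0 wd; have e := sumn_npairs.
case: (posnP npairs) => m0; last lia.
rewrite m0 addn0 in e.
case: (w) wd e => [|a [|b l]] //= wd; first by move=> e; rewrite -e in d0.
  by rewrite addn0 => e; case: wd; rewrite e.
by move=> _ _; lia.
Qed.

End TypeArithmetic.

(** * Cells of a given combinatorial type *)

Section CellsOfDefs.
Variables (R : realType) (d : nat) (w : seq nat).
Hypothesis hw : Omega_le d w.
Local Notation Cx := (C R).
Local Notation m := (npairs d w).
Local Notation wt := (fun i : 'I_(size w) => nth 0%N w i).
Local Notation cfg := (config R (size w) m).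

Lemma gaps_mono (D : cfg) :
  (forall ij, ij \in gapidx (size w) -> 0 <= D.1 0 ij.2 - D.1 0 ij.1) ->
  forall i j : 'I_(size w), (i <= j)%N -> D.1 0 i <= D.1 0 j.
Proof.
move=> H i j; move: {-2}(val j - val i)%N (erefl (val j - val i)%N) => n.
elim: n j => [|n IH] j e ij; rewrite /= in e.
  have -> // : i = j by apply: val_inj => /=; apply/eqP; rewrite eqn_leq ij /= -subn_eq0 e.
have lt : (j.-1 < size w)%N by apply: leq_ltn_trans (leq_pred _) (ltn_ord j).
have h1 : (n = Ordinal lt - i)%N by rewrite /=; lia.
have h2 : (i <= Ordinal lt)%N by rewrite /=; lia.
apply: le_trans (IH (Ordinal lt) h1 h2) _.
rewrite -subr_ge0; apply: (H (Ordinal lt, j)).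
by rewrite mem_filter mem_enum inE andbT /=; apply/eqP; lia.
Qed.

Lemma gaps_smono (D : cfg) :
  (forall ij, ij \in gapidx (size w) -> 0 < D.1 0 ij.2 - D.1 0 ij.1) ->
  forall i j : 'I_(size w), (i < j)%N -> D.1 0 i < D.1 0 j.
Proof.
move=> H i j ij.
have lt : (j.-1 < size w)%N by apply: leq_ltn_trans (leq_pred _) (ltn_ord j).
have H' : forall ij, ij \in gapidx (size w) -> 0 <= D.1 0 ij.2 - D.1 0 ij.1 by move=> ? /H /ltW.
have h : D.1 0 i <= D.1 0 (Ordinal lt) by apply: gaps_mono => //=; lia.
apply: le_lt_trans h _; rewrite -subr_gt0; apply: (H (Ordinal lt, j)).
by rewrite mem_filter mem_enum inE andbT /=; apply/eqP; lia.
Qed.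

Lemma ecellE : @ecell R d w = @scell R (size w) m.
Proof.
apply/seteqP; split => D; rewrite /scell /ecell /= /walls all_cat all_map [X in _ && X]all_map.
  move=> [H1 H2]; apply/andP; split; apply/allP => z /=; last exact: H2.
  by case: z => i j; rewrite mem_filter => /andP [/eqP e _]; rewrite subr_ge0 H1 //= [X in (_ <= X)%N]e.
move=> /andP [/allP H1 /allP H2]; split; last exact: H2.
exact: (@gaps_mono D H1).
Qed.

Lemma ecelloE : @ecello R d w = @scello R (size w) m.
Proof.
apply/seteqP; split => D; rewrite /scello /ecello /= /walls all_cat all_map [X in _ && X]all_map.
  move=> [H1 H2]; apply/andP; split; apply/allP => z /=; last exact: H2.
  by case: z => i j; rewrite mem_filter => /andP [/eqP e _]; rewrite subr_gt0 H1 //= [X in (_ < X)%N]e.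
move=> /andP [/allP H1 /allP H2]; split; last exact: H2.
exact: (@gaps_smono D H1).
Qed.

Lemma mem_rdiv (y : 'rV[R]_(size w)) (z : Cx) :
  z \in rdiv y <-> exists i, z = (y 0 i)%:C%C.
Proof.
rewrite /rdiv; split.
  by move/flatten_mapP => [i _]; rewrite mem_nseq => /andP [_ /eqP ->]; exists i.
move=> [i ->]; apply/flatten_mapP; exists i; first by rewrite mem_enum.
by rewrite mem_nseq (wt_gt0 hw) eqxx.
Qed.

(** The shift is by [- c]: the disk centred at [c] becomes the unit disk at the origin, and
    [c]-balanced divisors become those of moment 0. *)
Definition translate (c : R) : cfg -> cfg := aff 1 (const_mx (- c)) (- c%:C%C).

Lemma translateD c c' D : translate c (translate c' D) = translate (c + c') D.
Proof.
rewrite /translate aff_comp mulr1 scale1r; congr aff.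
  by apply/rowP => i; rewrite !mxE; ring.
by rewrite mul1r rmorphD opprD addrC.
Qed.

Lemma translate0 D : translate 0 D = D.
Proof.
rewrite /translate -[RHS](aff_id D); congr aff; first by apply/rowP => i; rewrite !mxE oppr0.
by rewrite oppr0.
Qed.

Lemma translateK c : cancel (translate c) (translate (- c)).
Proof. by move=> D; rewrite translateD addNr translate0. Qed.

Lemma translateNK c : cancel (translate (- c)) (translate c).
Proof. by move=> D; rewrite translateD addrN translate0. Qed.

Lemma translate_continuous c : continuous (translate c).
Proof.
apply: cts_all => D.
exact: (cts_aff (cts_cst (1 : R) D) (cts_cst (const_mx (- c) : 'rV[R]_(size w)) D) (cts_cst (- c%:C%C : Cx) D) (cts_id D)).
Qed.

Lemma touches_circleE c (D : cfg) : touches_circle (d := d) c D <-> radius (translate c D) = 1.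
Proof.
have real_translate i : cabs ((D.1 0 i)%:C%C - c%:C%C : Cx) = `|(translate c D).1 0 i|.
  by rewrite !mxE mul1r -cabs_real rmorphB.
(* An arbitrary predicate on moduli, so that the closed and the open disk are treated at once. *)
have supp (P : R -> Prop) : (forall i, P `|(translate c D).1 0 i|) /\
      (forall z, z \in pts (translate c D).2 -> P (cabs z)) <->
    (forall z : Cx, z \in rdiv D.1 ++ pts D.2 -> P (cabs (z - c%:C%C))).
  split=> [[H1 H2] z|H].
    rewrite mem_cat => /orP [/mem_rdiv [i ->]|zD]; first by rewrite real_translate; exact: H1.
    by apply: H2; rewrite (perm_mem (pts_sym_map _ _)); apply/mapP; exists z; rewrite ?mul1r.
  split=> [i|z].
    rewrite -real_translate; apply: H; rewrite mem_cat.
    by have -> // : (D.1 0 i)%:C%C \in rdiv D.1 by apply/mem_rdiv; exists i.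
  rewrite (perm_mem (pts_sym_map _ _)) => /mapP [u uD ->].
  by rewrite mul1r; apply: H; rewrite mem_cat uD orbT.
have le1 : radius (translate c D) <= 1 <-> forall z : Cx, z \in rdiv D.1 ++ pts D.2 -> `|z - c%:C%C| <= 1.
  rewrite radius_leP // (supp (fun x => x <= 1)).
  by split=> H z /H; rewrite cabsE (lec_real _ 1 : (_ <= 1) = _).
have lt1 : radius (translate c D) < 1 <-> forall z : Cx, z \in rdiv D.1 ++ pts D.2 -> `|z - c%:C%C| < 1.
  rewrite radius_ltP // (supp (fun x => x < 1)).
  by split=> H z /H; rewrite cabsE (ltc_real _ 1 : (_ < 1) = _).
rewrite /touches_circle /= -le1 -lt1; split.
  by move=> [h /negP]; rewrite -leNgt => h'; apply/eqP; rewrite eq_le h.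
by move=> ->; rewrite lexx ltxx.
Qed.

Lemma scell_translate c D : scell (translate c D) <-> scell D.
Proof.
rewrite /scell /= (perm_all _ (perm_walls_aff (c := 0) 1 D _ _)).
- by rewrite (eq_map (g := id)) ?map_id // => x; rewrite mul1r addr0.
- by move=> ij _; rewrite !mxE subrr.
- by rewrite /= oppr0.
Qed.

Lemma size_rdiv (y : 'rV[R]_(size w)) : size (rdiv y) = sumn w.
Proof.
rewrite /rdiv size_flatten /shape -map_comp (eq_map (g := wt)) => [|i]; last by rewrite /= size_nseq.
rewrite sumnE big_map -[in RHS](in_tupleE w) sumnE big_tuple.
rewrite big_enum /=; apply: eq_bigr => i _; by rewrite (tnth_nth 0%N).
Qed.

Lemma size_total_div (D : cfg) : size (total_div (d := d) D) = d.
Proof.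
rewrite !size_cat size_map size_rdiv (size_pts D.2) -[RHS](sumn_npairs hw) -addnn.
by [].
Qed.

Lemma sumn_wt : sumn w = \sum_i wt i.
Proof.
rewrite -[in LHS](in_tupleE w) sumnE big_tuple; apply: eq_bigr => i _.
by rewrite (tnth_nth 0%N).
Qed.

Lemma total_weightE : total_weight R m wt = d%:R.
Proof.
rewrite /total_weight -sumn_wt -[in RHS](sumn_npairs hw) -muln2 natrD natrM mulrC.
by ring.
Qed.

Lemma sum_total_div (D : cfg) :
  \sum_(z <- total_div (d := d) D) z = (moment wt D)%:C%C.
Proof.
rewrite !big_cat /= /moment rmorphD /=; congr (_ + _).
  rewrite /rdiv big_flatten big_map big_enum raddf_sum /=; apply: eq_bigr => i _.
  by rewrite big_nseq iter_addr_0 mulr_natl raddfMn.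
rewrite big_map -big_split raddf_sum /=; apply: eq_bigr => z _.
by rewrite addcJ rmorphM rmorph_nat.
Qed.

Lemma balancedE a (D : cfg) : balanced a (total_div (d := d) D) <-> moment wt D = a * d%:R.
Proof.
rewrite /balanced sum_total_div size_total_div; split=> [[]|->] //.
Qed.

Lemma moment_translate c D : moment wt (translate c D) = moment wt D - c * d%:R.
Proof.
rewrite moment_aff mul1r -total_weightE /total_weight /=.
under eq_bigr do rewrite mxE.
rewrite -mulr_suml natr_sum; ring.
Qed.

Lemma sigmaE : @sigma R d w = @slink R (size w) m.
Proof.
rewrite /sigma ecellE; apply/seteqP; split => D [H1 H2]; split => //.
  by have := (touches_circleE 0 D).1 H2; rewrite translate0.
by apply/(touches_circleE 0 D).2; rewrite translate0.
Qed.

Lemma sigma_bal_translate c D : sigma_bal c D <->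
  (@slink R (size w) m `&` [set D | moment wt D = 0]) (translate c D).
Proof.
rewrite /sigma_bal /ecell_bal ecellE /setI /= touches_circleE balancedE moment_translate.
rewrite /slink /setI /= scell_translate; split.
  by move=> [[H1 ->] H2]; rewrite subrr.
by move=> [[H1 H2] /eqP]; rewrite subr_eq0 => /eqP H3.
Qed.

Lemma ecell_balE c : @ecell_bal R d w c = @scell R (size w) m `&` [set D | moment wt D = c * d%:R].
Proof. by rewrite /ecell_bal ecellE; apply/seteqP; split => D [H1 H2]; split => //; apply/(balancedE c D). Qed.

Lemma cts_moment D : cts_at (@moment R _ m wt) D.
Proof.
have c := cts_each D (@viete_coord_continuous R (size w) m).
have c2 := cts_coord 0 0 (cts_mulmx (moment_form R m wt) c).
by apply: (cts_ext c2) => E; rewrite momentE.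
Qed.

Hypothesis d0 : (0 < d)%N.

Lemma sigma_bal_ball c :
  is_closed_ball R (@sigma_bal R d w c) (d%:Z - (rnorm w)%:Z - 2).
Proof.
have rd : (rnorm w <= d)%N.
  have := dimE hw; have := hw => -[Ow le _]; rewrite rnorm_sumn //; lia.
have [wd|wd] := pselect (w = [:: d]).
  have [p1 m0] := single_type wd.
  (* [Negz 0] is -1, the dimension of the empty ball. *)
  have -> : d%:Z - (rnorm w)%:Z - 2 = Negz 0.
    have := dimE hw; rewrite p1 m0 => h; rewrite NegzE; lia.
  split=> //; apply/seteqP; split => // D /sigma_bal_translate.
  by rewrite (slink_moment0_single R p1 m0 (wt_gt0 hw)).
have [k ek] := dim_ge2 hw d0 wd.
have -> : d%:Z - (rnorm w)%:Z - 2 = Posz k by have := dimE hw; rewrite ek; lia.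
rewrite /is_closed_ball.
apply: homeomorphic_trans (slink_moment0_cball R (wt_gt0 hw) (nwalls_gt0 hw d0 wd) ek).
exists (translate c); apply: (homeo_on_sub (translateK c) (translateNK c)).
- exact: translate_continuous.
- exact: translate_continuous.
- by move=> D; exact: sigma_bal_translate.
Qed.

Lemma sigma_ball : w <> [:: d] ->
  is_closed_ball R (@sigma R d w) (d%:Z - (rnorm w)%:Z - 1).
Proof.
move=> wd; have [k ek] := dim_ge2 hw d0 wd.
have -> : d%:Z - (rnorm w)%:Z - 1 = Posz k.+1 by have := dimE hw; rewrite ek; lia.
have [f [fh _]] := slink_cball R (wt_gt0 hw) (nwalls_gt0 hw d0 wd) ek.
by rewrite sigmaE; exists f.
Qed.

Lemma sigma_sphere : w = [:: d] -> homeomorphic (@sigma R d w) (@sphere R 1 1).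
Proof.
move=> wd; have [p1 m0] := single_type wd.
by rewrite sigmaE; exact: slink_sphere_single.
Qed.

Lemma cone_ecell : is_positive_cone R (@ecell R d w) (@sigma R d w).
Proof.
rewrite sigmaE ecellE.
pose z : cfg := (0, to_sym 0).
apply: (@cone_scell R _ m id id (fun=> erefl) (fun=> erefl) _ _ _ (dil 0 z)) => //.
- by move=> x; exact: cvg_id.
- by move=> x; exact: cvg_id.
- exact: closed_scell.
- exact: scell_dil0.
- by move=> D; exact: dil0.
- by move=> t D t0; exact: scell_dil.
Qed.

Lemma cone_ecell_bal c : is_positive_cone R (@ecell_bal R d w c) (@sigma_bal R d w c).
Proof.
have -> : @sigma_bal R d w c = @ecell_bal R d w c `&` [set D : cfg | radius (translate c D) = 1].
  rewrite /sigma_bal; apply/seteqP; split => D [H1 H2]; split => //; exact/(touches_circleE c D).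
pose z : cfg := (0, to_sym 0).
have E D : ecell_bal (d := d) c (translate (- c) D) <-> scell D /\ moment wt D = 0.
  rewrite ecell_balE /setI /= scell_translate moment_translate mulNr opprK.
  split=> -[H1 H2]; split=> //; last by rewrite H2 add0r.
  by apply: (addIr (c * d%:R)); rewrite H2 add0r.
apply: (@cone_scell R _ m (translate c) (translate (- c)) (translateK c) (translateNK c) _ _ _ (dil 0 z)).
- exact: translate_continuous.
- exact: translate_continuous.
- rewrite ecell_balE; apply: closedI; first exact: closed_scell.
  apply: (@preimage_closed _ _ (@moment R _ m wt) [set c * d%:R]); last exact: closed_eq.
  by move=> D _; case: (cts_moment D).
- apply/E; split; first exact: scell_dil0.
  by rewrite moment_aff mul0r mulr0 addr0 add0r; apply: big1 => i _; rewrite mxE mulr0.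
- by move=> D; exact: dil0.
- move=> t D t0 /E [H1 H2]; apply/E; split; first exact: scell_dil.
  rewrite moment_aff H2 !mulr0 addr0 add0r.
  by apply: big1 => i _; rewrite mxE mulr0.
Qed.

Lemma ecell_pair :
  [\/ pair_homeomorphic (@ecell R d w) (@ecello R d w) (@cball R (d - rnorm w)) (@oball R (d - rnorm w)),
      pair_homeomorphic (@ecell R d w) (@ecello R d w) (@hball R (d - rnorm w)) (@oball R (d - rnorm w)) |
      pair_homeomorphic (@ecell R d w) (@ecello R d w) (@oball R (d - rnorm w)) (@oball R (d - rnorm w)) /\
      w = [:: d]].
Proof.
rewrite ecellE ecelloE (dimE hw).
have [wd|wd] := pselect (w = [:: d]).
  have [p1 m0] := single_type wd.
  have e1 : (size w + (m + m) = 1)%N by rewrite p1 m0.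
  apply: Or33; split => //; rewrite e1.
  exact: scell_oball_single.
have [k ek] := dim_ge2 hw d0 wd.
apply: Or32; rewrite ek.
exact: (scell_hball R (wt_gt0 hw) (nwalls_gt0 hw d0 wd) ek).
Qed.

Lemma ecello_oball : homeomorphic (@ecello R d w) (@oball R (d - rnorm w)).
Proof.
have s : @ecello R d w `<=` @ecell R d w by rewrite ecellE ecelloE; exact: scello_sub.
by case: ecell_pair => [h|h|[h _]]; apply: (pair_homeomorphic_snd s h).
Qed.

End CellsOfDefs.

(** * Root divisors and degenerations *)

Section Divisors.
Variable R : realType.
Local Notation Cx := (C R).

(** A list version of [rdiv]: degenerations change the number of real points, which would change the
    type of a row vector. *)
Definition realdiv (w : seq nat) (y : seq R) : seq Cx :=
  flatten [seq nseq k.1 (k.2%:C%C : Cx) | k <- zip w y].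

Definition fulldiv (w : seq nat) (y : seq R) (zs : seq Cx) : seq Cx :=
  realdiv w y ++ zs ++ [seq (conjc z : Cx) | z <- zs].

Lemma realdiv_cat s t (y z : seq R) : size s = size y ->
  realdiv (s ++ t) (y ++ z) = realdiv s y ++ realdiv t z.
Proof. by move=> e; rewrite /realdiv zip_cat // map_cat flatten_cat. Qed.

Lemma realdiv_cons a w x y : realdiv (a :: w) (x :: y) = nseq a (x%:C%C : Cx) ++ realdiv w y.
Proof. by []. Qed.

Lemma size_realdiv w y : size w = size y -> size (realdiv w y) = sumn w.
Proof.
elim: w y => [|a w IH] [|x y] //= [e].
by rewrite realdiv_cons size_cat size_nseq IH.
Qed.

Lemma realdiv_real w y z : z \in realdiv w y -> complex.Im z = 0.
Proof.
elim: w y => [|a w IH] [|x y] //=; rewrite realdiv_cons mem_cat mem_nseq.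
by move=> /orP [/andP [_ /eqP ->]|/IH].
Qed.

Lemma count_realdiv w y x : size w = size y -> uniq y ->
  count_mem (x%:C%C : Cx) (realdiv w y) = if x \in y then nth 0%N w (index x y) else 0%N.
Proof.
elim: w y => [|a w IH] [|b y] //= [e] /andP [bn uy].
rewrite realdiv_cons count_cat count_nseq IH // in_cons /=.
have -> : ((b%:C%C : Cx) == x%:C%C) = (b == x) by apply/eqP/eqP => [[]|->].
have [bx|bx] := eqVneq b x; first by rewrite -bx (negPf bn) mul1n addn0.
by rewrite mul0n.
Qed.

Lemma conj_realdiv w y : [seq (conjc z : Cx) | z <- realdiv w y] = realdiv w y.
Proof.
rewrite -[RHS]map_id; apply/eq_in_map => z /realdiv_real.
by case: z => a b /= ->; rewrite oppr0.
Qed.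

Lemma conj_eq (q u : R[i]) : (conjc q == u) = (q == conjc u).
Proof. by apply/eqP/eqP => [<-|->]; rewrite conjcK. Qed.

Lemma conj_fulldiv w y zs :
  perm_eq [seq (conjc z : Cx) | z <- fulldiv w y zs] (fulldiv w y zs).
Proof.
rewrite /fulldiv !map_cat conj_realdiv perm_cat2l -map_comp.
have -> : [seq ((@conjc R) \o (@conjc R)) i | i <- zs] = zs.
  by rewrite -[RHS]map_id; apply: eq_map => z; exact: conjcK.
by rewrite perm_catC.
Qed.

Lemma rootpoly_conj (s : seq Cx) :
  map_poly (@conjc R : R[i] -> R[i]) (rootpoly s) = rootpoly [seq (conjc z : Cx) | z <- s].
Proof.
rewrite /rootpoly big_map.
pose f : {rmorphism R[i] -> R[i]} := @conjc R.
rewrite -[LHS]/(map_poly f _) (rmorph_prod (map_poly f)); apply: eq_bigr => z _.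
by rewrite rmorphB /= map_polyX map_polyC.
Qed.

Variable d : nat.

Definition cpoly (a : 'rV[R]_d) : {poly Cx} := map_poly (real_complex R) (monic_of a).

Lemma coef_monic_of (a : 'rV[R]_d) (i : 'I_d) : (monic_of a)`_i = a 0 i.
Proof. by rewrite /monic_of coefD coefXn ltn_eqF // add0r coef_rVpoly_ord. Qed.

Lemma size_monic_of (a : 'rV[R]_d) : size (monic_of a) = d.+1.
Proof. by rewrite /monic_of size_polyDl size_polyXn // ltnS size_poly. Qed.

Lemma monic_of_monic (a : 'rV[R]_d) : monic_of a \is monic.
Proof. by rewrite /monic_of monicE lead_coefDl ?lead_coefXn // size_polyXn ltnS size_poly. Qed.

Lemma monic_of_neq0 (a : 'rV[R]_d) : monic_of a != 0.
Proof. exact: monic_neq0 (monic_of_monic a). Qed.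

Lemma cpoly_inj : injective cpoly.
Proof.
move=> a b /(congr1 (fun P : {poly Cx} => P)) e; apply/rowP => i.
by rewrite -!coef_monic_of; apply: (fmorph_inj (real_complex R)); rewrite -!coef_map; exact: (congr1 (fun P : {poly Cx} => P`_i) e).
Qed.

Lemma conj_real (z : Cx) : (conjc z : Cx) = z -> z = (complex.Re z)%:C%C.
Proof.
case: z => a b [] /eqP; rewrite eq_sym -subr_eq0 opprK -mulr2n mulrn_eq0 /= => /eqP -> //.
Qed.

(** The coefficients of a conjugation-invariant product are real, so taking real parts in [viete]
    loses nothing. *)
Lemma cpoly_viete (s : seq Cx) : size s = d ->
  perm_eq [seq (conjc z : Cx) | z <- s] s -> cpoly (viete d s) = rootpoly s.
Proof.
move=> sd cs; apply/polyP => k; rewrite coef_map.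
have real : (rootpoly s)`_k = (complex.Re (rootpoly s)`_k)%:C%C.
  apply: conj_real; rewrite -[in RHS](perm_rootpoly cs) -rootpoly_conj coef_map_id0 //.
  by rewrite conjc0.
have [kd|] := ltnP k d.
  by rewrite -[k]/(nat_of_ord (Ordinal kd)) coef_monic_of mxE /= [RHS]real.
rewrite leq_eqVlt => /predU1P [<-|dk].
  have := monicP (monic_of_monic (viete d s)); rewrite lead_coefE size_monic_of /= => ->.
  by have := monicP (monic_rootpoly s); rewrite lead_coefE size_rootpoly sd /= => ->.
by rewrite !nth_default ?size_rootpoly ?sd // size_monic_of.
Qed.

Lemma cpoly_split (a : 'rV[R]_d) : exists s : seq Cx,
  [/\ size s = d, cpoly a = rootpoly s & perm_eq [seq (conjc z : Cx) | z <- s] s].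
Proof.
have m : cpoly a \is monic by rewrite /cpoly map_monic monic_of_monic.
have sz : size (cpoly a) = d.+1 by rewrite /cpoly size_map_poly size_monic_of.
have [s ss e] := rootpoly_surj m sz; exists s; split => //.
apply: rootpoly_inj; rewrite -rootpoly_conj -e /cpoly -map_poly_comp.
by apply: eq_map_poly => x /=; rewrite oppr0.
Qed.

Lemma mup_cpoly (a : 'rV[R]_d) (s : seq Cx) x : cpoly a = rootpoly s ->
  mup x (monic_of a) = count_mem (x%:C%C : Cx) s.
Proof.
move=> e; rewrite -mu_prod_XsubC -/(rootpoly s) -e.
have c0 : cpoly a != 0 by rewrite map_poly_eq0 monic_of_neq0.
apply/eqP; rewrite eqn_leq.
have H n : (('X - (x%:C%C : Cx)%:P) ^+ n %| cpoly a) = (('X - x%:P) ^+ n %| monic_of a).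
  by rewrite -(dvdp_map (real_complex R)) rmorphXn rmorphB /= map_polyX map_polyC.
rewrite mup_geq // H -mup_geq ?monic_of_neq0 // leqnn /=.
by rewrite mup_geq ?monic_of_neq0 // -H -mup_geq.
Qed.

(* Membership in the image under [Phi] of the closed (below: open) cell of type [w],
   witnessed by the real points [y] and the points [zs] of the half-plane. *)
Definition in_cell (w : seq nat) (a : 'rV[R]_d) (y : seq R) (zs : seq Cx) : Prop :=
  [/\ size y = size w, sorted <=%R y, all (fun z : Cx => 0 <= complex.Im z) zs,
      size zs = npairs d w & cpoly a = rootpoly (fulldiv w y zs)].

Definition in_open_cell (w : seq nat) (a : 'rV[R]_d) (y : seq R) (zs : seq Cx) : Prop :=
  [/\ size y = size w, sorted <%R y, all (fun z : Cx => 0 < complex.Im z) zs,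
      size zs = npairs d w & cpoly a = rootpoly (fulldiv w y zs)].

Lemma mem_rootsR (P : {poly R}) x : P != 0 -> (x \in rootsR P) = root P x.
Proof. by move=> P0; have := roots_on_rootsR P0 x; rewrite in_itv /= => ->. Qed.

(** The whole divisor determines its points in the upper half-plane; this is the complex half of the
    injectivity of [Phi] on open cells. *)
Lemma count_upper w y (zs : seq Cx) : all (fun z : Cx => 0 < complex.Im z) zs ->
  [seq z <- fulldiv w y zs | 0 < complex.Im z] = zs.
Proof.
move=> /allP H; rewrite /fulldiv !filter_cat.
have -> : [seq z <- realdiv w y | 0 < complex.Im z] = [::].
  apply/eqP; rewrite -size_eq0 size_filter -leqn0 leqNgt -has_count; apply/hasPn => z.
  by move=> /realdiv_real ->; rewrite ltxx.
have -> : [seq z <- [seq (conjc z : Cx) | z <- zs] | 0 < complex.Im z] = [::].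
  apply/eqP; rewrite -size_eq0 size_filter -leqn0 leqNgt -has_count; apply/hasPn => z.
  by move=> /mapP [u /H u0 ->]; case: u u0 => p q /=; rewrite oppr_gt0 -leNgt => /ltW.
by rewrite cats0 cat0s; apply/all_filterP/allP.
Qed.

Lemma fulldiv_real_count w y (zs : seq Cx) x : all (fun z : Cx => 0 < complex.Im z) zs ->
  count_mem (x%:C%C : Cx) (fulldiv w y zs) = count_mem (x%:C%C : Cx) (realdiv w y).
Proof.
move=> /allP H; rewrite /fulldiv !count_cat.
have -> : count_mem (x%:C%C : Cx) zs = 0%N.
  by apply/count_memPn; apply/negP => /H /=; rewrite ltxx.
have -> : count_mem (x%:C%C : Cx) [seq (conjc z : Cx) | z <- zs] = 0%N.
  apply/count_memPn; apply/negP => /mapP [[p q]] /H /= q0 [_] /eqP.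
  by rewrite eq_sym oppr_eq0 gt_eqF.
by rewrite !addn0.
Qed.

Lemma in_open_cell_rootsR w a y zs : Omega w -> in_open_cell w a y zs ->
  rootsR (monic_of a) = y /\ comb_type (monic_of a) = w.
Proof.
move=> Ow [sy oy zs0 szs e].
have uy : uniq y by apply: sorted_uniq oy; [exact: lt_trans|exact: ltxx].
have mu x : mup x (monic_of a) = if x \in y then nth 0%N w (index x y) else 0%N.
  by rewrite (mup_cpoly x e) fulldiv_real_count // count_realdiv.
have ey : rootsR (monic_of a) = y.
  apply: lt_sorted_eq; [exact: sorted_roots|exact: oy|] => x.
  rewrite mem_rootsR ?monic_of_neq0 // root_factor_theorem.
  rewrite -[_ - _]expr1 -mup_geq ?monic_of_neq0 // mu.
  case: ifP => // xy; rewrite lt0n; apply: contraNneq Ow => <-; apply: mem_nth.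
  by rewrite -sy index_mem.
split=> //; rewrite /comb_type ey; apply: (@eq_from_nth _ 0%N); rewrite size_map // => i iy.
by rewrite (nth_map 0) // mu mem_nth // index_uniq.
Qed.

(** The witnesses are the real roots and the roots in the upper half-plane. Multiplicities are
    compared at each point according to the sign of its imaginary part, conjugation exchanging the
    two half-planes; counting points then gives the size and parity conditions on the type. *)
Lemma stratum_in_open_cell a : let v := comb_type (monic_of a) in
  Omega_le d v /\ exists y zs, in_open_cell v a y zs.
Proof.
move=> v; have [s [sd e cs]] := cpoly_split a.
pose y := rootsR (monic_of a); pose zs := [seq z <- s | 0 < complex.Im z].
have oy : sorted <%R y := sorted_roots _ _ _.
have uy : uniq y by apply: sorted_uniq oy; [exact: lt_trans|exact: ltxx].
have sv : size v = size y by rewrite size_map.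
have mu x : (if x \in y then nth 0%N v (index x y) else 0%N) = mup x (monic_of a).
  case: ifP => xy.
    rewrite /v /comb_type -/y (nth_map 0); last by rewrite index_mem.
    by have -> := nth_index 0 xy.
  apply/esym/eqP; rewrite -leqn0 leqNgt -XsubC_dvd ?monic_of_neq0 //.
  by rewrite -root_factor_theorem -mem_rootsR ?monic_of_neq0 // -/y xy.
have zs0 : all (fun z : Cx => 0 < complex.Im z) zs by exact: filter_all.
have pe : perm_eq s (fulldiv v y zs).
  apply/allP => z _ /=; apply/eqP.
  have cz u : count_mem u s = count_mem (conjc u : Cx) s.
    rewrite -(seq.permP cs) count_map; apply: eq_count => q /=.
    exact: conj_eq.
  have cf u : count_mem u zs = if 0 < complex.Im u then count_mem u s else 0%N.
    rewrite count_filter; case: ifP => u0.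
      by apply: eq_count => q /=; apply: andb_idr => /eqP ->.
    by apply/eqP; rewrite -leqn0 leqNgt -has_count; apply/hasPn => q _ /=; apply/negP => /andP [/eqP ->]; rewrite u0.
  have cc u : count_mem u [seq (conjc z : Cx) | z <- zs] = count_mem (conjc u : Cx) zs.
    rewrite count_map; apply: eq_count => q /=.
    exact: conj_eq.
  have [z0|z0|z0] := ltgtP (complex.Im z) 0.
  - rewrite /fulldiv !count_cat cc !cf ltNge (ltW z0) /=.
    have -> : (0 < complex.Im (conjc z : Cx)) by case: z z0 => p q /=; rewrite oppr_gt0.
    rewrite -cz (_ : count_mem z (realdiv v y) = 0%N) //.
    by apply/count_memPn; apply/negP => /realdiv_real zi; rewrite zi ltxx in z0.
  - rewrite /fulldiv !count_cat cc !cf z0 /=.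
    have -> : (0 < complex.Im (conjc z : Cx)) = false.
      by case: z z0 => p q /= q0; rewrite oppr_gt0 ltNge ltW.
    rewrite (_ : count_mem z (realdiv v y) = 0%N) ?addn0 //.
    by apply/count_memPn; apply/negP => /realdiv_real zi; rewrite zi ltxx in z0.
  - have -> : z = ((complex.Re z)%:C%C : Cx) by case: z z0 => p q /= ->.
    by rewrite fulldiv_real_count // count_realdiv // mu (mup_cpoly _ e).
have sz := perm_size pe; rewrite sd /fulldiv !size_cat size_map size_realdiv // addnn in sz.
have Ov : Omega v.
  rewrite /Omega /=; apply/negP => /mapP [x xr /esym/eqP].
  apply/negP; rewrite -lt0n -XsubC_dvd ?monic_of_neq0 // -root_factor_theorem.
  by rewrite -mem_rootsR ?monic_of_neq0.
split.
  split => //; first by rewrite sz leq_addr.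
  by rewrite sz oddD odd_double addbF.
exists y, zs; split => //.
  by rewrite /npairs sz addKn doubleK.
by rewrite e (perm_rootpoly pe).
Qed.

End Divisors.

(** * Merges, inserts and the codimension *)

Lemma sumn_middle s x t : sumn (s ++ x :: t) = (sumn s + (x + sumn t))%N.
Proof. by rewrite sumn_cat. Qed.

(** The codimension is the sum of the entries minus their number. A merge keeps the sum and loses
    one entry; an insert adds 2 to the sum and gains one entry. *)
Lemma elementary_omega (w v : seq nat) : elementary w v -> Omega w ->
  [/\ Omega v, (sumn w <= sumn v)%N, odd (sumn v) = odd (sumn w) & rnorm v = (rnorm w).+1].
Proof.
case=> [s a b t -> ->|s t -> ->] Ow.
  have : Omega (s ++ (a + b)%N :: t).
    move: Ow; rewrite /Omega /= !mem_cat !in_cons; apply: contraNN; rewrite !(eq_sym 0%N) addn_eq0.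
    by case/or3P => [->//|/andP [-> _]|->]; rewrite ?orbT.
  have [a0 b0] : (0 < a)%N /\ (0 < b)%N.
    by move: Ow; rewrite /Omega /= !mem_cat !in_cons !negb_or !(eq_sym 0%N) !lt0n => /and4P [].
  move=> Ov; split => //; rewrite ?sumn_middle /= ?sumn_cat /=.
  - lia.
  - by congr odd; lia.
  - by rewrite /rnorm !map_cat !sumn_cat /=; lia.
have Ov : Omega (s ++ 2%N :: t).
  by move: Ow; rewrite /Omega /= !mem_cat in_cons /=.
split => //; rewrite ?sumn_middle ?sumn_cat /=.
- lia.
- by rewrite !oddD /=.
- by rewrite /rnorm !map_cat !sumn_cat /=; lia.
Qed.

Lemma succeq_omega (w v : seq nat) : succeq w v -> Omega w ->
  [/\ Omega v, (sumn w <= sumn v)%N, odd (sumn v) = odd (sumn w) & (rnorm w <= rnorm v)%N].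
Proof.
elim=> [x y e Ox|x|x y z _ IH1 _ IH2 Ox].
- by have [? ? ? ->] := elementary_omega e Ox.
- by [].
- have [Oy s1 o1 r1] := IH1 Ox; have [Oz s2 o2 r2] := IH2 Oy; split => //.
  + exact: leq_trans s1 s2.
  + by rewrite o2.
  + exact: leq_trans r1 r2.
Qed.

Section Degenerations.
Variables (R : realType) (d : nat).
Local Notation Cx := (C R).
Implicit Types (w v : seq nat) (a : 'rV[R]_d) (y : seq R) (zs : seq Cx).

Lemma sorted_lt_or_repeat y : sorted <=%R y ->
  sorted <%R y \/ exists y1 x y2, y = y1 ++ [:: x, x & y2].
Proof.
elim: y => [|x y IH] /=; first by left.
case: y IH => [|b y] IH; first by left.
rewrite /= => /andP [xb py]; have [e|xb'] := eqVneq x b.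
  by right; exists [::], x, y; rewrite -e.
have [/= h|[y1 [c [y2 e]]]] := IH py.
  by left; rewrite /= lt_neqAle xb' xb.
by right; exists (x :: y1), c, y2; rewrite e.
Qed.

Lemma sorted_insert y x (w : seq nat) : sorted <=%R y -> size y = size w ->
  exists s t y1 y2, [/\ w = s ++ t, y = y1 ++ y2, size s = size y1 & sorted <=%R (y1 ++ x :: y2)].
Proof.
elim: y w => [|b y IH] w oy sw.
  by exists [::], w, [::], [::].
case: w sw => // a w [sw].
have [xb|bx] := leP x b.
  by exists [::], (a :: w), [::], (b :: y); split => //=; rewrite xb.
have := oy; rewrite /= (path_sortedE le_trans) => /andP [ab oy'].
have [s [t [y1 [y2 [ew ey es os]]]]] := IH w oy' sw.
exists (a :: s), t, (b :: y1), y2; split => /=; rewrite ?ew ?ey ?es //.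
rewrite (path_sortedE le_trans) os andbT all_cat /= (ltW bx).
by move: ab; rewrite ey all_cat => /andP [-> ->].
Qed.

Lemma split_at (A : Type) (s : seq A) n1 n2 : size s = (n1 + n2)%N ->
  exists s1 s2, [/\ s = s1 ++ s2, size s1 = n1 & size s2 = n2].
Proof.
move=> e; exists (take n1 s), (drop n1 s); rewrite cat_take_drop size_drop e addKn.
by rewrite size_take e; split => //; case: ltnP => //; lia.
Qed.

Lemma sorted_mid_drop y1 (x : R) y2 : sorted <=%R (y1 ++ x :: y2) -> sorted <=%R (y1 ++ y2).
Proof.
apply: subseq_sorted; first exact: le_trans.
by apply: cat_subseq => //; exact: subseq_cons.
Qed.

Lemma sorted_mid_dup y1 (x : R) y2 : sorted <=%R (y1 ++ x :: y2) -> sorted <=%R (y1 ++ [:: x, x & y2]).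
Proof.
elim: y1 => [|b y1 IH] /=; first by rewrite lexx.
rewrite !(path_sortedE le_trans) !all_cat /= => /andP [/and3P [-> -> ->] /IH ->] //.
Qed.

Lemma sumn_le_npairs w v : Omega_le d v -> sumn v = (sumn w + 2)%N -> npairs d w = (npairs d v).+1.
Proof.
move=> [_ le _] e; rewrite /npairs.
have -> : (d - sumn w = (d - sumn v).+2)%N by lia.
by [].
Qed.

(* Two equal real points give a merge; a point of [zs] on the real axis, together
   with its conjugate, gives an insert. *)
Lemma in_cell_step w a y zs : Omega_le d w -> in_cell w a y zs ->
  in_open_cell w a y zs \/
  exists v, [/\ elementary w v, Omega_le d v & exists y' zs', in_cell v a y' zs'].
Proof.
move=> hw [sy oy zs0 szs e]; have [Ow le o] := hw.
have [zs1|] := boolP (all (fun z : Cx => 0 < complex.Im z) zs); last first.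
  rewrite -has_predC => /hasP [z zin /= zn]; right.
  have z0 : complex.Im z = 0 by apply/eqP; rewrite eq_le leNgt zn /=; have /allP := zs0; apply.
  pose x := complex.Re z; have zx : z = (x%:C%C : Cx) by rewrite /x; case: (z) z0 => p q /= ->.
  have [s [t [y1 [y2 [ew ey es os]]]]] := sorted_insert x oy sy.
  have pz := perm_to_rem zin.
  have sz : size zs = (size (rem z zs)).+1 by rewrite (perm_size pz).
  have el : elementary w (s ++ 2%N :: t) by exact: Insert ew erefl.
  have [Ov sv ov rv] := elementary_omega el Ow.
  have e2 : sumn (s ++ 2%N :: t) = (sumn w + 2)%N by rewrite ew !sumn_cat /=; lia.
  have hv : Omega_le d (s ++ 2%N :: t).
    split => //; last by rewrite ov.
    have := sumn_npairs hw; rewrite -szs sz e2 -addnn; lia.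
  exists (s ++ 2%N :: t); split => //; exists (y1 ++ x :: y2), (rem z zs); split.
  - by have := sy; rewrite ey ew !size_cat /= es; lia.
  - exact: os.
  - by apply/allP => u /mem_rem; exact: (allP zs0).
  - by apply: succn_inj; rewrite -sz szs (sumn_le_npairs hv e2).
  - rewrite e; apply: perm_rootpoly; apply/seq.permP => P.
    have := seq.permP pz P.
    rewrite /fulldiv ew ey !realdiv_cat // realdiv_cons !count_cat !count_map count_nseq /= => ->.
    have := seq.permP pz (preim (fun z : Cx => (conjc z : Cx)) P); rewrite /= => ->.
    have -> : P (conjc z : Cx) = P z by rewrite zx /= oppr0.
    have -> : P (x%:C%C : Cx) = P z by rewrite -zx.
    lia.
have [oy'|[y1 [x [y2 ey]]]] := sorted_lt_or_repeat oy; first by left.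
right.
have sw : size w = (size y1 + (size y2).+2)%N by rewrite -sy ey size_cat.
have [s [t' [ew es et]]] := split_at sw.
case: t' et ew => [|k1 [|k2 t]] //= [et] ew.
have el : elementary w (s ++ (k1 + k2)%N :: t) by exact: Merge ew erefl.
have [Ov sv ov rv] := elementary_omega el Ow.
have e2 : sumn (s ++ (k1 + k2)%N :: t) = sumn w by rewrite ew !sumn_cat /=; lia.
have hv : Omega_le d (s ++ (k1 + k2)%N :: t) by split => //; rewrite e2.
exists (s ++ (k1 + k2)%N :: t); split => //; exists (y1 ++ x :: y2), zs; split => //.
- by rewrite !size_cat /= es et.
- by apply: (@sorted_mid_drop _ x); rewrite -ey.
- by rewrite szs /npairs e2.
- rewrite e; congr rootpoly; rewrite /fulldiv; congr (_ ++ _).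
  by rewrite ew ey !realdiv_cat // !realdiv_cons nseqD -!catA.
Qed.

(** The reverse of a degeneration: a merged point is regarded as two equal real points, and two
    copies of an inserted double point as a point of [zs] on the real axis and its conjugate. *)
Lemma in_cell_elementary w v a y zs : elementary w v -> Omega_le d v -> in_cell v a y zs ->
  exists y' zs', in_cell w a y' zs'.
Proof.
move=> el hv [sy oy zs0 szs e].
case: el sy e szs hv => [s k1 k2 t ew ev|s t ew ev] sy e szs hv.
  have e3 : size y = (size s + (size t).+1)%N by rewrite sy ev size_cat.
have [y1 [y2' [ey es et]]] := split_at e3.
  case: y2' et ey => [|x y2] //= [et] ey.
  exists (y1 ++ [:: x, x & y2]), zs; split => //.
  - by rewrite ew !size_cat /= es et.
  - by apply: sorted_mid_dup; rewrite -ey.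
  - by rewrite szs /npairs ew ev !sumn_cat /= -(addnA k1).
  - rewrite e; congr rootpoly; rewrite /fulldiv; congr (_ ++ _).
    by rewrite ew ev ey !realdiv_cat ?es // !realdiv_cons nseqD -!catA.
have e3 : size y = (size s + (size t).+1)%N by rewrite sy ev size_cat.
have [y1 [y2' [ey es et]]] := split_at e3.
case: y2' et ey => [|x y2] //= [et] ey.
have e2 : sumn v = (sumn w + 2)%N by rewrite ew ev !sumn_cat /=; lia.
exists (y1 ++ y2), ((x%:C%C : Cx) :: zs); split => //.
- by rewrite ew !size_cat es et.
- by apply: (@sorted_mid_drop _ x); rewrite -ey.
- by rewrite /= lexx.
- by rewrite /= szs (sumn_le_npairs hv e2).
- rewrite e; apply: perm_rootpoly; apply/seq.permP => P.
  rewrite /fulldiv ew ev ey !realdiv_cat ?es // realdiv_cons !count_cat /= oppr0.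
  have -> : P (x +i* 0)%C = P (x%:C%C : Cx) by [].
  lia.
Qed.

Lemma in_open_cellW w a y zs : in_open_cell w a y zs -> in_cell w a y zs.
Proof.
move=> [sy oy zs0 szs e]; split => //; first by apply: sub_sorted oy => ? ?; exact: ltW.
by apply: sub_all zs0 => ?; exact: ltW.
Qed.

(** [in_cell_step] is repeated until the cell is open. Every step raises [rnorm], which stays at
    most [d], so this ends; and as soon as one step is made, the type of [a] has strictly larger
    codimension than [w]. *)
Lemma in_cell_type w a y zs : Omega_le d w -> in_cell w a y zs ->
  let v := comb_type (monic_of a) in
  [/\ succeq w v, (in_open_cell w a y zs \/ (rnorm w < rnorm v)%N) &
      (rnorm w <= rnorm v)%N].
Proof.
move=> hw hc; set v := comb_type _.
have hvd : (rnorm v <= d)%N.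
  have [[Ov le _] _] := stratum_in_open_cell a.
  by rewrite -/v in Ov le *; rewrite rnorm_sumn //; lia.
have [n] := ubnP (d - rnorm w); elim: n w y zs hw hc => // n IH w y zs hw hc lt.
have [Ow le _] := hw.
have [ho|[u [el hu [y' [zs' hc']]]]] := in_cell_step hw hc.
  have [_ e] := in_open_cell_rootsR Ow ho.
  by rewrite /v e; split => //; [exact: rt_refl|left].
have [Ou _ _ ru] := elementary_omega el Ow.
have ud : (rnorm u <= d)%N.
  have [_ le' _] := hu; rewrite rnorm_sumn //; lia.
have lt' : (d - rnorm u < n)%N by lia.
have [sv _ rv] := IH u y' zs' hu hc' lt'.
split.
- exact: rt_trans (rt_step _ _ _ _ el) sv.
- by right; rewrite -ru.
- by rewrite ltnW // -ru.
Qed.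

Lemma in_cell_succeq w v a y zs : succeq w v -> Omega_le d w -> Omega_le d v ->
  in_cell v a y zs -> exists y' zs', in_cell w a y' zs'.
Proof.
move=> /(clos_rt_rt1n _ _ _ _) H; elim: H y zs => [u y zs _ _ hc|u u' v' el H IH y zs hu hv hc].
  by exists y, zs.
have [Ou _ _] := hu.
(* The sum of the entries never decreases along the chain, so intermediate types are bounded by the
   last one. *)
have hu' : Omega_le d u'.
  have [Ou' _ o' _] := elementary_omega el Ou.
  have [_ s1 o1 _] := succeq_omega (clos_rt1n_rt _ _ _ _ H) Ou'.
  have [_ le o] := hv; split => //; first exact: leq_trans s1 le.
  by rewrite -o1.
have [y' [zs' hc']] := IH y zs hu' hv hc.
exact: in_cell_elementary el hu' hc'.
Qed.

End Degenerations.

Section PhiImages.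
Variables (R : realType) (d : nat) (w : seq nat).
Hypothesis hw : Omega_le d w.
Local Notation Cx := (C R).
Local Notation m := (npairs d w).
Local Notation cfg := (cell_space R d w).

Lemma nth_map_ord (A : Type) (a : A) n (f : 'I_n -> A) (i : 'I_n) :
  nth a [seq f k | k : 'I_n] i = f i.
Proof. by rewrite (nth_map i) ?size_enum_ord // nth_ord_enum. Qed.

Lemma nth_entries (y : 'rV[R]_(size w)) (i : 'I_(size w)) : nth 0 (entries y) i = y 0 i.
Proof. exact: nth_map_ord. Qed.

Lemma rdivE (y : 'rV[R]_(size w)) : rdiv y = realdiv w (entries y).
Proof.
rewrite /rdiv /realdiv; congr flatten; apply: (@eq_from_nth _ [::]).
  by rewrite [RHS]size_map size_zip size_entries minnn size_image card_ord.
move=> i; rewrite size_image card_ord => iw.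
rewrite (nth_map_ord [::] (fun k : 'I_(size w) => nseq (nth 0%N w k) ((y 0 k)%:C%C : Cx)) (Ordinal iw)).
rewrite (nth_map (0%N, 0)) ?size_zip ?size_entries ?minnn // nth_zip ?size_entries //=.
by rewrite (nth_entries y (Ordinal iw)).
Qed.

Lemma total_divE (D : cfg) : total_div D = fulldiv w (entries D.1) (pts D.2).
Proof. by rewrite /total_div rdivE. Qed.

Lemma cpoly_Phi (D : cfg) : cpoly (Phi D) = rootpoly (fulldiv w (entries D.1) (pts D.2)).
Proof.
rewrite /Phi cpoly_viete; first by rewrite total_divE.
  exact: size_total_div.
by rewrite total_divE conj_fulldiv.
Qed.

Lemma ecell_in_cell (D : cfg) : ecell D <-> in_cell w (Phi D) (entries D.1) (pts D.2).
Proof.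
split.
  move=> [H1 H2]; split; rewrite ?size_entries ?(size_pts D.2) //; last exact: cpoly_Phi.
    apply/(sortedP 0) => i; rewrite size_entries => iw.
    rewrite (nth_entries D.1 (Ordinal (ltnW iw))) (nth_entries D.1 (Ordinal iw)).
    exact: H1.
  by apply/allP => z; exact: H2.
move=> [_ oy /allP zs0 _ _]; split; last by [].
move=> i j ij; rewrite -!nth_entries.
by apply: (sorted_leq_nth le_trans le_refl 0 oy) => //; rewrite inE size_entries.
Qed.

Lemma ecello_in_cell (D : cfg) : ecello D <-> in_open_cell w (Phi D) (entries D.1) (pts D.2).
Proof.
split.
  move=> [H1 H2]; split; rewrite ?size_entries ?(size_pts D.2) //; last exact: cpoly_Phi.
    apply/(sortedP 0) => i; rewrite size_entries => iw.
    rewrite (nth_entries D.1 (Ordinal (ltnW iw))) (nth_entries D.1 (Ordinal iw)).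
    exact: H1.
  by apply/allP => z; exact: H2.
move=> [_ oy /allP zs0 _ _]; split; last by [].
move=> i j ij; rewrite -!nth_entries.
by apply: (sorted_ltn_nth lt_trans 0 oy) => //; rewrite inE size_entries.
Qed.

Lemma in_cell_config a y zs : size y = size w -> size zs = m ->
  cpoly a = rootpoly (fulldiv w y zs) ->
  exists D : cfg, [/\ Phi D = a, entries D.1 = y & perm_eq (pts D.2) zs].
Proof.
move=> sy szs e; have [r er] := entries_surj sy; have [E eE] := sym_surj szs.
exists (r, E); split => //=; apply/esym/cpoly_inj; rewrite cpoly_Phi e er /=.
apply: perm_rootpoly; rewrite /fulldiv perm_cat2l; apply: perm_cat.
  by rewrite perm_sym.
by apply: perm_map; rewrite perm_sym.
Qed.

Lemma Phi_ecellP a : (@Phi R d w @` @ecell R d w) a <-> exists y zs, in_cell w a y zs.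
Proof.
split; first by move=> [D /ecell_in_cell hD <-]; exists (entries D.1), (pts D.2).
move=> [y [zs [sy oy zs0 szs e]]].
have [D [ePhi ey ez]] := in_cell_config sy szs e; exists D => //.
apply/ecell_in_cell; split; rewrite ?size_entries ?(size_pts D.2) ?ey //.
  by rewrite (perm_all _ ez).
by rewrite -[in RHS]ey; exact: cpoly_Phi.
Qed.

Lemma Phi_ecelloP a : (@Phi R d w @` @ecello R d w) a <-> exists y zs, in_open_cell w a y zs.
Proof.
split; first by move=> [D /ecello_in_cell hD <-]; exists (entries D.1), (pts D.2).
move=> [y [zs [sy oy zs0 szs e]]].
have [D [ePhi ey ez]] := in_cell_config sy szs e; exists D => //.
apply/ecello_in_cell; split; rewrite ?size_entries ?(size_pts D.2) ?ey //.
  by rewrite (perm_all _ ez).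
by rewrite -[in RHS]ey; exact: cpoly_Phi.
Qed.

Lemma stratumP (a : 'rV[R]_d) : stratum w a <-> exists y zs, in_open_cell w a y zs.
Proof.
have [Ow _ _] := hw; split=> [e|[y [zs h]]].
  by have [_] := stratum_in_open_cell a; rewrite (e : comb_type _ = w).
by have [] := in_open_cell_rootsR Ow h.
Qed.

Lemma Phi_ecello : @Phi R d w @` @ecello R d w = @stratum R d w.
Proof. by apply/seteqP; split => a; rewrite (propext (Phi_ecelloP a)) (propext (stratumP a)). Qed.

Lemma Phi_ecell : @Phi R d w @` @ecell R d w =
  \bigcup_(v in [set v | Omega_le d v /\ succeq w v]) @stratum R d v.
Proof.
apply/seteqP; split => a; rewrite (propext (Phi_ecellP a)).
  move=> [y [zs hc]]; exists (comb_type (monic_of a)) => //; split.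
    by have [] := stratum_in_open_cell a.
  by have [] := in_cell_type hw hc.
move=> [v [hv sv] e]; have [_ [y [zs ho]]] := stratum_in_open_cell a.
rewrite (e : comb_type _ = v) in ho.
exact: in_cell_succeq sv hw hv (in_open_cellW ho).
Qed.

(** A point of the boundary is sent to a stratum of strictly larger codimension, so the open cell is
    the full preimage of its stratum. *)
Lemma ecell_open_of_stratum (D : cfg) : ecell D -> stratum w (Phi D) -> ecello D.
Proof.
move=> /ecell_in_cell hc e; apply/ecello_in_cell.
have [_ [//|]] := in_cell_type hw hc.
by rewrite (e : comb_type _ = w) ltnn.
Qed.

Lemma Phi_boundary (D : cfg) : ecell D -> ~ ecello D ->
  let v := comb_type (monic_of (Phi D)) in
  [/\ Omega_le d v, succeq w v & (rnorm w < rnorm v)%N].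
Proof.
move=> /ecell_in_cell hc nD v; have [sv [h|rv] _] := in_cell_type hw hc.
  by case: nD; apply/ecello_in_cell.
by split => //; have [] := stratum_in_open_cell (Phi D).
Qed.

Lemma Phi_inj (D D' : cfg) : ecello D -> ecello D' -> Phi D = Phi D' -> D = D'.
Proof.
have [Ow _ _] := hw.
move=> /ecello_in_cell h1 /ecello_in_cell h2 e.
have [y1 _] := in_open_cell_rootsR Ow h1; have [y2 _] := in_open_cell_rootsR Ow h2.
have ey : entries D.1 = entries D'.1 by rewrite -y1 -y2 e.
have [_ _ z1 _ e1] := h1; have [_ _ z2 _ e2] := h2.
have pe : perm_eq (fulldiv w (entries D.1) (pts D.2)) (fulldiv w (entries D'.1) (pts D'.2)).
  by apply: rootpoly_inj; rewrite -e1 -e2 e.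
have ez : D.2 = D'.2.
  apply: sym_ext; rewrite -(count_upper w (entries D.1) z1) -(count_upper w (entries D'.1) z2).
  exact: perm_filter.
case: D D' ey ez {h1 h2 y1 y2 e z1 z2 e1 e2 pe} => [y E] [y' E'] /= ey ->; congr pair.
by apply/rowP => i; rewrite -!nth_entries ey.
Qed.

End PhiImages.

(** * The cell complex of strata *)

Lemma hausdorff_subspaceW (X : topologicalType) (Z : set X) :
  hausdorff_space X -> hausdorff_space (subspace Z).
Proof.
move=> hX p q H; apply: hX => A B nA nB; apply: H.
  by have /= := @continuous_subspaceT _ _ Z id (fun x => @cvg_id _ (nbhs x)) p A nA.
by have /= := @continuous_subspaceT _ _ Z id (fun x => @cvg_id _ (nbhs x)) q B nB.
Qed.

(** Entries are positive with sum at most [d], so both the length and the entries fit in ['I_d.+1];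
    [F] decodes such data. *)
Lemma finite_Omega_le d : finite_set (Omega_le d).
Proof.
pose F (u : 'I_d.+1 * {ffun 'I_d.+1 -> 'I_d.+1}) : seq nat :=
  mkseq (fun i => val (u.2 (inord i))) u.1.
apply: (@sub_finite_set _ _ (F @` [set: 'I_d.+1 * {ffun 'I_d.+1 -> 'I_d.+1}])); last first.
  by apply: finite_image; exact: finite_finset.
move=> w [Ow le _]; have sw : (size w < d.+1)%N.
  by rewrite ltnS; apply: leq_trans (size_le_sumn Ow) le.
exists (Ordinal sw, [ffun i : 'I_d.+1 => inord (nth 0%N w i)]) => //.
apply: (@eq_from_nth _ 0%N); rewrite size_mkseq // => i iw.
rewrite nth_mkseq // ffunE /= !inordK //; first by apply: ltn_trans iw sw.
rewrite ltnS; apply: leq_trans le.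
have := mem_nth 0%N iw; elim: (w) (nth 0%N w i) => //= a l IH x.
  by rewrite in_cons => /predU1P [->|/IH]; lia.
by apply: ltn_trans iw sw.
Qed.

(** * Continuity, properness and closures of strata *)

Section PhiTopology.
Variables (R : realType) (d : nat) (w : seq nat).
Hypothesis hw : Omega_le d w.
Hypothesis d0 : (0 < d)%N.
Local Notation Cx := (C R).
Local Notation m := (npairs d w).
Local Notation p := (size w).
Local Notation cfg := (cell_space R d w).
Local Notation Phi := (@Phi R d w).
Local Notation ecell := (@ecell R d w).
Local Notation ecello := (@ecello R d w).

Lemma Phi_continuous : continuous Phi.
Proof.
apply: cts_all => D; apply: (@cts_config R p m) => y z; apply: cts_mx => i j.
(* The divisor is written as a fixed list of continuous functions of a representative, each real
   point repeated according to its multiplicity. *)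
pose g (i : 'I_p + ('I_m + 'I_m)) (u : 'rV[R]_p * 'rV[Cx]_m) : Cx := match i with
  | inl i => (u.1 0 i)%:C%C
  | inr (inl k) => u.2 0 k
  | inr (inr k) => conjc (u.2 0 k) end.
pose rl : seq 'I_p := flatten [seq nseq (nth 0%N w i) i | i : 'I_p].
pose L : seq ('I_p + ('I_m + 'I_m)) :=
  map inl rl ++ map (fun k => inr (inl k)) (enum 'I_m) ++ map (fun k => inr (inr k)) (enum 'I_m).
have gc k : cts_at (g k) (y, z).
  case: k => [k|[k|k]].
  - exact: (cts_real_complex (cts_coord 0 k (cts_fst (cts_id (y, z))))).
  - exact: (cts_coord 0 k (cts_snd (cts_id (y, z)))).
  - exact: (cts_conjc (cts_coord 0 k (cts_snd (cts_id (y, z))))).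
apply: (cts_ext (cts_Re (cts_rootpoly L j gc))) => u.
rewrite mxE; congr (complex.Re (polyseq _)`_j).
rewrite -(big_map (fun k => g k u) xpredT (fun c => 'X - c%:P)) -!/(rootpoly _).
apply: perm_rootpoly; rewrite /L !map_cat -(map_comp _ inl).
rewrite -(map_comp _ (fun k => inr (inl k))) -(map_comp _ (fun k => inr (inr k))) /total_div /=.
apply: perm_cat.
  have -> : rdiv u.1 = [seq ((g^~ u) \o inl) i | i <- rl]; last exact: perm_refl.
  rewrite /rdiv /rl map_flatten; congr flatten; rewrite -[RHS]map_comp.
  by apply: eq_map => k; rewrite /= map_nseq.
apply: perm_cat; rewrite perm_sym; first exact: pts_to_sym.
apply: perm_trans (perm_map _ (pts_to_sym _)) _.
by rewrite map_entries; exact: perm_refl.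
Qed.

Lemma Phi_proper (M : R) : exists2 K : set cfg, compact K &
  forall D, dot (Phi D) (Phi D) <= M -> K D.
Proof.
(* The coefficients are at most [1 + M] in absolute value, and [root_bound] applies in degree
   [d]. *)
have [K cK HK] := compact_config p m (1 + d%:R * (1 + M)).
exists K => // D H.
have M0 : 0 <= M by apply: le_trans H; exact: dot_ge0.
have e := cpoly_Phi hw D; rewrite -total_divE in e.
have B z : z \in total_div D -> cabs z <= 1 + d%:R * (1 + M).
  move=> zD; rewrite -[in X in _ <= X](size_total_div hw D); apply: root_bound zD; first lra.
  rewrite (size_total_div hw D) => k kd; rewrite -e coef_map.
  rewrite -[k]/(nat_of_ord (Ordinal kd)) coef_monic_of cabs_real; exact: le_norm_dot.
apply: HK => [i|z zD]; last by apply: B; rewrite !mem_cat zD orbT.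
rewrite -cabs_real; apply: B; rewrite mem_cat; apply/orP; left.
by apply/(mem_rdiv hw); exists i.
Qed.

Lemma closed_ecell : closed ecell.
Proof. by rewrite ecellE; exact: closed_scell. Qed.

Lemma ecello_sub : ecello `<=` ecell.
Proof. by rewrite ecellE ecelloE; exact: scello_sub. Qed.

Lemma Phi_closed (F : set cfg) : closed F -> closed (Phi @` (ecell `&` F)).
Proof.
move=> cF; apply: closed_image_rV.
- by apply: continuous_subspaceT; exact: Phi_continuous.
- by apply: closedI => //; exact: closed_ecell.
- by move=> M; have [K cK HK] := Phi_proper M; exists K => // D _; exact: HK.
Qed.

Lemma ecello_saturated : ecello = ecell `&` Phi @^-1` @stratum R d w.
Proof.
apply/seteqP; split => D.
  move=> h; split; first exact: ecello_sub.
  by rewrite /preimage -Phi_ecello //; exists D.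
by move=> [h1 h2]; exact: ecell_open_of_stratum.
Qed.

Lemma Phi_homeo : homeo_on ecello (@stratum R d w) Phi.
Proof.
apply: (@homeo_on_saturated cfg 'rV[R]_d ((0, to_sym 0) : cfg) Phi ecell ecello (@stratum R d w)).
- by apply: continuous_subspaceT; exact: Phi_continuous.
- exact: Phi_closed.
- exact: ecello_saturated.
- exact: Phi_inj.
- by rewrite -Phi_ecello //; apply: image_subset; exact: ecello_sub.
Qed.

(** The image of the closed cell is closed. Conversely, raising a point of the closed cell by any
    [s > 0] makes all walls positive, and letting [s] tend to 0 approximates it from the open cell.
    For [[:: d]] the two cells coincide. *)
Lemma closure_stratum : closure (@stratum R d w) = Phi @` ecell.
Proof.
apply/seteqP; split.
  have cl : closed (Phi @` ecell) by rewrite -[ecell]setIT; apply: Phi_closed; exact: closedT.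
  rewrite closureE; apply: smallest_sub => //.
  by rewrite -Phi_ecello //; apply: image_subset; exact: ecello_sub.
move=> _ [D eD <-].
have [wd|wd] := pselect (w = [:: d]).
  apply: subset_closure; rewrite -Phi_ecello //; exists D => //.
  have [p1 m0] := single_type wd; rewrite ecelloE.
  by have [_ ->] := scell_single R p1 m0.
have n0 := nwalls_gt0 hw d0 wd.
move=> U nU.
pose wt (i : 'I_p) := nth 0%N w i.
pose f (s : R) : 'rV[R]_d := Phi (raise wt s (D : config R p m)).
have fc : cts_at f 0.
  have c : cts_at (fun s : R => raise wt s (D : config R p m)) 0.
    exact: cts_raise (cts_id _) (cts_cst _ _).
  exact: cts_comp c (cts_each _ Phi_continuous).
have f0 : f 0 = Phi D by rewrite /f raise0.
case: fc => fc; rewrite -f0 in nU; have := fc U nU => /nbhs_ballP [e /= e0 be].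
exists (f (e / 2)); split; last first.
  by apply: be; rewrite -ball_normE /= sub0r normrN gtr0_norm; lra.
rewrite -Phi_ecello //; exists (raise wt (e / 2) (D : config R p m)) => //.
rewrite ecelloE; apply/scello_slack => //; rewrite slack_raise //.
by move: eD; rewrite ecellE => /scell_slack ?; lra.
Qed.

End PhiTopology.

Section CellComplex.
Variables (R : realType) (d : nat).
Hypothesis d0 : (0 < d)%N.

Lemma stratum_disjoint (v u : seq nat) (a : 'rV[R]_d) : stratum v a -> stratum u a -> v = u.
Proof. by rewrite /stratum /= => -> ->. Qed.

Lemma closed_stratum_single : Omega_le d [:: d] -> closed (@stratum R d [:: d]).
Proof.
move=> hd; rewrite -Phi_ecello //.
have [p1 m0] := single_type (erefl [:: d]).
have -> : @ecello R d [:: d] = @ecell R d [:: d].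
  by rewrite ecelloE ecellE; have [-> ->] := scell_single R p1 m0.
by rewrite -[ecell (w:=_)]setIT; apply: Phi_closed => //; exact: closedT.
Qed.

(** Formulated for any family of types stable under degeneration, so that it covers both the closure
    of one stratum and the whole coefficient space. *)
Lemma strata_complex (K : set (seq nat)) : K `<=` Omega_le d ->
  (forall v u, K v -> succeq v u -> Omega_le d u -> K u) ->
  cell_complex R (\bigcup_(v in K) @stratum R d v) K
    (@stratum R d) (fun v => (d - rnorm v)%N) (@ecell R d) (@ecello R d) (@Phi R d).
Proof.
move=> KO Kd; set Z := \bigcup_(v in K) _.
have fK : finite_set K := sub_finite_set KO (@finite_Omega_le d).
split.
- apply: hausdorff_subspaceW; exact: hausdorff_rV.
- split => //; apply/trivIsetP => v u _ _ /eqP vu; apply/seteqP; split => // a [va ua].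
  by apply: vu; exact: stratum_disjoint va ua.
- move=> v Kv; have hv := KO v Kv.
  case: (ecell_pair R hv d0) => [h|h|[h e]]; [exact: Or31|exact: Or32|].
  apply: Or33; split => //; apply: closed_subspaceW.
  by rewrite e; apply: closed_stratum_single; rewrite -e.
- move=> v Kv; have hv := KO v Kv; split.
  + by apply: continuous_subspaceT; exact: Phi_continuous.
  + rewrite Phi_ecell // => a [u [hu su] ua]; exists u => //; exact: Kd Kv su hu.
  + exact: Phi_homeo.
  + exists [set u | K u /\ (d - rnorm u < d - rnorm v)%N]; split.
    * by apply: sub_finite_set fK => u [].
    * by move=> u [].
    * by move=> u [].
    * move=> _ [D [eD nD] <-]; have [hu su ru] := Phi_boundary hv eD nD.
      exists (comb_type (monic_of (Phi D))) => //; split; first exact: Kd Kv su hu.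
      (* Subtraction is truncated, so the strict drop of dimension also needs that the codimension
         of the smaller stratum is at most [d]. *)
      have [Ou le _] := hu; have := rnorm_sumn Ou; lia.
- move=> Y YZ H; apply: closed_subspaceW.
  (* Open cells already cover, so [Y] is a finite union of images of closed sets under closed
     maps. *)
  have -> : Y = \bigcup_(v in K) (@Phi R d v @` (@ecell R d v `&` @Phi R d v @^-1` Y)).
    apply/seteqP; split => [a Ya|a [v Kv [D [_ YD] <-]] //].
    have [v Kv va] := YZ _ Ya; exists v => //.
    move: va; rewrite -(Phi_ecello R (KO v Kv)) => -[D eD ea]; exists D => //.
    by split; [exact: ecello_sub|rewrite /preimage /= ea].
  apply: closed_bigcup => // v Kv.
  have := H v Kv; rewrite closed_inE; [|exact: closed_ecell|by move=> ? []].
  by move=> c; rewrite -(setIidr (@subIsetl _ (@ecell R d v) (@Phi R d v @^-1` Y))); apply: Phi_closed => //; exact: KO.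
Qed.

Lemma closure_complex (w : seq nat) : Omega_le d w ->
  cell_complex R (closure (@stratum R d w)) [set v | Omega_le d v /\ succeq w v]
    (@stratum R d) (fun v => (d - rnorm v)%N) (@ecell R d) (@ecello R d) (@Phi R d).
Proof.
move=> hw; rewrite closure_stratum // Phi_ecell //; apply: strata_complex.
  by move=> v [].
by move=> v u [hv sv] su hu; split => //; exact: rt_trans sv su.
Qed.

Lemma bigcup_strata : \bigcup_(v in Omega_le d) @stratum R d v = [set: 'rV[R]_d].
Proof.
apply/seteqP; split => // a _; exists (comb_type (monic_of a)) => //.
by have [] := stratum_in_open_cell a.
Qed.

Lemma space_complex :
  cell_complex R [set: 'rV[R]_d] (Omega_le d)
    (@stratum R d) (fun v => (d - rnorm v)%N) (@ecell R d) (@ecello R d) (@Phi R d).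
Proof. by rewrite -bigcup_strata; exact: strata_complex. Qed.

Lemma attaching_maps (v : seq nat) : Omega_le d v ->
  @Phi R d v @` (@ecell R d v `\` @ecello R d v) `<=` closure (@stratum R d v) `\` @stratum R d v.
Proof.
move=> hv _ [D [eD nD] <-]; split; first by rewrite closure_stratum //; exists D.
by move=> /(ecell_open_of_stratum hv eD).
Qed.

End CellComplex.

(** * The flow *)

Section WeightedScaling.
Variables (R : realType) (d : nat).
Local Notation Cx := (C R).
Implicit Types (x y : 'rV[R]_d) (s t : R).

(* The effect on coefficients of multiplying all roots by [t]. *)
Definition wscale t x : 'rV[R]_d := \row_i (t ^+ (d - i) * x 0 i).

Lemma wscale1 x : wscale 1 x = x.
Proof. by apply/rowP => i; rewrite mxE expr1n mul1r. Qed.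

Lemma wscaleA s t x : wscale s (wscale t x) = wscale (s * t) x.
Proof. by apply/rowP => i; rewrite !mxE exprMn mulrA. Qed.

Lemma wscale0 x : wscale 0 x = 0.
Proof. by apply/rowP => i; rewrite !mxE expr0n subn_eq0 leqNgt ltn_ord mul0r. Qed.

Lemma wscaler0 t : wscale t 0 = 0.
Proof. by apply/rowP => i; rewrite !mxE mulr0. Qed.

Lemma cts_wscale (X : topologicalType) (t : X -> R) (x : X -> 'rV[R]_d) u :
  cts_at t u -> cts_at x u -> cts_at (fun z => wscale (t z) (x z)) u.
Proof.
move=> ct cx; apply: cts_mx => i j.
by apply: (cts_ext (ctsM (ctsX (d - j) ct) (cts_coord 0 j cx))) => z; rewrite mxE.
Qed.

Lemma dot_wscale t x : dot (wscale t x) (wscale t x) =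
  \sum_(i < d) (t ^+ (d - i)) ^+ 2 * x 0 i ^+ 2.
Proof. by rewrite /dot; apply: eq_bigr => i _; rewrite !mxE; ring. Qed.

Lemma dot_sqr x : dot x x = \sum_(i < d) x 0 i ^+ 2.
Proof. by rewrite /dot; apply: eq_bigr => i _; rewrite expr2. Qed.

(** All weights [d - i] are at least 1, so each squared factor is at least [t]. This linear bound
    gives both strict growth along orbits and growth without bound. *)
Lemma dot_wscale_ge t x : 1 <= t -> t * dot x x <= dot (wscale t x) (wscale t x).
Proof.
move=> t1; rewrite dot_wscale dot_sqr mulr_sumr; apply: ler_sum => i _.
rewrite ler_wpM2r ?sqr_ge0 // -exprM; apply: ler_eXnr => //.
by rewrite muln_gt0 subn_gt0 ltn_ord.
Qed.

Lemma dot_wscale_gt t x : 1 < t -> x != 0 -> dot x x < dot (wscale t x) (wscale t x).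
Proof.
move=> t1 x0; apply: lt_le_trans (dot_wscale_ge x (ltW t1)).
by rewrite ltr_pMl // dot_gt0.
Qed.

Lemma wscale_sphere_inj r s t x y : 0 < r -> 0 < s -> 0 < t ->
  sphere r x -> sphere r y -> wscale s x = wscale t y -> s = t /\ x = y.
Proof.
move=> r0 s0 t0 sx sy e.
suff st : s = t.
  split=> //; move: e; rewrite st => /(congr1 (wscale t^-1)).
  by rewrite !wscaleA mulVf ?gt_eqF // !wscale1.
have H a b u v : 0 < a -> 0 < b -> sphere r u -> sphere r v -> wscale a u = wscale b v -> ~ a < b.
  move=> a0 b0 su sv e' ab.
  have : u = wscale (b / a) v.
    by rewrite mulrC -wscaleA -e' wscaleA mulVf ?gt_eqF // wscale1.
  have ba : 1 < b / a by rewrite ltr_pdivlMr // mul1r.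
  move=> eu; have := dot_wscale_gt ba (sphere_neq0 r0 sv).
  by rewrite -eu (su : dot u u = _) (sv : dot v v = _) ltxx.
apply/eqP; rewrite eq_le !leNgt; apply/andP; split; apply/negP.
  exact: H sy sx (esym e).
exact: H sx sy e.
Qed.

Lemma wscale_to_sphere r x : 0 < r -> x != 0 -> exists2 t, 0 < t & sphere r (wscale t x).
Proof.
move=> r0 x0.
have p0 := dot_gt0 x0.
pose f t := dot (wscale t x) (wscale t x).
have q0 : 0 <= r ^+ 2 / dot x x by rewrite divr_ge0 ?sqr_ge0 // ltW.
(* Chosen so that [M * dot x x] exceeds [r ^+ 2]; the orbit then crosses the sphere at some
   parameter in [[0, M]]. *)
pose M := 1 + r ^+ 2 / dot x x.
have M1 : 1 <= M by rewrite lerDl.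
have fM : r ^+ 2 <= f M.
  apply: le_trans (dot_wscale_ge x M1); rewrite -ler_pdivrMr // /M lerDr //.
have f0 : f 0 = 0 by rewrite /f wscale0 dot0l.
have [] := @IVT R f 0 M (r ^+ 2).
- exact: le_trans M1.
- apply: cts_within => t _; apply: cts_dot; exact: cts_wscale (cts_id t) (cts_cst x t).
- by rewrite f0 minEle maxEle (le_trans (sqr_ge0 r) fM) sqr_ge0 fM.
move=> t; rewrite in_itv /= => /andP [t0 _] ft; exists t => //.
rewrite lt_neqAle t0 andbT; apply/eqP => t00; move: ft; rewrite -t00 f0 => /eqP.
by rewrite eq_sym expf_eq0 gt_eqF.
Qed.

Lemma cpoly_wscale (a : 'rV[R]_d) (s : seq Cx) t : size s = d -> cpoly a = rootpoly s ->
  cpoly (wscale t a) = rootpoly [seq (t%:C%C : Cx) * z | z <- s].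
Proof.
move=> sd e; apply/polyP => k; rewrite coef_map.
have [kd|] := ltnP k d.
  rewrite rootpoly_scale ?sd ?(ltnW kd) // -e coef_map -[k]/(nat_of_ord (Ordinal kd)) !coef_monic_of mxE.
  rewrite -[(t%:C%C : Cx)]/(real_complex R t) -(rmorphXn (real_complex R)).
  exact: (rmorphM (real_complex R)).
rewrite leq_eqVlt => /predU1P [<-|dk].
  have := monicP (monic_of_monic (wscale t a)); rewrite lead_coefE size_monic_of /= => ->.
  have := monicP (monic_rootpoly [seq (t%:C%C : Cx) * z | z <- s]).
  by rewrite lead_coefE size_rootpoly size_map sd /= => ->.
by rewrite !nth_default ?size_rootpoly ?size_map ?sd // size_monic_of.
Qed.

Definition flow t : 'rV[R]_d -> 'rV[R]_d := wscale (expR t).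

Lemma is_derive_coord (k : nat) (c : R) : is_derive (0 : R) 1 (fun t : R => expR t ^+ k * c) (k%:R * c).
Proof.
have h1 := is_deriveX k (is_derive_expR (0 : R)).
have h2 := is_deriveM h1 (is_derive_cst c (0 : R) 1).
rewrite (_ : (fun t => _) = (expR ^+ k * cst c)%R); last by apply/funext => t; rewrite !fctE.
apply: is_derive_eq h2 _.
rewrite scaler0 add0r expR0 expr1n mulr1 -[LHS]/(c * (k%:R * 1)) mulr1.
exact: mulrC.
Qed.

Lemma flow_velocityE x : flow_velocity flow x = \row_(i < d) ((d - i)%:R * x 0 i).
Proof.
rewrite /flow_velocity /derive1; apply: cvg_lim; first exact: norm_hausdorff.
apply: cvg_mxP => i j; rewrite mxE.
have [h1 h2] := is_derive_coord (d - j) (x 0 j).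
rewrite -h2.
rewrite [X in X @ _ --> _](_ : _ = (fun h : R => h^-1 *: ((fun t : R => expR t ^+ (d - j) * x 0 j) (h *: 1 + 0) - (expR 0 ^+ (d - j) * x 0 j)))).
  exact: h1.
by apply/funext => h; rewrite !mxE -[h *: 1]/(h * 1) mulr1.
Qed.

Lemma is_flow_flow : is_flow flow.
Proof.
split.
- by move=> x; rewrite /flow expR0 wscale1.
- by move=> s t x; rewrite /flow expRD wscaleA.
- apply: cts_all => u; apply: cts_wscale; last exact: (cts_snd (cts_id u)).
  by apply: (cts_comp (cts_fst (cts_id u))); apply: cts_each; exact: continuous_expR.
- move=> x; apply/derivable_mxP => i j.
  have [h _] := is_derive_coord (d - j) (x 0 j).
  rewrite (_ : (fun t => _) = (fun t : R => expR t ^+ (d - j) * x 0 j)) //.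
  by apply/funext => t; rewrite mxE.
- apply: cts_all => x; apply: (@cts_ext _ _ (fun x : 'rV[R]_d => \row_(i < d) ((d - i)%:R * x 0 i))); last first.
    by move=> y; rewrite flow_velocityE.
  apply: cts_mx => i j.
  have c : cts_at (fun y : 'rV[R]_d => (d - j)%:R * y 0 j) x.
    exact: ctsM (cts_cst ((d - j)%:R : R) x) (cts_coord 0 j (cts_id x)).
  by apply: (cts_ext c) => y; rewrite mxE.
Qed.

Lemma flow_stationary x : stationary flow x <-> x = 0.
Proof.
split=> [H|-> t]; last exact: wscaler0.
apply/rowP => i; have := congr1 (fun y : 'rV[R]_d => y 0 i) (H (ln 2)).
rewrite !mxE lnK ?posrE // => /eqP; rewrite -subr_eq0 -{2}[x 0 i]mul1r -mulrBl mulf_eq0.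
case/orP => [|/eqP //]; rewrite subr_eq0 => /eqP e.
have : 1 < 2 ^+ (d - i) :> R by rewrite exprn_egt1 // ?ltr1n // -lt0n subn_gt0.
by rewrite e ltxx.
Qed.

Lemma flow_source : is_source flow 0.
Proof.
split.
  (* In negative time every coordinate is multiplied by a factor in [[0, 1]], so balls of the
     maximum norm are themselves invariant. *)
  move=> U /nbhs_ballP [e /= e0 be]; exists (ball 0 e); first exact: nbhsx_ballx.
  move=> x t [_ bx] t0; apply: be; split=> // i j; have := bx i j.
  rewrite -!ball_normE /= !mxE !sub0r !normrN ord1; apply: le_lt_trans.
  rewrite normrM ler_piMl // ger0_norm ?exprn_ge0 ?expR_ge0 //.
  by rewrite exprn_ile1 ?expR_ge0 // -expR0 ler_expR.
near=> x.
have e0 : (expR t : R) @[t --> -oo] --> (0 : R).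
  apply/cvgrPdist_lt => e e0; near=> t.
  rewrite sub0r normrN ger0_norm ?expR_ge0 // -[e]lnK ?posrE // ltr_expR.
  by near: t; exact: nbhs_ninfty_lt (num_real _).
have [c] := cts_wscale (cts_id (0 : R)) (cts_cst x (0 : R)).
rewrite -[X in _ --> X](wscale0 x).
exact: cvg_comp e0 c.
Unshelve. all: by end_near. Qed.

(** The velocity has coordinates [(d - i) * x_i] with [d - i >= 1], so its scalar product with [x]
    is at least [dot x x]. *)
Lemma flow_transversal r : 0 < r -> transversal_to_sphere flow r.
Proof.
move=> r0 x sx; rewrite flow_velocityE gt_eqF //.
apply: lt_le_trans (_ : dot x x <= _); first by rewrite (sx : dot x x = _) exprn_gt0.
rewrite dot_sqr /dot; apply: ler_sum => i _; rewrite mxE -mulrA -expr2.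
by rewrite ler_peMl ?sqr_ge0 // ler1n subn_gt0.
Qed.

Section Strata.
Variable w : seq nat.
Hypothesis hw : Omega_le d w.
Local Notation cfg := (config R (size w) (npairs d w)).

Lemma Phi_dil t (D : cfg) : @Phi R d w (dil t D) = wscale t (@Phi R d w D).
Proof.
apply/cpoly_inj; have e := cpoly_Phi hw D; rewrite -total_divE in e.
rewrite (cpoly_wscale t (size_total_div hw D) e) cpoly_Phi // -total_divE.
apply: perm_rootpoly; rewrite /total_div !map_cat.
apply: perm_cat.
  rewrite !rdivE /realdiv.
  have -> : entries (dil t D).1 = [seq t * u | u <- entries D.1].
    by rewrite /entries /image_mem -[RHS]map_comp; apply: eq_map => i; rewrite /= !mxE addr0.
  elim: (w) (entries D.1) => [|a l IH] [|b y] //=; rewrite map_cat map_nseq /=.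
  rewrite rmorphM /= perm_cat2l; exact: IH.
have p1 : perm_eq (pts (dil t D).2) [seq (t%:C%C : Cx) * z | z <- pts D.2].
  apply: perm_trans (pts_sym_map _ _) _.
  by rewrite (eq_map (g := fun z => (t%:C%C : Cx) * z)) // => z; rewrite addr0.
apply: perm_cat => //.
apply: perm_trans (perm_map _ p1) _; move: (pts D.2) => l; rewrite -!map_comp.
rewrite (eq_map (g := (fun z => (t%:C%C : Cx) * z) \o (@conjc R))) // => -[p q] /=.
by apply/eqP; rewrite eq_complex /=; apply/andP; split; apply/eqP; ring.
Qed.

Lemma stratum_wscale t a : 0 < t -> stratum w a -> stratum w (wscale t a).
Proof.
move=> t0; rewrite -(Phi_ecello R hw) => -[D eD <-].
exists (dil t (D : cfg)); last exact: Phi_dil.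
by move: eD; rewrite ecelloE; exact: scello_dil.
Qed.

Lemma flow_stratum t : flow t @` stratum w = stratum w.
Proof.
apply/seteqP; split => [_ [a wa <-]|a wa]; first exact: stratum_wscale (expR_gt0 _) wa.
exists (flow (- t) a); first exact: stratum_wscale (expR_gt0 _) wa.
by rewrite /flow wscaleA -expRD subrr expR0 wscale1.
Qed.

End Strata.

End WeightedScaling.

(** * The induced complex on spheres *)

Section RadialProjection.
Variables (R : realType) (d : nat) (r : R).
Hypothesis r0 : 0 < r.
Local Notation S := (@sphere R d r).
Implicit Types (x y : 'rV[R]_d) (t : R).

(** The cone parameter is the exponential of time, so that the apex is reached at time minus
    infinity. On nonnegative parameters the map is just [wscale], without a case distinction. *)
Definition cone_param (p : R * 'rV[R]_d) : 'rV[R]_d :=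
  if p.1 == 0 then 0 else flow (ln p.1) p.2.

Lemma cone_paramE t x : 0 <= t -> cone_param (t, x) = wscale t x.
Proof.
rewrite /cone_param /= le_eqVlt => /predU1P [<-|t0]; first by rewrite eqxx wscale0.
by rewrite gt_eqF // /flow lnK.
Qed.

Lemma wscale_eq0 t x : 0 < t -> wscale t x = 0 -> x = 0.
Proof.
move=> t0 /(congr1 (wscale t^-1)).
by rewrite wscaleA mulVf ?gt_eqF // wscale1 wscaler0.
Qed.

Lemma compact_sphere : compact S.
Proof.
apply: (@subclosed_compact _ _ [set x : 'rV[R]_d | dot x x <= r ^+ 2]).
- rewrite (_ : S = (fun x => dot x x) @^-1` [set r ^+ 2]) //.
  apply: preimage_closed; last exact: closed_eq.
  by move=> x _; have [] := cts_dot (cts_id x).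
- exact: compact_dot.
- by move=> x; rewrite /sphere /= => ->.
Qed.

Lemma cone_sphere : cone_map [set: 'rV[R]_d] S 0 cone_param.
Proof.
have c : {within [set t : R | 0 <= t] `*` S, continuous cone_param}.
  apply: (@subspace_eq_continuous _ _ _ (fun p => wscale p.1 p.2)).
    by move=> [t x] /set_mem [/= t0 _]; rewrite -[RHS]/(cone_param (t, x)) cone_paramE.
  apply: cts_within => u _.
  exact: cts_wscale (cts_fst (cts_id u)) (cts_snd (cts_id u)).
(* For [t >= 1] the growth estimate gives [t * r^2 <= |wscale t x|^2] on the sphere; the summand 1
   covers [t <= 1]. *)
apply: (@cone_mapI R _ _ _ _ _ _ (fun x => 1 + dot x x / r ^+ 2)) => //.
- exact: compact_sphere.
- apply: cts_all => x; apply: ctsD; first exact: cts_cst.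
  by apply: ctsM; [exact: cts_dot (cts_id x)|exact: cts_cst].
- move=> t x t0 Sx; split => //; rewrite cone_paramE //.
  have [t1|/ltW t1] := leP t 1.
    by apply: le_trans t1 _; rewrite lerDl divr_ge0 ?dot_ge0 // sqr_ge0.
  apply: (@le_trans _ _ (dot (wscale t x) (wscale t x) / r ^+ 2)); last by rewrite lerDr.
  rewrite ler_pdivlMr ?exprn_gt0 // -(Sx : dot x x = _).
  exact: dot_wscale_ge.
- by move=> x _; rewrite /cone_param /= eqxx.
- move=> t x t0 /(sphere_neq0 r0) /eqP x0; rewrite cone_paramE ?ltW // => /(wscale_eq0 t0).
  by [].
- move=> t x t' x' t0 Sx t0' Sx'; rewrite !cone_paramE ?ltW // => e.
  by have [-> ->] := wscale_sphere_inj r0 t0 t0' Sx Sx' e.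
- move=> x _ /eqP x0; have [t t0 St] := wscale_to_sphere r0 x0.
  exists t^-1, (wscale t x); split => //; first by rewrite invr_gt0.
  by rewrite cone_paramE ?invr_ge0 ?ltW // wscaleA mulVf ?gt_eqF // wscale1.
Qed.

Definition radial_proj x : 'rV[R]_d :=
  xget 0 [set y | S y /\ exists2 t, 0 < t & x = wscale t y].

Lemma radial_projP x : x <> 0 ->
  S (radial_proj x) /\ exists2 t, 0 < t & x = wscale t (radial_proj x).
Proof.
move=> /eqP x0; rewrite /radial_proj; case: xgetP => [y -> //|H].
have [t t0 St] := wscale_to_sphere r0 x0; case: (H (wscale t x)); split => //.
exists t^-1; first by rewrite invr_gt0.
by rewrite wscaleA mulVf ?gt_eqF // wscale1.
Qed.

Lemma radial_proj_wscale t y : 0 < t -> S y -> radial_proj (wscale t y) = y.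
Proof.
move=> t0 Sy; have n0 : wscale t y <> 0.
  by move=> /(wscale_eq0 t0) y0; have := sphere_neq0 r0 Sy; rewrite y0 eqxx.
have [Sr [s s0 e]] := radial_projP n0.
by have [_ <-] := wscale_sphere_inj r0 t0 s0 Sy Sr e.
Qed.

(** By the quotient topology of the cone, closedness can be checked on the product of [[0, oo)] with
    the sphere, where the projection becomes the second coordinate. The origin is added to [W]
    because the whole slice at parameter 0 lies over it. *)
Lemma radial_proj_continuous : {within [set x | x <> 0], continuous radial_proj}.
Proof.
apply: continuous_within => F cF.
pose W := 0 |` [set x | x <> 0 /\ F (radial_proj x)].
have [_ _ _ cone] := cone_sphere.
exists W; last first.
  apply/seteqP; split => x; first by move=> [x0 Fx]; split => //; right.
  by move=> [x0 [//|[_ Fx]]].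
rewrite -(closed_inE closedT (@subsetT _ W)).
apply/(cone W (@subsetT _ W)).
have closedC : closed ([set t : R | 0 <= t] `*` S).
  have -> : [set t : R | 0 <= t] `*` S = (fst @^-1` [set t | 0 <= t]) `&` (snd @^-1` S) by [].
  apply: closedI.
    by apply: preimage_closed; [move=> x _; exact: cvg_fst|exact: closed_ge].
  apply: preimage_closed; [by move=> x _; exact: cvg_snd|].
  by apply: compact_closed compact_sphere; exact: hausdorff_rV.
rewrite (closed_inE closedC (@subIsetl _ _ _)).
rewrite (_ : _ `&` _ = ([set t : R | 0 <= t] `*` S) `&`
    ((fst @^-1` [set (0 : R)]) `|` (snd @^-1` F))).
  apply: closedI => //; apply: closedU.
    by apply: preimage_closed; [move=> x _; exact: cvg_fst|exact: closed_eq].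
  by apply: preimage_closed => // x _; exact: cvg_snd.
apply/seteqP; split => -[t x] [[/= t0 Sx]]; rewrite /preimage /= cone_paramE //.
  move=> Wx; split => //; have [t00|/eqP tn0] := pselect (t = 0); first by left.
  have tp : 0 < t by rewrite lt_neqAle eq_sym tn0.
  case: Wx => [/(wscale_eq0 tp) x0|[_]]; first by have := sphere_neq0 r0 Sx; rewrite x0 eqxx.
  by rewrite radial_proj_wscale //; right.
move=> h; split => //; have [t00|/eqP tn0] := pselect (t = 0).
  by left; rewrite t00 wscale0.
have tp : 0 < t by rewrite lt_neqAle eq_sym tn0.
right; split; last by rewrite radial_proj_wscale //; case: h => // /eqP; rewrite (negPf tn0).
by move=> /(wscale_eq0 tp) x0; have := sphere_neq0 r0 Sx; rewrite x0 eqxx.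
Qed.

Section Stratum.
Variable v : seq nat.
Hypothesis hv : Omega_le d v.

Lemma stratum_radial_proj x : x <> 0 -> stratum v (radial_proj x) <-> stratum v x.
Proof.
move=> x0; have [_ [t t0 e]] := radial_projP x0; split => [h|h].
  by rewrite e; exact: stratum_wscale.
have -> : radial_proj x = wscale t^-1 x by rewrite {2}e wscaleA mulVf ?gt_eqF // wscale1.
by apply: stratum_wscale => //; rewrite invr_gt0.
Qed.

Lemma cone_param_stratum :
  cone_param @` ([set t : R | 0 < t] `*` (stratum v `&` S)) = stratum v `\ 0.
Proof.
apply/seteqP; split => [_ [[t x] [/= t0 [vx Sx]] <-]|x [vx x0]].
  rewrite cone_paramE ?ltW //; split; first exact: stratum_wscale.
  by move=> /(wscale_eq0 t0) e; have := sphere_neq0 r0 Sx; rewrite e eqxx.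
have [Sr [t t0 e]] := radial_projP x0; exists (t, radial_proj x).
  by split => //; split => //; exact/stratum_radial_proj.
by rewrite cone_paramE ?ltW.
Qed.

End Stratum.

End RadialProjection.

Section LinkCell.
Variables (R : realType) (d : nat) (r : R).
Hypothesis r0 : 0 < r.
Hypothesis d0 : (0 < d)%N.
Local Notation S := (@sphere R d r).
Local Notation rho := (radial_proj r).

Section Stratum.
Variable v : seq nat.
Hypothesis hv : Omega_le d v.
Hypothesis vd : v <> [:: d].
Local Notation cfg := (config R (size v) (npairs d v)).
Local Notation Phi := (@Phi R d v).

Lemma Phi_eq0 (D : cfg) : Phi D = 0 -> radius D = 0.
Proof.
move=> e; have ec := cpoly_Phi hv D; rewrite -total_divE e in ec.
have z0 z : z \in total_div (d := d) D -> z = 0.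
  rewrite -root_prod_XsubC -/(rootpoly _) -ec /cpoly /monic_of linear0 addr0 map_polyXn.
  by rewrite rootE hornerXn expf_eq0 => /andP [_ /eqP].
apply/eqP; rewrite eq_le radius_ge0 andbT; apply/radius_leP => //; split.
  move=> i; have /z0 [->] : ((D.1 0 i)%:C%C : C R) \in total_div (d := d) D.
    by rewrite mem_cat; apply/orP; left; apply/(mem_rdiv hv); exists i.
  by rewrite normr0.
move=> z zD; have /z0 -> : z \in total_div (d := d) D by rewrite !mem_cat zD orbT.
by rewrite (_ : cabs 0 = 0) // (cabs_real 0) normr0.
Qed.

Lemma slink_Phi_neq0 (D : cfg) : slink D -> Phi D <> 0.
Proof. by move=> [_ r1] /Phi_eq0; rewrite (r1 : radius D = 1) => /eqP; rewrite oner_eq0. Qed.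

(** The characteristic map of a spherical cell: identify the closed ball with the link, apply [Phi],
    and project along orbits. Since [Phi] commutes with dilations, the projection respects
    strata. *)
Lemma link_cell : exists (k : nat) (f : cfg -> 'rV[R]_k) (phi : 'rV[R]_k -> 'rV[R]_d),
  [/\ (k = d - rnorm v - 1)%N, homeo_on (@slink R (size v) (npairs d v)) (@cball R k) f,
      {within @cball R k, continuous phi} /\
      (forall x, cball x -> exists2 D, slink D & x = f D),
      homeo_on (@oball R k) (stratum v `&` S) phi &
      forall D, slink D -> [/\ scello D <-> oball (f D), phi (f D) = rho (Phi D) &
        S (rho (Phi D))]].
Proof.
have [k ek] := dim_ge2 hv d0 vd.
have [f [fh fo]] := slink_cball R (wt_gt0 hv) (nwalls_gt0 hv d0 vd) ek.
have [g [fS gS fK gK [cf cg]]] := homeo_onP fh.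
pose phi := rho \o (Phi \o g).
have Pn0 x : cball x -> Phi (g x) <> 0 by move=> /gS; exact: slink_Phi_neq0.
have cphi : {within @cball R k.+1, continuous phi}.
  apply: within_comp (radial_proj_continuous r0) Pn0.
  by apply: within_compl cg _ => x _; exact: Phi_continuous.
exists k.+1, f, phi; split => //.
- by rewrite (dimE hv) ek; lia.
- by split => // x cx; exists (g x); [exact: gS|rewrite gK].
- have oc (x : 'rV[R]_k.+1) : oball x -> cball x by exact: ltW.
  have go x : cball x -> oball x <-> scello (g x).
    by move=> cx; rewrite fo; [rewrite gK|exact: gS].
  apply: (@homeo_on_saturated 'rV[R]_k.+1 'rV[R]_d 0 phi (@cball R k.+1)) => //.
  + move=> F cF; apply: compact_closed_image => //.
    exact: compact_dot.
  + apply/seteqP; split => x.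
      move=> ox; have cx := oc _ ox; split => //; split.
        apply/(stratum_radial_proj r0 hv (Pn0 x cx)).
        by rewrite -(Phi_ecello R hv); exists (g x) => //; rewrite ecelloE; exact/go.
      by have [] := radial_projP r0 (Pn0 x cx).
    move=> [cx [vx Sx]]; apply/go => //; rewrite -ecelloE.
    apply: (ecell_open_of_stratum hv); first by rewrite ecellE; have [] := gS x cx.
    exact/(stratum_radial_proj r0 hv (Pn0 x cx)).
  + move=> x x' ox ox' e; have cx := oc _ ox; have cx' := oc _ ox'.
    have [_ [t t0 et]] := radial_projP r0 (Pn0 x cx).
    have [_ [s s0 es]] := radial_projP r0 (Pn0 x' cx').
    (* Equal projections mean that the polynomials, hence the configurations, differ by a dilation;
       both configurations have radius 1, so its factor is 1. *)
    have e2 : Phi (g x) = Phi (dil (t / s) (g x')).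
      rewrite Phi_dil // es wscaleA divfK ?gt_eqF // et.
      by congr wscale.
    have ts : 0 < t / s by exact: divr_gt0.
    have e3 : g x = dil (t / s) (g x').
      apply: (Phi_inj hv) e2; rewrite ecelloE; first exact/go.
      by apply: scello_dil => //; exact/go.
    have e4 : t / s = 1.
      have := congr1 (fun E => radius E) e3; rewrite radius_dil ?ltW //.
      by have [_ /= ->] := gS x cx; have [_ /= ->] := gS x' cx'; rewrite mulr1.
    by rewrite -(gK x) // -(gK x') // e3 e4 dil1.
  + move=> b [vb Sb]; move: (vb); rewrite -(Phi_ecello R hv) => -[D eD eb].
    have nD : radius D != 0.
      apply/eqP => /radius_eq0 e; move: eb; rewrite e Phi_dil // wscale0 => b0.
      by have := sphere_neq0 r0 Sb; rewrite -b0 eqxx.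
    have pD : 0 < (radius D)^-1 by rewrite invr_gt0 lt_neqAle eq_sym nD radius_ge0.
    (* A preimage of [b] is found by normalizing its configuration to radius 1; the projection takes
       back the change of scale. *)
    have lD : slink (dil (radius D)^-1 D).
      split; last by rewrite /= radius_dil ?ltW // mulVf.
      by apply: scell_dil (ltW pD) _; rewrite -ecellE; exact: ecello_sub.
    exists (f (dil (radius D)^-1 D)); first exact: fS.
    rewrite /phi /= fK // Phi_dil // eb.
    exact: radial_proj_wscale.
- move=> D lD; split; first exact: fo.
  + by rewrite /phi /= fK.
  + by have [] := radial_projP r0 (slink_Phi_neq0 lD).
Qed.

End Stratum.

End LinkCell.

Section SphereComplex.
Variables (R : realType) (d : nat) (r : R).
Hypothesis r0 : 0 < r.
Hypothesis d0 : (0 < d)%N.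
Local Notation S := (@sphere R d r).
Local Notation rho := (radial_proj r).
Implicit Types (x a : 'rV[R]_d) (v : seq nat) (c : set 'rV[R]_d).

Definition root_type x : seq nat := comb_type (monic_of x).

Lemma root_type_le x : Omega_le d (root_type x).
Proof. by have [] := stratum_in_open_cell x. Qed.

(** A canonical cell through each point of the sphere; disjointness and covering both reduce to
    it. *)
Definition cell_at x : set 'rV[R]_d :=
  if root_type x == [:: d] then [set x] else stratum (root_type x) `&` S.

Lemma sphere_cells_at x : S x -> sphere_cells r (cell_at x).
Proof.
move=> Sx; rewrite /cell_at; case: eqP => e; first by right; exists x.
by left; exists (root_type x) => //; split => //; exact: root_type_le.
Qed.

Lemma mem_cell_at x : S x -> cell_at x x.
Proof. by rewrite /cell_at; case: eqP. Qed.

Lemma cell_at_stratum x : cell_at x `<=` stratum (root_type x).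
Proof. by rewrite /cell_at; case: eqP => _ y; [move=> ->|case]. Qed.

Lemma sphere_cellE c x : sphere_cells r c -> c x -> c = cell_at x.
Proof.
rewrite /cell_at => -[[v [hv vd] <-] [vx Sx]|[a [da Sa] <-] ->].
  by rewrite [root_type x]vx; case: eqP.
by rewrite [root_type a]da eqxx.
Qed.

Lemma sphere_cell_sub c : sphere_cells r c -> c `<=` S.
Proof. by move=> [[v _ <-] x []|[a [_ Sa] <-] x ->]. Qed.

(** A polynomial [(z - y)^d] with [y] nonzero is a dilate of [(z - 1)^d] or [(z + 1)^d]; the boolean
    records the sign of [y]. This bounds the number of exceptional cells. *)
Lemma single_stratum_sphere a : stratum [:: d] a -> S a ->
  exists b : bool, a = rho (viete d (nseq d (((-1) ^+ b)%:C%C : C R))).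
Proof.
move=> da Sa; pose c (y : R) := @viete R d (nseq d (y%:C%C : C R)).
have ec y : cpoly (c y) = rootpoly (nseq d (y%:C%C : C R)).
  apply: cpoly_viete; rewrite ?size_nseq // map_nseq /= oppr0.
  exact: perm_refl.
have cs t y : c (t * y) = wscale t (c y).
  apply: cpoly_inj; rewrite (cpoly_wscale t _ (ec y)) ?size_nseq // map_nseq ec.
  by rewrite -[(t%:C%C : C R)]/(real_complex R t) rmorphM.
have hd : Omega_le d [:: d] by rewrite -da; exact: root_type_le.
have [y [zs [sy _ _ szs e]]] := (stratumP hd a).1 da.
case: y sy e => [|y []] // _.
rewrite /npairs /= addn0 subnn in szs; rewrite (size0nil szs) /fulldiv /realdiv /= !cats0 -ec.
move=> /cpoly_inj ea.
have y0 : y != 0.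
  apply/eqP => y0; have := sphere_neq0 r0 Sa.
  by rewrite ea y0 -[0](mul0r 1) cs wscale0 eqxx.
exists (y < 0); rewrite -/(c _).
have -> : c ((-1) ^+ (y < 0)%R) = wscale (`|y|^-1) a.
  by rewrite ea -cs {3}[y]numEsign mulrCA mulVf ?normr_eq0 // mulr1.
by rewrite radial_proj_wscale // invr_gt0 normr_gt0.
Qed.

Lemma finite_sphere_cells : finite_set (@sphere_cells R d r).
Proof.
rewrite finite_setU; split.
  apply: finite_image; apply: sub_finite_set (@finite_Omega_le d).
  by move=> v [].
apply: finite_image.
apply: (@sub_finite_set _ _ ((fun b : bool => rho (viete d (nseq d (((-1) ^+ b)%:C%C : C R)))) @` setT)).
  by move=> a [da Sa]; have [b ->] := single_stratum_sphere da Sa; exists b.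
by apply: finite_image; exact: finite_finset.
Qed.

(* [phi] is a characteristic map of the cell [c], which lies in the stratum [v]. *)
Definition sphere_chart c k (phi : 'rV[R]_k -> 'rV[R]_d) : Prop := exists v,
  [/\ (c !=set0 /\ c `<=` stratum v), (k = d - rnorm v - 1)%N,
    {within @cball R k, continuous phi} /\ (forall y, cball y -> S (phi y)),
    homeo_on (@oball R k) c phi /\
    (forall y, cball y -> ~ oball y -> (d - rnorm (root_type (phi y)) - 1 < k)%N) &
    v <> [:: d] -> exists2 h : cell_space R d v -> 'rV[R]_k,
      homeo_on (@sigma R d v) (@cball R k) h &
      forall D, @sigma R d v D -> exists2 t : R, 0 < t & Phi D = wscale t (phi (h D))].

Lemma sphere_cell_chart c : sphere_cells r c -> exists k phi, @sphere_chart c k phi.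
Proof.
move=> [[v [hv vd] <-]|[a [da Sa] <-]]; last first.
  (* The codimension of [[:: d]] is [d - 1], so the cell has dimension 0, and the ball in dimension
     0 is one point. *)
  exists 0%N, (fun=> a), [:: d]; split => //.
  - by split; [exists a|move=> _ ->].
  - rewrite /rnorm /=; lia.
  - by split => //; apply: continuous_subspaceT; exact: cst_continuous.
  - split.
      apply: (@homeo_onI 'rV[R]_0 'rV[R]_d _ _ _ (fun=> 0)) => //.
      + by move=> _ _; rewrite /oball /= /dot big_ord0.
      + by move=> x _; apply/rowP; case.
      + by apply: continuous_subspaceT; exact: cst_continuous.
      + by apply: continuous_subspaceT; exact: cst_continuous.
    by move=> y _ []; rewrite /oball /= /dot big_ord0.
have [k [f [phi [ek fh [cphi fs] hphi H]]]] := link_cell r0 d0 hv vd.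
have Sphi y : cball y -> S (phi y).
  by move=> /fs [D lD ->]; have [_ -> ?] := H D lD.
have o0 : @oball R k 0 by rewrite /oball /= dot0l.
exists k, phi, v; split => //.
- split; last by move=> x [].
  by exists (phi 0); have [[h _ _] _ _] := hphi; exact: h.
- split => // y cy; have [D lD ->] := fs y cy; have [hD -> _] := H D lD.
  move=> nD; have nD2 : ~ scello D by move=> /hD.
  have eD : @ecell R d v D by rewrite ecellE; have [] := lD.
  have [|hu su ru] := Phi_boundary hv eD; first by rewrite ecelloE.
  have -> : root_type (rho (Phi D)) = root_type (Phi D).
    apply/(stratum_radial_proj r0 (root_type_le (Phi D))) => //.
    exact: (slink_Phi_neq0 hv lD).
  (* The boundary type has positive codimension, so it is not empty and its codimension is at most
     [d - 1]; this keeps the drop strict under truncated subtraction. *)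
  rewrite ek; have [Ou le _] := hu; have := rnorm_sumn Ou; rewrite -/(root_type _).
  move: ru le; rewrite -/(root_type _); case: (root_type _) => [|b u] //= ; lia.
- move=> _; exists f; first by rewrite sigmaE.
  move=> D; rewrite (sigmaE R hv) => lD; have [_ -> _] := H D lD.
  have [_ [t t0 e]] := radial_projP r0 (slink_Phi_neq0 hv lD).
  by exists t.
Qed.

Lemma sphere_complex : exists (dim : set 'rV[R]_d -> nat)
    (phi : forall c, 'rV[R]_(dim c) -> 'rV[R]_d),
  [/\ (forall c v, sphere_cells r c -> Omega_le d v -> c `<=` stratum v ->
         dim c = (d - rnorm v - 1)%N),
      cell_complex R S (@sphere_cells R d r) id dim
        (fun c => @cball R (dim c)) (fun c => @oball R (dim c)) phi &
      forall v, Omega_le d v -> v <> [:: d] ->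
        let c := stratum v `&` S in
        exists2 h : cell_space R d v -> 'rV[R]_(dim c),
          homeo_on (@sigma R d v) (@cball R (dim c)) h &
          forall D, @sigma R d v D ->
            exists2 t : R, 0 < t & Phi D = cone_param (t, phi c (h D))].
Proof.
(* Dimension and characteristic map are chosen together, because the source of the map depends on
   the dimension. *)
have /choice [F FP] (c : set 'rV[R]_d) : exists kp : {k : nat & 'rV[R]_k -> 'rV[R]_d},
    sphere_cells r c -> sphere_chart c (projT2 kp).
  have [cc|nc] := pselect (sphere_cells r c); last first.
    by exists (existT _ 0%N (fun=> 0)).
  by have [k [phi H]] := sphere_cell_chart cc; exists (existT _ k phi).
pose dim c := projT1 (F c).
pose phi c : 'rV[R]_(dim c) -> 'rV[R]_d := projT2 (F c).
(* A cell is nonempty, so the stratum that contains it is unique and the dimension chosen for it is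
   forced. *)
have dimP c v : sphere_cells r c -> Omega_le d v -> c `<=` stratum v -> dim c = (d - rnorm v - 1)%N.
  move=> cc _ cv; have [u [[[x cx] cu] e _ _ _]] := FP c cc.
  by rewrite -(stratum_disjoint (cu x cx) (cv x cx)).
exists dim, phi; split => //; last first.
  move=> v hv vd c.
  have cc : sphere_cells r c by left; exists v.
  have [u [[[x cx] cu] e _ _ H]] := FP c cc.
  have uv : u = v by apply: stratum_disjoint (cu x cx) _; case: cx.
  move: H; rewrite uv => /(_ vd) [h hh hD]; exists h => // D /hD [t t0 ->].
  by exists t => //; rewrite cone_paramE ?ltW.
split.
- by apply: hausdorff_subspaceW; exact: hausdorff_rV.
- split.
    apply/trivIsetP => c c' cc cc' /eqP ne; apply/seteqP; split => // x [cx cx'].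
    by apply: ne; rewrite (sphere_cellE cc cx) (sphere_cellE cc' cx').
  apply/seteqP; split => [x [c cc cx]|x Sx]; first exact: (sphere_cell_sub cc cx).
  exists (cell_at x); [exact: sphere_cells_at|exact: mem_cell_at].
- move=> c _; apply: Or31; exists id; last by rewrite image_id.
  apply: (homeo_onI (g := id)) => //; apply: continuous_subspaceT => x; exact: cvg_id.
- move=> c cc; have [v [[c0 cv] e [cphi Sphi] [hphi bd] _]] := FP c cc.
  split => //; first by move=> _ [y cy <-]; exact: Sphi.
  exists [set c' | sphere_cells r c' /\ (dim c' < dim c)%N]; split.
  + by apply: sub_finite_set finite_sphere_cells => ? [].
  + by move=> ? [].
  + by move=> ? [].
  + move=> _ [y [cy ny] <-]; have Sy := Sphi y cy.
    exists (cell_at (phi c y)); last exact: mem_cell_at.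
    split; first exact: sphere_cells_at.
    rewrite (dimP _ _ (sphere_cells_at Sy) (root_type_le _) (@cell_at_stratum _)).
    exact: bd.
- move=> Y YS H; apply: closed_subspaceW.
  have -> : Y = \bigcup_(c in @sphere_cells R d r) (phi c @` (@cball R (dim c) `&` phi c @^-1` Y)).
    apply/seteqP; split => [a Ya|a [c cc [y [_ Yy] <-]] //].
    have Sa := YS _ Ya; have cc := sphere_cells_at Sa.
    exists (cell_at a) => //; have [v [_ _ _ [[[_ _ fs] _ _] _] _]] := FP _ cc.
    have [y oy ey] := fs _ (mem_cell_at Sa); exists y => //.
    by split; [exact: ltW|rewrite /preimage /= /phi ey].
  apply: closed_bigcup => [|c cc]; first exact: finite_sphere_cells.
  have [v [_ _ [cphi _] _ _]] := FP c cc.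
  have cB : compact (@cball R (dim c)) by exact: compact_dot.
  have clB : closed (@cball R (dim c)) by apply: compact_closed cB; exact: hausdorff_rV.
  have := H c cc; rewrite (closed_inE clB (@subIsetl _ _ _)) => h.
  rewrite -(setIidr (@subIsetl _ (@cball R (dim c)) (phi c @^-1` Y))).
  by apply: compact_closed_image => //; exact: hausdorff_rV.
Qed.

End SphereComplex.

Theorem theorem4p1 (R : realType) (d : nat) (w : seq nat) (alpha : R)
    (hd : (1 <= d)%N) (hw : Omega_le d w) :
  (* (1) *)
  homeomorphic (@stratum R d w) (@oball R (d - rnorm w)) /\
  (* (2) *)
  [/\ (w <> [:: d] -> is_closed_ball R (@sigma R d w) (d%:Z - (rnorm w)%:Z - 1)),
      (w = [:: d] -> homeomorphic (@sigma R d w) (@sphere R 1 1)),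
      is_closed_ball R (@sigma_bal R d w alpha) (d%:Z - (rnorm w)%:Z - 2),
      is_positive_cone R (@ecell R d w) (@sigma R d w) &
      is_positive_cone R (@ecell_bal R d w alpha) (@sigma_bal R d w alpha)] /\
  (* (3) *)
  (forall w1 : seq nat, Omega_le d w1 ->
    cell_complex R (closure (@stratum R d w1))
      [set v | Omega_le d v /\ succeq w1 v]
      (@stratum R d) (fun v => (d - rnorm v)%N)
      (@ecell R d) (@ecello R d) (@Phi R d) /\
    (forall v : seq nat, Omega_le d v -> succeq w1 v ->
      @Phi R d v @` (@ecell R d v `\` @ecello R d v) `<=`
        closure (@stratum R d v) `\` @stratum R d v)) /\
  (* (4) *)
  (exists Psi : R -> 'rV[R]_d -> 'rV[R]_d,
    [/\ is_flow Psi,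
        (forall x, stationary Psi x <-> x = 0) /\ is_source Psi 0,
        (forall r : R, 0 < r -> transversal_to_sphere Psi r),
        (forall (v : seq nat) (t : R), Omega_le d v ->
           Psi t @` stratum v = stratum v) &
        (cell_complex R [set: 'rV[R]_d] (Omega_le d)
           (@stratum R d) (fun v => (d - rnorm v)%N)
           (@ecell R d) (@ecello R d) (@Phi R d) /\
         forall r : R, 0 < r ->
           let q (p : R * 'rV[R]_d) := if p.1 == 0 then 0 else Psi (ln p.1) p.2 in
           [/\ cone_map [set: 'rV[R]_d] (@sphere R d r) 0 q,
               (forall v : seq nat, Omega_le d v ->
                  q @` ([set t : R | 0 < t] `*` (stratum v `&` sphere r)) =
                  stratum v `\ 0) &
               exists (dim : set 'rV[R]_d -> nat)
                      (phi : forall c, 'rV[R]_(dim c) -> 'rV[R]_d),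
                 [/\ (forall c (v : seq nat), sphere_cells r c -> Omega_le d v ->
                        c `<=` stratum v -> dim c = (d - rnorm v - 1)%N),
                     cell_complex R (@sphere R d r) (@sphere_cells R d r) id dim
                       (fun c => @cball R (dim c)) (fun c => @oball R (dim c)) phi &
                     forall v : seq nat, Omega_le d v -> v <> [:: d] ->
                       let c := stratum v `&` sphere r in
                       exists2 h : cell_space R d v -> 'rV[R]_(dim c),
                         homeo_on (@sigma R d v) (@cball R (dim c)) h &
                         forall D, @sigma R d v D ->
                           exists2 t : R, 0 < t & Phi D = q (t, phi c (h D))]])]).
Proof.
split.
  apply: homeomorphic_trans (ecello_oball R hw hd).
  by apply: homeomorphic_sym; exists (@Phi R d w); exact: Phi_homeo.
split.
  split; [exact: sigma_ball|exact: sigma_sphere|exact: sigma_bal_ball|exact: cone_ecell|].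
  exact: cone_ecell_bal.
split.
  move=> w1 hw1; split; first exact: closure_complex.
  by move=> v hv _; exact: attaching_maps.
exists (@flow R d); split.
- exact: is_flow_flow.
- by split; [exact: flow_stationary|exact: flow_source].
- exact: flow_transversal.
- by move=> v t hv; exact: flow_stratum.
split; first exact: space_complex.
move=> r r0 q; split.
- exact: cone_sphere.
- by move=> v hv; exact: cone_param_stratum.
- exact: sphere_complex.
Qed.
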